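(* Let $d\ge 2$ and let $E\subset\mathbb{R}^d$ be a bounded convex set with nonempty interior. Then a set of the form $rE+x$, where $r\ge 1$ and $x\in\mathbb{R}^d$, can be reconstructed using $d+1$ sets.
   Context: $\lambda^d$ denotes Lebesgue measure on $\mathbb{R}^d$. For a family $\mathcal{A}$ of Lebesgue measurable subsets of $\mathbb{R}^d$ of finite measure, an element of $\mathcal{A}$ can be reconstructed using $n$ (test) sets if there exist measurable sets $T_1,\ldots,T_n\subset\mathbb{R}^d$ such that whenever $A,B\in\mathcal{A}$ and $\lambda^d(A\cap T_i)=\lambda^d(B\cap T_i)$ for every $i=1,\ldots,n$, then $A=B$. Here the family is $\{rE+x: r\ge 1,\ x\in\mathbb{R}^d\}$. *)

(* Defs.v *)
From mathcomp Require Import all_boot all_order all_algebra.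
From mathcomp Require Import all_classical all_reals all_analysis.

Set Implicit Arguments.
Unset Strict Implicit.
Unset Printing Implicit Defensive.
Import Order.TTheory GRing.Theory Num.Theory.
Import numFieldNormedType.Exports.
Local Open Scope classical_set_scope.
Local Open Scope ring_scope.

Definition box (R : realType) (d : nat) (B : 'rV[R]_d * 'rV[R]_d) :
    set 'rV[R]_d :=
  [set x | forall i, x 0 i \in `]B.1 0 i, B.2 0 i]].

Definition box_volume (R : realType) (d : nat) (B : 'rV[R]_d * 'rV[R]_d) : R :=
  \prod_(i < d) Num.max 0 (B.2 0 i - B.1 0 i).

(* Lebesgue outer measure on R^d, for d > 0 (in dimension 0 no box is empty,
   so that the empty set would get measure +oo). It is total; its restriction
   to [lebesgue_measurable] is the (complete) Lebesgue measure. *)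
Definition lebesgue_rV (R : realType) (d : nat) (A : set 'rV[R]_d) : \bar R :=
  ereal_inf [set (\sum_(k <oo) (box_volume (B k))%:E)%E |
    B in [set B : nat -> 'rV[R]_d * 'rV[R]_d | A `<=` \bigcup_k box (B k)]].

Definition lebesgue_measurable (R : realType) (d : nat) :
    set (set 'rV[R]_d) :=
  (@lebesgue_rV R d).-caratheodory.

(* The first conjunct is the standing requirement on families for which
   reconstruction is considered. *)
Definition reconstructible (R : realType) (d : nat) (F : set (set 'rV[R]_d))
    (n : nat) : Prop :=
  (forall A, F A -> lebesgue_measurable A /\ (lebesgue_rV A < +oo)%E) /\
  exists T : 'I_n -> set 'rV[R]_d,
    (forall i, lebesgue_measurable (T i)) /\
    forall A B, F A -> F B ->
      (forall i, lebesgue_rV (A `&` T i) = lebesgue_rV (B `&` T i)) -> A = B.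

Definition magnified_copies (R : realType) (d : nat) (E : set 'rV[R]_d) :
    set (set 'rV[R]_d) :=
  [set A | exists (r : R) (x : 'rV[R]_d),
    1 <= r /\ A = [set r *: y + x | y in E]].

(* Main.v *)
Require Import Defs.
From HB Require Import structures.
From mathcomp Require Import all_boot all_order all_algebra.
From mathcomp Require Import all_classical all_reals all_analysis.
From mathcomp Require Import measurable_realfun ring lra zify.
Import Order.TTheory GRing.Theory Num.Theory.
Import numFieldNormedType.Exports.
Local Open Scope classical_set_scope.
Local Open Scope ring_scope.
Set Implicit Arguments.
Unset Strict Implicit.
Unset Printing Implicit Defensive.

(** The whole space as a test set gives [r]. Every other test set is a union of
    slabs [{y | c y \in S}] orthogonal to a linear form [c], where [S] meets the
    interval between the integers [n] and [n + 1] in [M n] equally spaced intervals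
    of total length [dens n], and [dens] increases from 0 to 1. If [H t] is the
    volume of the part of the closure [K] of [E] at height less than [t] and
    [f = H'], then the derivative of vol((r K + x) & T) along [c] is, up to a
    positive factor, the sum of [f] at the left ends minus that at the right ends of
    the intervals of [S], suitably rescaled. Were [f] affine on each block
    [n, n + 1], this would be (by Abel summation) a positive combination of the
    increments of [dens]; the deviation is a sum of chord gaps of [f], and it is
    made smaller than this gain by refining the slabs. So for each [r] the volume
    determines [c x].

    The chord gap estimate has to be uniform in [r >= 1] and [x]. It needs
    that [f] vanishes at both ends of [[0, 4]] and is controlled by [sqrt] there,
    and this holds if the caps of [K] in direction [c] have diameter
    [O(sqrt height)]. Such a [c] arises from a pair of points of [K] at maximal
    distance for some Euclidean norm. Norms which exaggerate the coordinate [i]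
    yield forms [c_i] dominated by their [i]-th coefficient; these are linearly
    independent, so that the numbers [c_i x] determine [x]. *)

(** * Chord gaps *)

(** The test sets must not depend on [r] or [x], and this shapes the argument. The slabs have to
    extend over all heights, since far copies miss a bounded union, and the gain then has no
    positive lower bound: it tends to 0 as a copy moves away. Yet the error granted to block [n] is
    fixed by [n] alone. If [|n|] is at least of order [sqrt r], the index controls the size of the
    copy and a grant decaying in [n] stays below the gain; blocks nearer to the origin meet copies
    of unbounded size, and there the square-root modulus of [f] is used instead. The condition
    [r >= 1] enters because the mesh of a block, seen from the copy, is divided by [r]. The
    dimension enters through [f]: for an interval [f] would jump at the ends of its support, and no
    refinement removes the chord gap of a jump. Inside the support [f] is merely Lipschitz, so a
    single gap has the order of the mesh and the sum is only seen to be bounded; that it tends to 0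
    is an energy argument. *)

Section chord_gap.
Context {R : realType}.
Implicit Types (u v g : R -> R) (p c h : R).

Definition chord_gap u p a h : R := (1 - p) * u a + p * u (a + h) - u (a + p * h).

Definition gap_sum u p c h M : R := \sum_(j < M) `|chord_gap u p (c + j%:R * h) h|.

Lemma gap_sum_add u v p c h M :
  gap_sum (fun t => u t + v t) p c h M <= gap_sum u p c h M + gap_sum v p c h M.
Proof.
rewrite -big_split/=; apply: ler_sum => j _.
apply: le_trans (ler_normD _ _); rewrite le_eqVlt; apply/orP; left; apply/eqP.
by congr (`| _ |); rewrite /chord_gap; ring.
Qed.

Lemma gap_sumZ k u p c h M :
  gap_sum (fun t => k * u t) p c h M = `|k| * gap_sum u p c h M.
Proof.
rewrite /gap_sum mulr_sumr; apply: eq_bigr => j _; rewrite -normrM.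
by congr (`| _ |); rewrite /chord_gap; ring.
Qed.

Lemma gap_sum_cst k p c h M : gap_sum (fun=> k) p c h M = 0.
Proof.
rewrite /gap_sum big1// => j _; apply/normr0P/eqP; rewrite /chord_gap; ring.
Qed.

Lemma gap_sum_sum (I : Type) (s : seq I) (F : I -> R -> R) p c h M :
  gap_sum (fun t => \sum_(i <- s) F i t) p c h M <=
  \sum_(i <- s) gap_sum (F i) p c h M.
Proof.
elim: s => [|i s IH].
  rewrite big_nil (_ : (fun _ => _) = fun=> 0) ?gap_sum_cst//.
  by apply/funext => t; rewrite big_nil.
rewrite big_cons; under eq_fun do rewrite big_cons.
by apply: le_trans (gap_sum_add _ _ _ _ _ _) _; rewrite lerD2l.
Qed.

(** A chord gap is a convex combination, up to signs, of the increments of [u] on the two parts of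
    its cell. Bounding these by [g] makes the sum telescope, whatever the number of cells; the slack
    [e] is paid twice per cell. *)
Lemma gap_sum_gauge u g e p c h M : 0 <= p <= 1 -> 0 <= h ->
  (forall s t, s <= t -> `|u t - u s| <= g t - g s + e) ->
  gap_sum u p c h M <= g (c + M%:R * h) - g c + 2 * M%:R * e.
Proof.
move=> /andP[p0 p1] h0 ug; rewrite /gap_sum.
elim: M => [|M IH]; first by rewrite big_ord0 !mul0r addr0 mulr0 mul0r subrr addr0.
rewrite big_ord_recr/=.
set a := c + M%:R * h in IH *.
have aE : c + M.+1%:R * h = a + h by rewrite /a -natr1; ring.
rewrite aE.
have h1 : p * h <= h by rewrite ler_piMl.
have h2 : 0 <= p * h by rewrite mulr_ge0.
have g1 : `|u (a + p * h) - u a| <= g (a + p * h) - g a + e by apply: ug; rewrite lerDl.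
have g2 : `|u (a + h) - u (a + p * h)| <= g (a + h) - g (a + p * h) + e.
  by apply: ug; rewrite lerD2l.
have : `|chord_gap u p a h| <= `|u (a + p * h) - u a| + `|u (a + h) - u (a + p * h)|.
  rewrite (_ : chord_gap _ _ _ _ = (1 - p) * - (u (a + p * h) - u a) +
     p * (u (a + h) - u (a + p * h))); last by rewrite /chord_gap; ring.
  apply: le_trans (ler_normD _ _) _; rewrite !normrM normrN.
  rewrite (ger0_norm p0) (ger0_norm (_ : 0 <= 1 - p)) ?subr_ge0//.
  by apply: lerD; apply: ler_piMl => //; lra.
rewrite -natr1; lra.
Qed.

(** The hinge is affine away from [t0], so only the cell around [t0] has a gap, of size at most [h].
    The step function [H] in the proof records whether that cell has been passed. *)
Lemma gap_sum_hinge t0 p c h M : 0 <= p <= 1 -> 0 <= h ->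
  gap_sum (fun t => Num.max (t - t0) 0) p c h M <= h.
Proof.
move=> /andP[p0 p1] h0; pose H (t : R) : R := (t0 < t)%R%:R.
suff : gap_sum (fun t => Num.max (t - t0) 0) p c h M <=
    h * (H (c + M%:R * h) - H c).
  move=> /le_trans; apply; rewrite ler_piMr//.
  have H01 t : 0 <= H t <= 1 by rewrite /H; case: ltP; rewrite ?lexx ler01.
  by have := H01 c; have := H01 (c + M%:R * h); lra.
rewrite /gap_sum; elim: M => [|M IH]; first by rewrite big_ord0 mul0r addr0 subrr mulr0.
rewrite big_ord_recr/=; set a := c + M%:R * h in IH *.
have aE : c + M.+1%:R * h = a + h by rewrite /a -natr1; ring.
rewrite aE.
have h1 : p * h <= h by rewrite ler_piMl.
have h2 : 0 <= p * h by rewrite mulr_ge0.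
suff : `|chord_gap (fun t => Num.max (t - t0) 0) p a h| <= h * (H (a + h) - H a) by lra.
rewrite /chord_gap /H ler_norml.
have k1 : p * (a + h - t0) = p * (a - t0) + p * h by ring.
have k2 : (1 - p) * (a - t0) = (a - t0) - p * (a - t0) by ring.
have k3 : 0 <= (1 - p) * h by rewrite mulr_ge0//; lra.
case: (leP (a - t0) 0) => a0; case: (leP (a + h - t0) 0) => b0;
  case: (leP (a + p * h - t0) 0) => c0; case: (ltP t0 a) => d0;
  case: (ltP t0 (a + h)) => e0; rewrite ?mulr1n ?mulr0n; try lra.
- have : 0 <= p * (a + h - t0) by rewrite mulr_ge0//; lra.
  have : p * (a - t0) <= 0 by rewrite mulr_ge0_le0.
  lra.
- have : (1 - p) * (a - t0) <= 0 by rewrite mulr_ge0_le0//; lra.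
  have : 0 <= (1 - p) * (a - t0 + h) by rewrite mulr_ge0//; lra.
  lra.
Qed.

Definition clip (a b t : R) : R := Num.max a (Num.min t b).

Lemma clip_itv a b t : a <= b -> a <= clip a b t <= b.
Proof.
by move=> ab; rewrite /clip; case: (leP t b) => ?;
  [case: (leP a t)|case: (leP a b)] => ?; lra.
Qed.

Lemma clip_lip a b s t : a <= b -> s <= t ->
  0 <= clip a b t - clip a b s <= t - s.
Proof.
move=> ab st; rewrite /clip; case: (leP t b) => ?; case: (leP s b) => ?;
 case: (leP a s) => ?; case: (leP a t) => ?; case: (leP a b) => ?; lra.
Qed.

Lemma clip_id a b t : a <= t -> t <= b -> clip a b t = t.
Proof. by move=> at_ tb; rewrite /clip (min_l tb) (max_r at_). Qed.

Lemma clip_lt a b t : a <= b -> t <= a -> clip a b t = a.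
Proof.
by move=> ab ta; rewrite /clip (min_l (le_trans ta ab)) (max_l ta).
Qed.

Lemma clip_gt a b t : a <= b -> b <= t -> clip a b t = b.
Proof. by move=> ab tb; rewrite /clip (min_r tb) (max_r ab). Qed.

End chord_gap.

(** * Piecewise linear interpolation and discrete energy *)

Section dyadic_energy.
Context {R : realType}.
Implicit Types (u v g : R -> R) (D K : R).

Lemma sum_blocks (F : nat -> R) a b :
  \sum_(i < a * b) F i = \sum_(i < a) \sum_(j < b) F (i * b + j)%N.
Proof.
elim: a => [|a IH]; first by rewrite mul0n !big_ord0.
rewrite big_ord_recr/= -IH mulSnr -[LHS](big_mkord xpredT F).
rewrite (@big_cat_nat _ _ _ (a * b)) ?leq_addr//= big_mkord; congr (_ + _).
rewrite -{1}[(a * b)%N]add0n big_addn addKn big_mkord.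
by apply: eq_bigr => j _; rewrite addnC.
Qed.

Lemma normr_hinge (a b : R) : `|Num.max a 0 - Num.max b 0| <= `|a - b|.
Proof.
case: (leP a 0) => a0; case: (leP b 0) => b0; rewrite ?subrr ?normr0//.
- by rewrite sub0r normrN gtr0_norm// ltr0_norm ?opprB; lra.
- by rewrite subr0 gtr0_norm// gtr0_norm; lra.
Qed.

Definition grid D N i : R := i%:R * D / N%:R.

(* The piecewise linear interpolation of [u] on the grid, as a sum of hinges, whose
   chord gaps are bounded by the mesh ([gap_sum_hinge]). *)
Definition pl u D N t : R := u 0 + \sum_(i < N)
  (u (grid D N i.+1) - u (grid D N i)) * N%:R / D *
  (Num.max (t - grid D N i) 0 - Num.max (t - grid D N i.+1) 0).

(** This is [D] times the Dirichlet integral of the interpolation of [u] on the grid. *)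
Definition energy u D N : R :=
  \sum_(i < N) (u (grid D N i.+1) - u (grid D N i)) ^+ 2 * N%:R.

Lemma grid_refine D N B i : (0 < B)%N -> grid D (N * B) (i * B) = grid D N i.
Proof.
move=> B0; rewrite /grid !natrM.
have [->|N0] := eqVneq (N%:R : R) 0; first by rewrite mul0r invr0 !mulr0.
by field; rewrite N0 pnatr_eq0 -lt0n B0.
Qed.

Lemma grid_step D N i : grid D N i.+1 = grid D N i + D / N%:R.
Proof. by rewrite /grid -natr1; ring. Qed.

Lemma le_grid D N i j : 0 <= D -> (i <= j)%N -> grid D N i <= grid D N j.
Proof.
move=> D0 ij; rewrite /grid ler_wpM2r ?invr_ge0// ler_wpM2r// ler_nat//.
Qed.

(** Each difference of hinges in [pl] is constant off its own coarse cell, so only the [i]-th term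
    moves on a fine cell inside coarse cell [i]. *)
Lemma pl_step u D N B i j : 0 < D -> (0 < N)%N -> (i < N)%N -> (j < B)%N ->
  pl u D N (grid D (N * B) (i * B + j).+1) - pl u D N (grid D (N * B) (i * B + j)) =
  (u (grid D N i.+1) - u (grid D N i)) / B%:R.
Proof.
move=> D0 N0 iN jB.
have B0 : (0 < B)%N by exact: leq_ltn_trans jB.
have lo : grid D N i <= grid D (N * B) (i * B + j).
  by rewrite -(@grid_refine D N B)//; apply: le_grid; rewrite ?ltW// leq_addr.
have hi : grid D (N * B) (i * B + j).+1 <= grid D N i.+1.
  by rewrite -(@grid_refine D N B)//; apply: le_grid; rewrite ?ltW// mulSn addnC ltn_add2r.
have mi : grid D (N * B) (i * B + j) <= grid D (N * B) (i * B + j).+1.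
  by apply: le_grid; rewrite ?ltW.
have st := grid_step D (N * B) (i * B + j).
set y := grid D (N * B) (i * B + j) in lo hi mi st *.
set y' := grid D (N * B) (i * B + j).+1 in hi mi st *.
rewrite /pl opprD addrACA subrr add0r -sumrB (bigD1 (Ordinal iN))//=.
rewrite [X in _ + X]big1 ?addr0 => [|k /eqP ki].
  rewrite (max_l (_ : 0 <= y' - grid D N i)) ?(max_r (_ : y' - grid D N i.+1 <= 0))
    ?(max_l (_ : 0 <= y - grid D N i)) ?(max_r (_ : y - grid D N i.+1 <= 0)); try lra.
  rewrite st natrM; field.
  by rewrite gt_eqF ?ltr0n// gt_eqF// gt_eqF// ltr0n.
case: (ltngtP k i) => kj; last by case: ki; apply/val_inj.
  have k1 : grid D N k.+1 <= grid D N i by apply: le_grid => //; exact: ltW.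
  have k2 : grid D N k <= grid D N k.+1 by apply: le_grid => //; exact: ltW.
  by rewrite !max_l; [ring|lra..].
have k1 : grid D N i.+1 <= grid D N k by apply: le_grid => //; exact: ltW.
have k2 : grid D N k <= grid D N k.+1 by apply: le_grid => //; exact: ltW.
by rewrite !max_r; [ring|lra..].
Qed.

(* Pythagoras: on every coarse cell the increments of [u - pl u] sum to 0. *)
Lemma energy_refine u D N B : 0 < D -> (0 < N)%N -> (0 < B)%N ->
  energy (fun t => u t - pl u D N t) D (N * B) = energy u D (N * B) - energy u D N.
Proof.
move=> D0 N0 B0; pose F w i : R := (w (grid D (N * B) i.+1) - w (grid D (N * B) i)) ^+ 2 * (N * B)%:R.
rewrite /energy -!/(\sum_(i < N * B) F _ i) (sum_blocks (F u)).
rewrite (sum_blocks (F (fun t => u t - pl u D N t))).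
rewrite /F -sumrB; apply: eq_bigr => i _.
set A := u (grid D N i.+1) - u (grid D N i).
pose a j := u (grid D (N * B) (i * B + j).+1) - u (grid D (N * B) (i * B + j)).
have sa : \sum_(j < B) a j = A.
  rewrite -(big_mkord xpredT a) /a.
  rewrite (eq_bigr (fun j => u (grid D (N * B) (i * B + j.+1)) -
     u (grid D (N * B) (i * B + j)))) => [|j _]; last by rewrite addnS.
  rewrite (telescope_sumr (fun j => u (grid D (N * B) (i * B + j))))//.
  by rewrite addn0 -mulSnr !grid_refine.
rewrite (eq_bigr (fun j : 'I_B => (N * B)%:R * (a j ^+ 2) - (2 * N%:R * A) * a j
    + N%:R * A ^+ 2 / B%:R)) => [|j _]; last first.
  rewrite [X in X ^+ 2](_ : _ = a j - A / B%:R); last first.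
    by rewrite /A -(pl_step u D0 N0 (ltn_ord i) (ltn_ord j)) /a; ring.
  rewrite natrM; field; by rewrite pnatr_eq0 -lt0n.
rewrite big_split/= sumrB -!mulr_sumr sa sumr_const card_ord -mulr_natr.
rewrite -mulr_suml [X in _ = X - _]mulrC.
field; by rewrite pnatr_eq0 -lt0n.
Qed.

Lemma energy_le u D K N : 0 <= D -> (0 < N)%N ->
  (forall s t, `|u t - u s| <= K * `|t - s|) -> energy u D N <= (K * D) ^+ 2.
Proof.
move=> D0 N0 uK; rewrite /energy.
have N0' : 0 < N%:R :> R by rewrite ltr0n.
apply: (@le_trans _ _ (\sum_(i < N) (K * D) ^+ 2 / N%:R)).
  apply: ler_sum => i _; rewrite -ler_pdivlMr// -[_ ^+ 2]real_normK ?num_real//.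
  apply: (@le_trans _ _ ((K * (D / N%:R)) ^+ 2)).
    rewrite ler_sqr ?nnegrE ?normr_ge0//; last first.
      have := le_trans (normr_ge0 _) (uK 0 (D / N%:R)).
      by rewrite subr0 ger0_norm ?divr_ge0.
    apply: le_trans (uK _ _) _.
    by rewrite grid_step [grid _ _ _ + _]addrC addrK ger0_norm ?divr_ge0.
  by rewrite le_eqVlt; apply/orP; left; apply/eqP; field; rewrite gt_eqF.
rewrite sumr_const card_ord -mulr_natr.
by rewrite le_eqVlt; apply/orP; left; apply/eqP; field; rewrite gt_eqF.
Qed.

(** Cauchy-Schwarz, in the form [b <= b^2 N / (2 tau) + tau / (2 N)] for each term. *)
Lemma sum_normr_energy (v : R -> R) D N tau : 0 < tau -> (0 < N)%N ->
  energy v D N <= tau ^+ 2 ->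
  \sum_(i < N) `|v (grid D N i.+1) - v (grid D N i)| <= tau.
Proof.
move=> t0 N0 vt.
have N0' : 0 < N%:R :> R by rewrite ltr0n.
apply: (@le_trans _ _ (\sum_(i < N)
  ((v (grid D N i.+1) - v (grid D N i)) ^+ 2 * N%:R / (2 * tau) + tau / (2 * N%:R)))).
  apply: ler_sum => i _; set a := _ - _.
  rewrite -[a ^+ 2]real_normK ?num_real//; set b := `|a|.
  have -> : b ^+ 2 * N%:R / (2 * tau) + tau / (2 * N%:R) =
      b + (N%:R * b - tau) ^+ 2 / (2 * tau * N%:R).
    by field; rewrite !gt_eqF.
  by rewrite lerDl divr_ge0 ?sqr_ge0// !mulr_ge0// ltW.
rewrite big_split/= sumr_const card_ord -mulr_suml.
rewrite [X in _ + X](_ : _ = tau / 2); last first.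
  by rewrite -[LHS]mulr_natr; field; rewrite gt_eqF.
have : energy v D N / (2 * tau) <= tau ^+ 2 / (2 * tau).
  by rewrite ler_wpM2r// invr_ge0 mulr_ge0// ltW.
have -> : tau ^+ 2 / (2 * tau) = tau / 2 by field; rewrite gt_eqF.
rewrite /energy; lra.
Qed.

Lemma pl_lipschitz u D N s t :
  `|pl u D N t - pl u D N s| <= (\sum_(i < N)
  `|(u (grid D N i.+1) - u (grid D N i)) * N%:R / D| * 2) * `|t - s|.
Proof.
rewrite /pl opprD addrACA subrr add0r -sumrB mulr_suml.
apply: le_trans (ler_norm_sum _ _ _) _; apply: ler_sum => i _.
rewrite -mulrBr normrM -[leRHS]mulrA ler_wpM2l ?normr_ge0//.
have h1 := normr_hinge (t - grid D N i) (s - grid D N i).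
have h2 := normr_hinge (t - grid D N i.+1) (s - grid D N i.+1).
have e1 : t - grid D N i - (s - grid D N i) = t - s by ring.
have e2 : t - grid D N i.+1 - (s - grid D N i.+1) = t - s by ring.
rewrite e1 in h1; rewrite e2 in h2.
rewrite opprD addrACA opprK [X in _ + X]addrC.
rewrite -[_ - Num.max (t - _) 0]opprB.
by apply: le_trans (ler_normB _ _) _; lra.
Qed.

Lemma pl_lt0 u D N t : 0 <= D -> t <= 0 -> pl u D N t = u 0.
Proof.
move=> D0 t0; rewrite /pl big1 ?addr0// => i _.
have g0 k : 0 <= grid D N k by rewrite /grid divr_ge0// mulr_ge0.
by rewrite !max_r ?subrr ?mulr0// subr_le0 (le_trans t0).
Qed.

Lemma pl_gtD u D N t : 0 <= D -> (0 < N)%N -> D <= t -> pl u D N t = pl u D N D.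
Proof.
move=> D0 N0 t0; rewrite /pl; congr (_ + _); apply: eq_bigr => i _.
have g0 k : (k <= N)%N -> grid D N k <= D.
  move=> kN; rewrite /grid ler_pdivrMr ?ltr0n// mulrC ler_wpM2l// ler_nat//.
have gi := g0 i (ltnW (ltn_ord i)); have gi1 := g0 i.+1 (ltn_ord i).
rewrite !max_l ?subr_ge0// ?(le_trans gi) ?(le_trans gi1)//.
by congr (_ * _); ring.
Qed.

End dyadic_energy.

Section lipschitz_gap.
Context {R : realType}.
Variables (u : R -> R) (D K : R).
Hypotheses (D0 : 0 < D) (uK : forall s t, `|u t - u s| <= K * `|t - s|).
Hypotheses (u_lt0 : forall t : R, t <= 0 -> u t = u 0) (u_gtD : forall t : R, D <= t -> u t = u D).

Lemma energy_max (tau : R) : 0 < tau -> exists2 N, (0 < N)%N &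
  forall k, energy u D (N * 2 ^ k) - energy u D N <= tau.
Proof.
move=> t0; pose S := [set energy u D (2 ^ n) | n in setT].
have S0 : has_sup S.
  split; first by exists (energy u D (2 ^ 0)); exists 0%N.
  by exists ((K * D) ^+ 2) => _ [n _ <-]; apply: energy_le; rewrite ?expn_gt0// ltW.
have [_ [n _ <-] nS] := sup_adherent t0 S0.
exists (2 ^ n)%N => [|k]; first by rewrite expn_gt0.
have : energy u D (2 ^ n * 2 ^ k) <= sup S.
  by apply: sup_upper_bound => //; exists (n + k)%N; rewrite ?expnD.
lra.
Qed.

(* [energy u D (N * 2 ^ k)] is bounded and nondecreasing in [k], hence almost
   constant from some [N] on; then [u - pl u] has small variation at all dyadic
   scales below [D / N]. *)
Lemma pl_approx (tau : R) : 0 < tau -> exists2 N, (0 < N)%N &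
  forall e : R, 0 < e -> exists2 g : R -> R, (forall t, 0 <= g t <= tau) &
  forall s t, s <= t ->
    `|(u t - pl u D N t) - (u s - pl u D N s)| <= g t - g s + e.
Proof.
move=> t0; have t20 : 0 < tau ^+ 2 by rewrite exprn_gt0.
have [N N0 EN] := energy_max t20; exists N => // e e0.
pose v t := u t - pl u D N t.
pose L := \sum_(i < N) `|(u (grid D N i.+1) - u (grid D N i)) * N%:R / D| * 2.
have vL s t : `|v t - v s| <= (K + L) * `|t - s|.
  rewrite (_ : v t - v s = (u t - u s) - (pl u D N t - pl u D N s)); last first.
    by rewrite /v; ring.
  rewrite mulrDl; apply: le_trans (ler_normB _ _) _.
  by apply: lerD => //; exact: pl_lipschitz.
have v0 (t : R) : t <= 0 -> v t = v 0.
  by move=> t0'; rewrite /v u_lt0// !pl_lt0// ltW.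
have vD t : D <= t -> v t = v D.
  by move=> tD; rewrite /v u_gtD// pl_gtD// ltW.
have L0 : 0 <= K + L.
  have := le_trans (normr_ge0 _) (vL 0 1).
  by rewrite subr0 normr1 mulr1.
(* [v] is Lipschitz, so a fine enough dyadic refinement makes its oscillation on a fine cell at most
   [e / 2]. *)
have [k kP] : exists k, (K + L) * D / (N * 2 ^ k)%:R <= e / 2.
  pose x := (K + L) * D / (e / 2).
  exists (Num.truncn x).+1.
  have x0 : 0 <= x by rewrite /x divr_ge0// ?mulr_ge0// ltW// divr_gt0.
  have h1 : x < ((Num.truncn x).+1)%:R by apply: truncnS_gt.
  have h2 : ((Num.truncn x).+1 <= N * 2 ^ (Num.truncn x).+1)%N.
    by apply: leq_trans (ltnW (ltn_expl _ (ltnSn 1))) _; rewrite leq_pmull.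
  rewrite ler_pdivrMr; last by rewrite ltr0n muln_gt0 N0 expn_gt0.
  rewrite [leRHS]mulrC -ler_pdivrMr ?divr_gt0// -/x.
  by apply/ltW/(lt_le_trans h1); rewrite ler_nat.
have B0 : (0 < 2 ^ k)%N by rewrite expn_gt0.
have EB := energy_refine u D0 N0 B0.
move: (EN k) B0 kP EB; set B := (2 ^ k)%N; rewrite -/v => EB B0 kP EBv.
pose M := (N * B)%N; rewrite -/M in EB kP EBv.
have M0 : (0 < M)%N by rewrite muln_gt0 N0.
have M0' : 0 < M%:R :> R by rewrite ltr0n.
rewrite -EBv in EB.
have W1 := sum_normr_energy t0 M0 EB.
(* [W] is the variation of [v] along the fine grid, at most [tau] in total by [W1]. The gauge is [W]
   at the grid index just below [t]; rounding both end points costs [e / 2] each. *)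
pose W i := \sum_(0 <= j < i) `|v (grid D M j.+1) - v (grid D M j)|.
have leW i j : (i <= j)%N -> `|v (grid D M j) - v (grid D M i)| <= W j - W i.
  move=> ij; rewrite /W (@big_cat_nat _ _ _ i 0 j)//= [leRHS]addrC addKr.
  rewrite -(telescope_sumr (fun k => v (grid D M k)))//.
  exact: ler_norm_sum.
pose rho t := Num.truncn (M%:R * clip 0 D t / D).
have rho_le t : grid D M (rho t) <= clip 0 D t.
  have /andP[c0 cD] := @clip_itv _ 0 D t (ltW D0).
  rewrite /grid -ler_pdivlMr ?invr_gt0// invrK -ler_pdivlMr// [clip 0 D t * _]mulrC.
  by rewrite truncn_le// divr_ge0// ?mulr_ge0// ltW.
have rho_gt t : clip 0 D t - grid D M (rho t) <= D / M%:R.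
  have : clip 0 D t < grid D M (rho t).+1.
    rewrite /grid -ltr_pdivrMr ?invr_gt0// invrK -ltr_pdivrMr// [clip 0 D t * _]mulrC.
    exact: truncnS_gt.
  by rewrite grid_step; lra.
have rho_M t : (rho t <= M)%N.
  have /andP[c0 cD] := @clip_itv _ 0 D t (ltW D0).
  rewrite -(ler_nat R); apply: le_trans (_ : M%:R * clip 0 D t / D <= _).
    by rewrite truncn_le// divr_ge0// ?mulr_ge0// ltW.
  by rewrite ler_pdivrMr// ler_wpM2l// ltW.
have leW' i j : (i <= j)%N -> W i <= W j.
  by move=> ij; have := le_trans (normr_ge0 _) (leW _ _ ij); rewrite subr_ge0.
exists (W \o rho) => [t|s t st] /=.
  have W0 : W 0%N = 0 by rewrite /W big_geq.
  rewrite -{1}W0 leW'//=; apply: le_trans (leW' _ _ (rho_M t)) _.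
  by rewrite /W big_mkord.
have vr r : `|v r - v (grid D M (rho r))| <= e / 2.
  have -> : v r = v (clip 0 D r).
    case: (leP r 0) => r0; first by rewrite clip_lt ?(ltW D0)// v0.
    case: (leP r D) => rD; first by rewrite clip_id// ltW.
    by rewrite clip_gt ?(ltW D0) ?vD// ltW.
  rewrite (le_trans (vL _ _))//.
  rewrite ger0_norm ?subr_ge0 ?rho_le// (le_trans _ kP)// -[leRHS]mulrA ler_wpM2l//.
have rst : (rho s <= rho t)%N.
  apply: le_truncn; rewrite ler_wpM2r ?invr_ge0 ?(ltW D0)// ler_wpM2l//.
  by have := clip_lip (ltW D0) st; rewrite subr_ge0 => /andP[].
rewrite -/(v t) -/(v s).
rewrite (_ : v t - v s = (v t - v (grid D M (rho t))) +
  (v (grid D M (rho t)) - v (grid D M (rho s))) - (v s - v (grid D M (rho s)))); last by ring.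
apply: le_trans (ler_normB _ _) _; apply: le_trans (lerD (ler_normD _ _) (lexx _)) _.
have := leW _ _ rst; have := vr t; have := vr s; lra.
Qed.

(** Split [u] into [u - pl u], whose variation is small up to the slack of [pl_approx], and [pl u],
    a fixed finite sum of hinges costing [O(h)] altogether. Both bounds are uniform in [c] and
    [M]. *)
Lemma gap_sum_lipschitz (e : R) : 0 < e -> exists2 h0, 0 < h0 &
  forall p c h M, 0 <= p <= 1 -> 0 <= h <= h0 -> gap_sum u p c h M <= e.
Proof.
move=> e0; have e20 : 0 < e / 4 by rewrite divr_gt0.
have [N N0 gN] := pl_approx e20.
pose s i := (u (grid D N i.+1) - u (grid D N i)) * N%:R / D.
pose L := \sum_(i < N) `|s i| * 2.
have L0 : 0 <= L by apply: sumr_ge0 => i _; rewrite mulr_ge0.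
exists (e / 4 / (L + 1)); first by rewrite divr_gt0// ltr_pwDr.
move=> p c h M p01 /andP[h0 hh].
have hL : L * h <= e / 4.
  have : (L + 1) * h <= e / 4 by rewrite mulrC -ler_pdivlMr// ltr_pwDr.
  by rewrite mulrDl; lra.
rewrite (_ : u = fun t => (u t - pl u D N t) + pl u D N t); last first.
  by apply/funext => t; rewrite subrK.
apply: le_trans (gap_sum_add _ _ _ _ _ _) _.
(* The slack may depend on [M]: in [pl_approx] the number [N], hence [h0], is chosen before it. *)
have pe : 0 < e / 4 / (2 * M%:R + 1) by rewrite divr_gt0// ltr_pwDr// mulr_ge0.
have [g g01 gP] := gN _ pe.
have g1 := gap_sum_gauge c M p01 h0 gP.
have g2 : gap_sum (pl u D N) p c h M <= L * h.
  rewrite {1}/pl; apply: le_trans (gap_sum_add _ _ _ _ _ _) _.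
  rewrite gap_sum_cst add0r.
  apply: le_trans (gap_sum_sum _ _ _ _ _ _) _.
  rewrite mulr_suml; apply: ler_sum => i _; rewrite gap_sumZ -[leRHS]mulrA ler_wpM2l//.
  have -> : (fun t => Num.max (t - grid D N i) 0 - Num.max (t - grid D N i.+1) 0) =
    (fun t => Num.max (t - grid D N i) 0 + (-1) * Num.max (t - grid D N i.+1) 0).
    by apply/funext => t; rewrite mulN1r.
  apply: le_trans (gap_sum_add _ _ _ _ _ _) _; rewrite gap_sumZ normrN1 mul1r.
  have := gap_sum_hinge (grid D N i) c M p01 h0.
  have := gap_sum_hinge (grid D N i.+1) c M p01 h0.
  lra.
have := g01 (c + M%:R * h); have := g01 c.
have : 2 * M%:R * (e / 4 / (2 * M%:R + 1)) <= e / 4.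
  rewrite mulrA ler_pdivrMr ?ltr_pwDr ?mulr_ge0// mulrC ler_wpM2l ?(ltW e20)//.
  by rewrite lerDl.
lra.
Qed.

End lipschitz_gap.

(** * Chord gaps under a square-root modulus at the ends *)

Section gauge.
Context {R : realType}.

Lemma sqrtr_subadd (s t : R) : s <= t -> Num.sqrt t <= Num.sqrt s + Num.sqrt (t - s).
Proof.
move=> st; have [s0|s0] := leP s 0.
  rewrite (ler0_sqrtr s0) add0r ler_wsqrtr//; lra.
rewrite -ler_sqr ?nnegrE ?addr_ge0 ?sqrtr_ge0// sqrrD !sqr_sqrtr; try lra.
have : 0 <= Num.sqrt s * Num.sqrt (t - s) by rewrite mulr_ge0 ?sqrtr_ge0.
lra.
Qed.

(* Increments of [psi] are at most of order [sqrt] near the ends of [[0, 4]] and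
   Lipschitz inside. *)
Definition psi (t : R) : R := Num.sqrt t - Num.sqrt (4 - t).

Lemma le_psi s t : s <= t -> psi s <= psi t.
Proof. by move=> st; rewrite /psi lerB// ler_wsqrtr// lerB. Qed.

Lemma psi_holder s t : s <= t -> psi t - psi s <= 2 * Num.sqrt (t - s).
Proof.
move=> st; have h1 := sqrtr_subadd st.
have h2 : Num.sqrt (4 - s) <= Num.sqrt (4 - t) + Num.sqrt (4 - s - (4 - t)).
  by apply: sqrtr_subadd; lra.
have e : 4 - s - (4 - t) = t - s by ring.
by rewrite e in h2; rewrite /psi; lra.
Qed.

Lemma sqrtr_lip (h s t : R) : 0 < h -> h <= s -> s <= t ->
  Num.sqrt t - Num.sqrt s <= (t - s) / Num.sqrt h.
Proof.
move=> h0 hs st; have h0' : 0 < Num.sqrt h by rewrite sqrtr_gt0.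
rewrite ler_pdivlMr//.
have hs' : Num.sqrt h <= Num.sqrt s by rewrite ler_wsqrtr.
have st' : Num.sqrt s <= Num.sqrt t by rewrite ler_wsqrtr.
have -> : t - s = (Num.sqrt t - Num.sqrt s) * (Num.sqrt t + Num.sqrt s).
  by rewrite -subr_sqr !sqr_sqrtr; lra.
by rewrite ler_wpM2l ?subr_ge0//; lra.
Qed.

Variables (f : R -> R) (C : R).
Hypotheses (C0 : 0 <= C) (f0 : forall t : R, t <= 0 -> f t = 0)
  (f4 : forall t : R, 4 <= t -> f t = 0)
  (fC : forall s t : R, 0 <= s -> s <= t -> t <= 4 ->
     `|f t - f s| <= C * (psi t - psi s)).

(** Clipping to [[0, 4]] does not change the values of [f], and it only shrinks the increment of
    [psi], which is monotone on the whole line because [Num.sqrt] vanishes on negative numbers. *)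
Lemma gauge_global s t : s <= t -> `|f t - f s| <= C * (psi t - psi s).
Proof.
move=> st; have cst k : k <= 0 \/ 4 <= k -> f k = 0 by case=> ?; [exact: f0|exact: f4].
have [t0|t0] := leP t 0.
  rewrite !cst ?subrr ?normr0 ?mulr_ge0 ?subr_ge0 ?le_psi//; left; lra.
have [s4|s4] := leP 4 s.
  rewrite !cst ?subrr ?normr0 ?mulr_ge0 ?subr_ge0 ?le_psi//; right; lra.
have -> : f s = f (clip 0 4 s).
  have [s0|s0] := leP s 0; first by rewrite clip_lt ?(f0 s0) ?(f0 (lexx 0)).
  by rewrite clip_id// ltW.
have -> : f t = f (clip 0 4 t).
  have [t4|t4] := leP 4 t; first by rewrite clip_gt ?(f4 t4) ?(f4 (lexx 4)).
  by rewrite clip_id// ltW.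
have h1 := @clip_itv _ 0 4 s ltac:(lra).
have h2 := @clip_itv _ 0 4 t ltac:(lra).
have h3 := @clip_lip _ 0 4 s t ltac:(lra) st.
apply: le_trans (fC _ _ _) _; try lra.
rewrite ler_wpM2l// lerB// le_psi//.
  have [t4|t4] := leP 4 t; first by rewrite clip_gt.
  by rewrite clip_id// ltW.
have [s0|s0] := leP s 0; first by rewrite clip_lt.
by rewrite clip_id// ltW.
Qed.

(** Cut [[0, 4]] at [q] and [4 - q]. On the two tips the total increment of [psi] is [O(sqrt q)] and
    [gap_sum_gauge] suffices without refinement; on the middle part [f] is Lipschitz and the energy
    argument applies. *)
Lemma gap_sum_gauge_small (e : R) : 0 < e -> exists2 h0, 0 < h0 &
  forall p c h M, 0 <= p <= 1 -> 0 <= h <= h0 -> gap_sum f p c h M <= e.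
Proof.
move=> e0; pose x := e / (8 * (C + 1)).
have C1 : 0 < C + 1 by rewrite ltr_pwDr.
have x0 : 0 < x by rewrite divr_gt0// mulr_gt0.
(* [q <= 1] gives [q <= 4 - q], and [sqrt q <= x] makes each tip cost at most [e / 4]. *)
pose q := Num.min 1 (x ^+ 2).
have q0 : 0 < q by rewrite lt_min ltr01 exprn_gt0.
have q1 : q <= 1 by rewrite ge_min lexx.
have sq : Num.sqrt q <= x.
  apply: (@le_trans _ _ (Num.sqrt (x ^+ 2))); last by rewrite sqrtr_sqr gtr0_norm.
  by rewrite ler_wsqrtr// ge_min lexx orbT.
have Cx : C * (2 * Num.sqrt q) <= e / 4.
  apply: (@le_trans _ _ ((C + 1) * (2 * x))).
    rewrite ler_pM ?mulr_ge0 ?sqrtr_ge0// ?lerDl//; lra.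
  rewrite le_eqVlt; apply/orP; left; apply/eqP; rewrite /x; field.
  by rewrite gt_eqF.
pose u t := f (clip q (4 - q) t).
have q4 : q <= 4 - q by lra.
have uK0 s t : s <= t -> `|u t - u s| <= 2 * C / Num.sqrt q * `|t - s|.
  move=> st; have h1 := @clip_itv _ q (4 - q) s q4.
  have h2 := @clip_itv _ q (4 - q) t q4.
  have h3 := clip_lip q4 st.
  have sq0 : 0 < Num.sqrt q by rewrite sqrtr_gt0.
  rewrite /u; apply: le_trans (fC _ _ _) _; try lra.
  rewrite (ger0_norm (_ : 0 <= t - s)) ?subr_ge0//.
  rewrite -mulrA [2 * _]mulrC -!mulrA ler_wpM2l//.
  move: (clip q _ s) (clip q _ t) h1 h2 h3 => a b h1 h2 h3.
  have k1 : Num.sqrt b - Num.sqrt a <= (b - a) / Num.sqrt q by apply: sqrtr_lip; lra.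
  have k2 : Num.sqrt (4 - a) - Num.sqrt (4 - b) <= (4 - a - (4 - b)) / Num.sqrt q.
    by apply: sqrtr_lip; lra.
  have ke : 4 - a - (4 - b) = b - a by ring.
  rewrite ke in k2.
  have k3 : (b - a) / Num.sqrt q <= (Num.sqrt q)^-1 * (t - s).
    by rewrite mulrC ler_wpM2l ?invr_ge0 ?sqrtr_ge0//; lra.
  by rewrite /psi; lra.
have uK s t : `|u t - u s| <= 2 * C / Num.sqrt q * `|t - s|.
  have [/uK0//|/ltW/uK0] := leP s t.
  by rewrite distrC [`|s - t|]distrC.
have u0 (t : R) : t <= 0 -> u t = u 0 by move=> t0; rewrite /u !clip_lt//; lra.
have u4 (t : R) : 4 <= t -> u t = u 4 by move=> t4; rewrite /u !clip_gt//; lra.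
have [h0 h00 hu] := @gap_sum_lipschitz _ u 4 _ ltac:(lra) uK u0 u4 (e / 2) ltac:(lra).
exists h0 => // p c h M p01 hh.
have tip (a b : R) : 0 <= a -> a <= b -> b <= 4 -> b - a <= q ->
    gap_sum (fun t => f (clip a b t)) p c h M <= e / 4.
  move=> a0 ab b4 abq.
  have g1 s t : s <= t -> `|f (clip a b t) - f (clip a b s)| <=
      C * psi (clip a b t) - C * psi (clip a b s) + 0.
    move=> st; rewrite addr0 -mulrBr.
    have h1 := @clip_itv _ a b s ab.
    have h2 := @clip_itv _ a b t ab.
    have h3 := clip_lip ab st.
    by apply: fC; lra.
  have /andP[hh0 _] := hh.
  apply: le_trans (gap_sum_gauge c M p01 hh0 g1) _.
  rewrite mulr0 addr0 -mulrBr (le_trans _ Cx)// ler_wpM2l//.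
  have := @clip_itv _ a b (c + M%:R * h) ab; have := @clip_itv _ a b c ab.
  move: (clip a b c) (clip a b _) => y z /andP[ay yb] /andP[az zb].
  apply: (@le_trans _ _ (psi b - psi a)); first by apply: lerB; exact: le_psi.
  by rewrite (le_trans (psi_holder ab))// ler_wpM2l// ler_wsqrtr.
(* The three clipped pieces add up to [f] and a constant, which has no chord gaps. *)
have fE : f = fun t => (f (clip 0 q t) + f (clip (4 - q) 4 t)) +
    (u t + (- f q - f (4 - q))).
  apply/funext => t; rewrite /u.
  have [tq|tq] := leP t q.
    rewrite (@clip_lt _ (4 - q))//; [|lra|lra].
    rewrite (@clip_lt _ q (4 - q))//.
    have [t0|t0] := leP t 0.
      rewrite clip_lt//; last exact: ltW.
      by rewrite (f0 t0) (f0 (lexx 0)); ring.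
    by rewrite clip_id//; [ring|exact: ltW].
  rewrite (@clip_gt _ 0 q); [|exact: ltW..].
  have [tq4|tq4] := leP t (4 - q).
    rewrite (@clip_lt _ (4 - q))//; [|lra].
    by rewrite clip_id//; [ring|exact: ltW].
  rewrite (@clip_gt _ q (4 - q))//; [|exact: ltW].
  have [t4|t4] := leP 4 t.
    rewrite clip_gt//; [|lra].
    by rewrite (f4 t4) (f4 (lexx 4)); ring.
  by rewrite clip_id; [ring|exact: ltW..].
rewrite fE.
apply: le_trans (gap_sum_add _ _ _ _ _ _) _.
have t1 := tip 0 q ltac:(lra) ltac:(lra) ltac:(lra) ltac:(lra).
have t2 := tip (4 - q) 4 ltac:(lra) ltac:(lra) ltac:(lra) ltac:(lra).
have t3 := gap_sum_add (fun t => f (clip 0 q t)) (fun t => f (clip (4 - q) 4 t)) p c h M.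
have t4 := gap_sum_add u (fun=> - f q - f (4 - q)) p c h M.
rewrite gap_sum_cst in t4.
have := hu p c h M p01 hh.
lra.
Qed.

End gauge.

(** * The slab density *)

Section density.
Context {R : realType}.

Definition root4 (y : R) : R := Num.sqrt (Num.sqrt y).

Lemma root4_gt0 y : 0 < y -> 0 < root4 y.
Proof. by move=> y0; rewrite /root4 !sqrtr_gt0. Qed.

Lemma root4X y : 0 <= y -> root4 y ^+ 4 = y.
Proof. by move=> y0; rewrite /root4 (exprM _ 2 2) !sqr_sqrtr ?sqrtr_ge0. Qed.

Lemma le_root4 x y : x <= y -> root4 x <= root4 y.
Proof. by move=> xy; rewrite /root4 !ler_wsqrtr. Qed.

Lemma root4_ge1 y : 1 <= y -> 1 <= root4 y.
Proof. by move=> /le_root4; rewrite /root4 !sqrtr1. Qed.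

Lemma root4M x y : 0 <= x -> root4 (x * y) = root4 x * root4 y.
Proof. by move=> x0; rewrite /root4 sqrtrM// sqrtrM// sqrtr_ge0. Qed.

(* The exponent 1/4 makes [dens] increase fast enough: for [r] of the order of [|x|]
   the gain [r * r ^ (- 5/4)] has the same order [r ^ (- 1/4)] as the error of the
   blocks [|n| <= s ^ 2 * sqrt r], which have to be treated without refinement. *)
Definition dens (n : int) : R :=
  match n with
  | Posz m => 1 - (root4 m.+1%:R)^-1 / 3
  | Negz m => (root4 m.+1%:R)^-1 / 3
  end.

Lemma root4S m : 0 < (root4 m.+1%:R)^-1 <= 1.
Proof.
have h : 1 <= root4 m.+1%:R by rewrite root4_ge1// ler1n.
by rewrite invr_gt0 invf_le1// !(lt_le_trans ltr01 h).
Qed.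

Lemma dens01 n : 0 <= dens n <= 1.
Proof. by case: n => m /=; have := root4S m; lra. Qed.

(** With [a] and [b] the two fourth roots, [b^4 - a^4 = 1] gives [b - a >= 1 / (4 b^3)], hence
    [1/a - 1/b >= 1 / (4 b^5)]. *)
Lemma root4_incr m y : m.+2%:R <= y ->
  (root4 y)^-1 ^+ 5 / 12 <= ((root4 m.+1%:R)^-1 - (root4 m.+2%:R)^-1) / 3.
Proof.
move=> my; have y0 : 0 < y by apply: lt_le_trans my; rewrite ltr0n.
have a0 : 0 < root4 m.+1%:R by rewrite root4_gt0// ltr0n.
have b0 : 0 < root4 m.+2%:R by rewrite root4_gt0// ltr0n.
have ab : root4 m.+1%:R <= root4 m.+2%:R by rewrite le_root4// ler_nat.
have by_ : (root4 y)^-1 <= (root4 m.+2%:R)^-1 by rewrite lef_pV2 ?posrE ?root4_gt0// le_root4.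
apply: (@le_trans _ _ ((root4 m.+2%:R)^-1 ^+ 5 / 12)).
  by rewrite ler_wpM2r// lerXn2r ?nnegrE ?invr_ge0// ltW// root4_gt0.
have a4 : root4 m.+1%:R ^+ 4 = m.+1%:R :> R by rewrite root4X.
have b4 : root4 m.+2%:R ^+ 4 = m.+2%:R :> R by rewrite root4X.
have : root4 m.+2%:R ^+ 4 - root4 m.+1%:R ^+ 4 = 1 :> R by rewrite a4 b4 -natrB// subSnn.
move: (root4 m.+1%:R) (root4 m.+2%:R) a0 b0 ab {a4 b4 by_} => a b a0 b0 ab e.
rewrite -subr_ge0.
have -> : (a^-1 - b^-1) / 3 - b^-1 ^+ 5 / 12 = (4 * (b - a) * b ^+ 4 - a) / (12 * a * b ^+ 5).
  by field; rewrite !gt_eqF.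
apply: divr_ge0; last by rewrite !mulr_ge0 ?exprn_ge0// ltW.
have : (b - a) * (4 * b ^+ 3) >= 1.
  apply: (@le_trans _ _ (b ^+ 4 - a ^+ 4)); first by rewrite e.
  have -> : b ^+ 4 - a ^+ 4 = (b - a) * ((b + a) * (b ^+ 2 + a ^+ 2)) by ring.
  rewrite ler_wpM2l ?subr_ge0//.
  have -> : 4 * b ^+ 3 = (b + b) * (b ^+ 2 + b ^+ 2) by ring.
  apply: ler_pM; [lra|by rewrite addr_ge0 ?sqr_ge0|lra|].
  by rewrite lerD2l lerXn2r ?nnegrE// ltW.
move=> h; have : a <= b * ((b - a) * (4 * b ^+ 3)).
  by rewrite (le_trans ab)// ler_peMr// ltW.
by rewrite (_ : b * _ = 4 * (b - a) * b ^+ 4); [lra|ring].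
Qed.

Lemma dens_incr (n : int) (y : R) : `|n%:~R| + 1 <= y ->
  (root4 y)^-1 ^+ 5 / 12 <= dens n - dens (n - 1).
Proof.
case: n => [[|m]|m].
(* At [n = 0] the two branches of [dens] meet: the value passes from 1/3 to 2/3. *)
- rewrite normr0 add0r => y1 /=.
  have -> : root4 1%:R = 1 :> R by rewrite /root4 !sqrtr1.
  have r1 : 1 <= root4 y by rewrite root4_ge1.
  have : (root4 y)^-1 ^+ 5 <= 1.
    by rewrite exprn_ile1 ?invr_ge0 ?invf_le1// ?(le_trans _ r1)// (lt_le_trans _ r1).
  by rewrite invr1; lra.
- rewrite ger0_norm ?ler0z// => my.
  have -> : Posz m.+1 - 1 = Posz m by lia.
  rewrite /= (le_trans (root4_incr (_ : m.+2%:R <= y)))//; last lra.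
  by rewrite -natr1.
- rewrite NegzE => my.
  have -> : - (m.+1)%:Z - 1 = Negz m.+1 by lia.
  have -> : - (m.+1)%:Z = Negz m by lia.
  rewrite /= (le_trans (root4_incr (_ : m.+2%:R <= y)))//; last lra.
  by rewrite -natr1; move: my; rewrite mulrNz normrN ger0_norm ?ler0z.
Qed.

Lemma dens_le (n : int) : dens (n - 1) <= dens n.
Proof.
rewrite -subr_ge0; apply: le_trans (dens_incr (lexx _)).
rewrite divr_ge0// exprn_ge0// invr_ge0 ltW// root4_gt0// ltr_pwDr//.
Qed.

End density.

(** * Abel summation over the blocks *)

Section slab_gain.
Context {R : realType}.

Definition slab_lo (M : int -> nat) (n : int) (j : nat) : R := n%:~R + j%:R / (M n)%:R.

Definition slab_hi (M : int -> nat) (n : int) (j : nat) : R :=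
  n%:~R + (j%:R + dens n) / (M n)%:R.

(** It serves twice. For [F] the volume of the body below a level, it is up to a negative factor the
    volume of the copy inside the test set; for [F] the derivative of that volume, it is the
    quantity to be shown positive. The blocks run from [-N] to [N - 1], and [x] is the height at
    which the copy starts. *)
Definition slab_sum (M : int -> nat) (F : R -> R) (r x : R) N : R :=
  \sum_(i < N + N) \sum_(j < M (i%:Z - N%:Z))
    (F ((slab_lo M (i%:Z - N%:Z) j - x) / r) - F ((slab_hi M (i%:Z - N%:Z) j - x) / r)).

(** In the rescaled variable a slab occupies the fraction [dens n] of its cell, so [F] at its upper
    end is the chord value minus a chord gap. The chord parts telescope over the block. *)
Lemma block_sum_ge (F : R -> R) M n r x : (0 < M n)%N -> 0 < r ->
  dens n * (F ((n%:~R - x) / r) - F (((n + 1)%:~R - x) / r)) -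
    gap_sum F (dens n) ((n%:~R - x) / r) (((M n)%:R * r)^-1) (M n) <=
  \sum_(j < M n) (F ((slab_lo M n j - x) / r) - F ((slab_hi M n j - x) / r)).
Proof.
move=> M0 r0; have M0' : 0 < (M n)%:R :> R by rewrite ltr0n.
set c := (n%:~R - x) / r; set h := ((M n)%:R * r)^-1.
have loE (j : nat) : (slab_lo M n j - x) / r = c + j%:R * h.
  by rewrite /slab_lo /c /h; field; rewrite !gt_eqF.
have hiE (j : nat) : (slab_hi M n j - x) / r = c + j%:R * h + dens n * h.
  by rewrite /slab_hi /c /h; field; rewrite !gt_eqF.
have endE : ((n + 1)%:~R - x) / r = c + (M n)%:R * h.
  by rewrite /c /h intrD; field; rewrite !gt_eqF.
rewrite endE.
rewrite (eq_bigr (fun j : 'I_(M n) => - dens n * (F (c + j.+1%:R * h) - F (c + j%:R * h)) +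
    chord_gap F (dens n) (c + j%:R * h) h)) => [|j _]; last first.
  rewrite loE hiE /chord_gap (_ : c + j.+1%:R * h = c + j%:R * h + h).
    by ring.
  by rewrite -natr1; ring.
rewrite big_split/= -mulr_sumr.
rewrite -(big_mkord xpredT (fun j => F (c + j.+1%:R * h) - F (c + j%:R * h))).
rewrite (telescope_sumr (fun j => F (c + j%:R * h)))// mul0r addr0 mulNr -mulrN opprB.
rewrite lerD2l lerNl -sumrN; apply: ler_sum => j _.
by rewrite -normrN ler_norm.
Qed.

Lemma abel_sum (P : int -> R) (F : nat -> R) (n0 : int) m :
  \sum_(i < m) P (i%:Z + n0) * (F i - F i.+1) =
  \sum_(i < m) (P (i%:Z + n0) - P (i%:Z + n0 - 1)) * F i
   + P (n0 - 1) * F 0%N - P (m%:Z + n0 - 1) * F m.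
Proof.
elim: m => [|m IH]; first by rewrite !big_ord0 !add0r subrr.
rewrite !big_ord_recr/= IH.
have -> : m.+1%:Z + n0 - 1 = m%:Z + n0 by lia.
ring.
Qed.

Lemma sum_geo_half N : \sum_(i < N) (2^-1 : R) ^+ i <= 2.
Proof.
have : \sum_(i < N) (2^-1 : R) ^+ i = 2 - 2 * 2^-1 ^+ N.
  elim: N => [|N IH]; first by rewrite big_ord0 expr0; ring.
  by rewrite big_ord_recr/= IH exprS; field.
by move=> ->; rewrite gerBl mulr_ge0// exprn_ge0.
Qed.

Lemma sum_geo_int N : \sum_(i < N + N) (2^-1 : R) ^+ `|i%:Z - N%:Z|%N <= 4.
Proof.
rewrite big_split_ord/= (_ : 4 = 2 + 2); last by ring.
apply: lerD.
  rewrite (reindex_inj rev_ord_inj)/=.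
  apply: le_trans (sum_geo_half N); apply: ler_sum => i _.
  apply: ler_wiXn2l => //; first by lra.
  by have := ltn_ord i; lia.
apply: le_trans (sum_geo_half N); apply: ler_sum => i _.
rewrite (_ : `|(N + i)%N%:Z - N%:Z|%N = i)//; lia.
Qed.

End slab_gain.

(** * The gain against the chord gaps *)

Section slab_positive.
Context {R : realType}.
Variables (f : R -> R) (C c0 : R).
Hypotheses (C0 : 0 <= C) (c00 : 0 < c0) (f_ge0 : forall t : R, 0 <= f t)
  (f0 : forall t : R, t <= 0 -> f t = 0) (f4 : forall t : R, 4 <= t -> f t = 0)
  (fC : forall s t : R, 0 <= s -> s <= t -> t <= 4 ->
     `|f t - f s| <= C * (psi t - psi s))
  (f13 : forall t : R, 1 <= t -> t <= 3 -> c0 <= f t).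

Lemma gain_ge (r x : R) N : 1 <= r -> `|x| + 4 * r <= N%:R ->
  r * (root4 (`|x| + 4 * r + 1))^-1 ^+ 5 * c0 / 12 <=
  \sum_(i < N + N) (dens (i%:Z - N%:Z) - dens (i%:Z - N%:Z - 1)) *
    f (((i%:Z - N%:Z)%:~R - x) / r).
Proof.
move=> r1 xN; have r0 : 0 < r by apply: lt_le_trans r1.
set y := `|x| + 4 * r + 1.
have xlo : - `|x| <= x by rewrite lerNl -normrN ler_norm.
have xhi : x <= `|x| by exact: ler_norm.
(* The integers [n = i - N] with [i0 <= i < i0 + k] lie between [x + r] and [x + 3 r], where [f13]
   applies. There are [k] of them, the integer part of [2 r], which is at least [r] because
   [r >= 1]. *)
pose i0 := (Num.truncn (N%:R + x + r)).+1.
pose k := Num.truncn (2 * r).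
have s0 : 0 <= N%:R + x + r by lra.
have /andP[i1 i2] : (Num.truncn (N%:R + x + r))%:R <= N%:R + x + r < i0%:R by apply: truncn_itv.
have /andP[k1 k2] : k%:R <= 2 * r < k.+1%:R by apply: truncn_itv; lra.
have i3 : i0%:R <= N%:R + x + r + 1 by rewrite /i0 -natr1; lra.
have kr : r <= k%:R by move: k2; rewrite -natr1; lra.
have ikN : (i0 + k <= N + N)%N.
  have : (i0 + k)%:R < ((N + N).+1)%:R :> R by rewrite -natr1 !natrD; lra.
  by rewrite ltr_nat ltnS.
pose F (i : nat) := (dens (i%:Z - N%:Z) - dens (i%:Z - N%:Z - 1)) *
    f (((i%:Z - N%:Z)%:~R - x) / r).
have F0 i : 0 <= F i by rewrite mulr_ge0 ?subr_ge0 ?dens_le.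
rewrite -(big_mkord xpredT F) (@big_cat_nat _ _ _ i0)//=; last first.
  exact: leq_trans (leq_addr _ _) ikN.
rewrite (@big_cat_nat _ _ _ (i0 + k) i0)//= ?leq_addr//.
have h1 : 0 <= \sum_(0 <= i < i0) F i by apply: sumr_ge0.
have h2 : 0 <= \sum_(i0 + k <= i < N + N) F i by apply: sumr_ge0.
set g := (root4 y)^-1 ^+ 5 / 12 * c0.
have g0 : 0 <= g.
  rewrite mulr_ge0 ?(ltW c00)// divr_ge0// exprn_ge0// invr_ge0 ltW// root4_gt0//.
  by rewrite /y; have := normr_ge0 x; lra.
have h3 : \sum_(i0 <= i < i0 + k) g <= \sum_(i0 <= i < i0 + k) F i.
  rewrite big_nat [leRHS]big_nat; apply: ler_sum => i /andP[ii0 iik].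
  have a1 : i0%:R <= i%:R :> R by rewrite ler_nat.
  have a2 : i%:R + 1 <= i0%:R + k%:R :> R by rewrite natr1 -natrD ler_nat.
  have nE : (i%:Z - N%:Z)%:~R = i%:R - N%:R :> R by rewrite intrB.
  rewrite /F /g; apply: ler_pM.
  - by rewrite divr_ge0// exprn_ge0// invr_ge0 ltW// root4_gt0// /y; have := normr_ge0 x; lra.
  - exact: ltW.
  - by apply: dens_incr; rewrite nE /y -lerBrDr ler_norml; lra.
  - by rewrite nE; apply: f13; rewrite ?ler_pdivlMr ?ler_pdivrMr//; lra.
apply: (@le_trans _ _ (\sum_(i0 <= i < i0 + k) g)); last by lra.
rewrite sumr_const_nat addKn -[leRHS]mulr_natl.
have -> : r * (root4 y)^-1 ^+ 5 * c0 / 12 = r * g by rewrite /g; ring.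
by rewrite ler_wpM2r.
Qed.

Lemma gap_block_le (n : int) (r x : R) (M : nat) : 0 < r -> (0 < M)%N ->
  gap_sum f (dens n) ((n%:~R - x) / r) ((M%:R * r)^-1) M <=
  C * (psi (((n + 1)%:~R - x) / r) - psi ((n%:~R - x) / r)).
Proof.
move=> r0 M0; have M0' : 0 < M%:R :> R by rewrite ltr0n.
have g s t : s <= t -> `|f t - f s| <= C * psi t - C * psi s + 0.
  by move=> st; rewrite addr0 -mulrBr; apply: gauge_global.
have h0 : 0 <= (M%:R * r)^-1 by rewrite invr_ge0 mulr_ge0// ltW.
apply: le_trans (gap_sum_gauge _ _ (dens01 n) h0 g) _.
rewrite mulr0 addr0 -mulrBr (_ : _ + _ * _ = ((n + 1)%:~R - x) / r)//.
by rewrite intrD; field; rewrite !gt_eqF.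
Qed.

Lemma gap_block_out (n : int) (r x : R) (M : nat) : 0 < r -> (0 < M)%N ->
  (n + 1)%:~R <= x \/ x + 4 * r <= n%:~R ->
  gap_sum f (dens n) ((n%:~R - x) / r) ((M%:R * r)^-1) M = 0.
Proof.
move=> r0 M0 out; have M0' : 0 < M%:R :> R by rewrite ltr0n.
rewrite /gap_sum big1// => j _; apply/normr0P/eqP.
have /andP[p0 p1] := @dens01 R n.
have fz t : n%:~R <= t -> t <= (n + 1)%:~R -> f ((t - x) / r) = 0.
  move=> nt tn; case: out => [h|h]; [apply: f0|apply: f4].
    by rewrite pmulr_lle0 ?invr_gt0//; lra.
  by rewrite ler_pdivlMr//; lra.
have jM : j.+1%:R <= M%:R :> R by rewrite ler_nat.
have := ler0n R j => j0.
have fz' q : 0 <= q <= 1 -> f ((n%:~R - x) / r + j%:R * (M%:R * r)^-1 + q * (M%:R * r)^-1) = 0.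
  move=> /andP[q0 q1].
  have -> : (n%:~R - x) / r + j%:R * (M%:R * r)^-1 + q * (M%:R * r)^-1 =
    (n%:~R + (j%:R + q) / M%:R - x) / r by field; rewrite !gt_eqF.
  apply: fz; first by rewrite lerDl divr_ge0// addr_ge0.
  rewrite intrD lerD2l ler_pdivrMr// mul1r (le_trans _ jM)// -natr1 lerD2l//.
rewrite /chord_gap fz' ?p0//.
have := fz' 0; rewrite mul0r addr0 => ->; last by rewrite lexx ler01.
have := fz' 1; rewrite mul1r => ->; last by rewrite lexx ler01.
by rewrite !mulr0 addr0 subr0.
Qed.

(** The rescaled mesh [1 / (M r)] is at most [1 / M] for [r >= 1], so one [M n] serves all
    copies. *)
Lemma slab_mesh (w : int -> R) : (forall n, 0 < w n) ->
  exists M : int -> nat, (forall n, 0 < M n)%N /\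
  forall n c r, 1 <= r -> gap_sum f (dens n) c (((M n)%:R * r)^-1) (M n) <= w n.
Proof.
move=> w0.
have H n : exists M : nat, (0 < M)%N /\ forall c r, 1 <= r ->
    gap_sum f (dens n) c ((M%:R * r)^-1) M <= w n.
  have [h h0 hP] := gap_sum_gauge_small C0 f0 f4 fC (w0 n).
  exists (Num.truncn h^-1).+1; split => // c r r1; apply: hP; first exact: dens01.
  have M0 : 0 < (Num.truncn h^-1).+1%:R :> R by rewrite ltr0n.
  have r0 : 0 < r by apply: lt_le_trans r1.
  rewrite invr_ge0 mulr_ge0 ?(ltW M0) ?(ltW r0)//= -[leRHS]invrK lef_pV2 ?posrE ?invr_gt0 ?mulr_gt0//.
  by rewrite (le_trans (ltW (truncnS_gt _)))// ler_peMr// ltW.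
have [M MP] := choice H.
by exists M; split => n; have [] := MP n.
Qed.

Lemma coarse_le (n0 : int) (m : nat) (r x : R) (N : nat) : 0 < r -> (m <= N)%N ->
  \sum_(i < N + N) (if (N - m <= i < N + m)%N then
    C * (psi (((i%:Z - N%:Z + 1)%:~R - x) / r) - psi (((i%:Z - N%:Z)%:~R - x) / r)) else 0)
  <= C * (2 * Num.sqrt (2 * m%:R / r)).
Proof.
(* Clamping the index to the coarse range turns the masked sum into a telescoping one over an
   interval of length [2 m / r]. *)
move=> r0 mN; pose cl i := maxn (N - m) (minn i (N + m)).
pose g i := C * psi (((cl i)%:R - N%:R - x) / r).
rewrite (eq_bigr (fun i : 'I_(N + N) => g i.+1 - g i)) => [|i _]; last first.
  case: ifPn => [/andP[im mi]|].
    rewrite /g /cl (minn_idPl mi) (minn_idPl (ltnW mi)) (maxn_idPr im).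
    rewrite (maxn_idPr (leqW im)) -mulrBr; congr (C * (psi (_ / r) - psi (_ / r))).
      by rewrite intrD intrB -natr1; ring.
    by rewrite intrB.
  move=> h; rewrite /g (_ : cl i.+1 = cl i) ?subrr// /cl; lia.
rewrite -(big_mkord xpredT (fun i => g i.+1 - g i)) telescope_sumr// /g -mulrBr.
rewrite ler_wpM2l// /cl (_ : maxn _ (minn (N + N) _) = (N + m)%N); last lia.
rewrite (_ : maxn _ (minn 0 _) = (N - m)%N); last lia.
rewrite natrD natrB//; apply: le_trans (psi_holder _) _.
  by rewrite ler_wpM2r ?invr_ge0 ?(ltW r0)//; have := ler0n R m; lra.
by rewrite ler_wpM2l// ler_wsqrtr// le_eqVlt; apply/orP; left; apply/eqP; ring.
Qed.

Lemma root4_16 : root4 16 = 2 :> R.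
Proof.
have -> : 16 = (2 ^+ 2) ^+ 2 :> R by ring.
by rewrite /root4 sqrtr_sqr ger0_norm ?sqr_ge0// sqrtr_sqr ger0_norm.
Qed.

(** [M] is chosen before [r] and [x], from grants [w n]. Write [Y = |x| + 4 r + 1] and
    [om = Y^(-1/4)]; the gain is at least a constant times [r om^5]. Blocks with [(|n| + 1)^2] of
    order at least [Y] have grants of order [om^12], below the gain. The other blocks that meet the
    copy occur only if [|x| <= 8 r], and [coarse_le] handles them together. *)
Lemma slab_positive : exists M : int -> nat, (forall n, 0 < M n)%N /\
  forall r x N, 1 <= r -> `|x| + 4 * r <= N%:R -> 0 < slab_sum M f r x N.
Proof.
have C1 : 0 < C + 1 by rewrite ltr_pwDr.
(* With this [s] the coarse error, at most [4 C s r^(-1/4)], is less than half of the lower bound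
   [(c0 / 384) r^(-1/4)] for the gain. *)
pose s := Num.min 1 (c0 / 16 / 64 / 4 / (C + 1)).
have s0 : 0 < s by rewrite lt_min ltr01 !divr_gt0.
have s1 : s <= 1 by rewrite ge_min lexx.
have sC : 4 * C * s <= c0 / 16 / 64.
  have : s * (C + 1) <= c0 / 16 / 64 / 4.
    by rewrite -ler_pdivlMr// ge_min lexx orbT.
  by rewrite mulrDr mulr1; lra.
(* In [w], the powers of 1/2 sum to at most 4 over all blocks, and the sixth power of [|n| + 1]
   becomes [om^12] once [(|n| + 1)^2 >= s^4 Y / 16]. The value of [kap] then makes [fine] equal to
   [c0 om^12 / 256]. *)
pose kap := c0 * s ^+ 12 / 16 ^+ 5.
have kap0 : 0 < kap by rewrite divr_gt0 ?mulr_gt0 ?exprn_gt0.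
pose w (n : int) : R := kap / ((`|n%:~R| + 1) ^+ 2) ^+ 3 * 2^-1 ^+ `|n|%N.
have w0 n : 0 < w n.
  by rewrite mulr_gt0 ?exprn_gt0// divr_gt0// !exprn_gt0// ltr_pwDr.
have [M [M0 MP]] := slab_mesh w0.
exists M; split => // r x N r1 xN.
have r0 : 0 < r by apply: lt_le_trans r1.
pose Y := `|x| + 4 * r + 1.
have x0 : 0 <= `|x| by [].
have Y0 : 0 < Y by rewrite /Y; lra.
have Y1 : 1 <= Y by rewrite /Y; lra.
pose om := (root4 Y)^-1.
have ry1 : 1 <= root4 Y by exact: root4_ge1.
have om0 : 0 < om by rewrite invr_gt0 root4_gt0.
have om1 : om <= 1 by rewrite invf_le1// root4_gt0.
have omY : Y * om ^+ 4 = 1.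
  by rewrite /om exprVn root4X ?(ltW Y0)// divff// gt_eqF.
pose gain := r * om ^+ 5 * c0 / 12.
pose gs (i : nat) := gap_sum f (dens (i%:Z - N%:Z)) (((i%:Z - N%:Z)%:~R - x) / r)
   (((M (i%:Z - N%:Z))%:R * r)^-1) (M (i%:Z - N%:Z)).
have xhi : x <= `|x| by exact: ler_norm.
have xlo : - `|x| <= x by rewrite lerNl -normrN ler_norm.
have main : gain - \sum_(i < N + N) gs i <= slab_sum M f r x N.
  pose F (i : nat) := f (((i%:Z - N%:Z)%:~R - x) / r).
  apply: (@le_trans _ _ (\sum_(i < N + N) (dens (i%:Z - N%:Z) * (F i - F i.+1) - gs i))).
    rewrite sumrB lerD2r.
    have F0 : F 0%N = 0 by apply: f0; rewrite pmulr_lle0 ?invr_gt0// intrB; lra.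
    have FN : F (N + N)%N = 0.
      rewrite /F (_ : (N + N)%N%:Z - N%:Z = N%:Z); last by clear; lia.
      by apply: f4; rewrite ler_pdivlMr//; lra.
    have -> := abel_sum dens F (- N%:Z) (N + N).
    rewrite F0 FN !mulr0 addr0 subr0.
    exact: gain_ge.
  apply: ler_sum => i _.
  have -> : F i.+1 = f (((i%:Z - N%:Z + 1)%:~R - x) / r).
    by rewrite /F (_ : i.+1%:Z - N%:Z = i%:Z - N%:Z + 1)//; clear; lia.
  exact: block_sum_ge.
have gs_w i : gs i <= w (i%:Z - N%:Z) by exact: MP.
pose fine := kap * (16 / s ^+ 4 * om ^+ 4) ^+ 3.
have w_fine (n : int) : s ^+ 4 * Y / 16 <= (`|n%:~R| + 1) ^+ 2 ->
    w n <= fine * 2^-1 ^+ `|n|%N.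
  move=> h; rewrite /w ler_wpM2r ?exprn_ge0// /fine ler_wpM2l ?(ltW kap0)//.
  have A0 : 0 <= 16 / s ^+ 4 * om ^+ 4.
    by apply: mulr_ge0; [apply: divr_ge0 => //|]; apply: exprn_ge0; exact: ltW.
  have B0 : 0 <= ((`|n%:~R| + 1) ^+ 2)^-1 :> R by rewrite invr_ge0 sqr_ge0.
  rewrite -exprVn lerXn2r ?nnegrE//.
  have -> : 16 / s ^+ 4 * om ^+ 4 = (s ^+ 4 * Y / 16)^-1.
    have -> : om ^+ 4 = Y^-1 by apply: (mulfI (lt0r_neq0 Y0)); rewrite omY divff ?gt_eqF.
    by field; rewrite !gt_eqF.
  by rewrite lef_pV2 ?posrE ?exprn_gt0 ?divr_gt0 ?mulr_gt0 ?exprn_gt0// ltr_pwDr.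
have fineE : fine = c0 * om ^+ 12 / 16 / 16.
  by rewrite /fine /kap; field; rewrite gt_eqF.
have gain0 : 0 < gain by rewrite divr_gt0// !mulr_gt0 ?exprn_gt0.
have fine_gain : 4 * fine <= gain / 4.
  have : om ^+ 12 <= r * om ^+ 5.
    have -> : om ^+ 12 = om ^+ 7 * om ^+ 5 by ring.
    rewrite ler_wpM2r ?exprn_ge0 ?(ltW om0)// (le_trans _ r1)//.
    by rewrite exprn_ile1// ltW.
  move=> /(ler_wpM2l (ltW c00)) h; move: gain0; rewrite fineE /gain; lra.
suff : \sum_(i < N + N) gs i <= gain / 2 + 4 * fine by lra.
have fine0 : 0 <= fine by rewrite fineE !divr_ge0// mulr_ge0 ?exprn_ge0// ltW.
have sum_fine : \sum_(i < N + N) fine * 2^-1 ^+ `|i%:Z - N%:Z|%N <= 4 * fine.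
  by rewrite -mulr_sumr mulrC ler_wpM2r// sum_geo_int.
(* Here [Y <= 16 r], so the gain has order at least [r^(-1/4)]. The coarse blocks are those with
   [-m <= n < m]; for the others [|n| + 1 > s^2 sqrt r], and the grant is fine. *)
have [xr|xr] := leP `|x| (8 * r).
  pose m := Num.truncn (s ^+ 2 * Num.sqrt r).
  have sr0 : 0 <= s ^+ 2 * Num.sqrt r by rewrite mulr_ge0 ?sqrtr_ge0 ?sqr_ge0.
  have /andP[m1 m2] : m%:R <= s ^+ 2 * Num.sqrt r < m.+1%:R by exact: truncn_itv.
  have sqr1 : 1 <= Num.sqrt r by rewrite -[1]sqrtr1 ler_wsqrtr.
  have sqrr : Num.sqrt r <= r.
    by rewrite -[leRHS]sqr_sqrtr ?(ltW r0)// expr2 ler_peMr// (le_trans ler01).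
  have mN : (m <= N)%N.
    rewrite -(ler_nat R); apply: le_trans m1 _.
    apply: (@le_trans _ _ (1 * r)); last by lra.
    by rewrite ler_pM ?sqr_ge0 ?sqrtr_ge0// expr_le1// ltW.
  have cs := coarse_le 0 x r0 mN.
  apply: (@le_trans _ _ (C * (2 * Num.sqrt (2 * m%:R / r)) + 4 * fine)); last first.
    rewrite lerD2r.
    pose rho := root4 r.
    have rho1 : 1 <= rho by exact: root4_ge1.
    have rho0 : 0 < rho by apply: lt_le_trans rho1.
    have rE : r = rho ^+ 4 by rewrite root4X// ltW.
    have sE : Num.sqrt r = rho ^+ 2 by rewrite /rho /root4 sqr_sqrtr// sqrtr_ge0.
    have h1 : Num.sqrt (2 * m%:R / r) <= 2 * s / rho.
      rewrite -[leRHS]gtr0_norm ?divr_gt0 ?mulr_gt0// -sqrtr_sqr ler_wsqrtr//.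
      rewrite ler_pdivrMr//.
      have -> : (2 * s / rho) ^+ 2 * r = 4 * (s ^+ 2 * rho ^+ 2).
        by rewrite rE; field; rewrite gt_eqF.
      by rewrite -sE; have := ler0n R m; lra.
    have h2 : om >= (2 * rho)^-1.
      rewrite lef_pV2 ?posrE ?mulr_gt0 ?root4_gt0//.
      have -> : 2 * rho = root4 (16 * r).
        by rewrite root4M// root4_16.
      by rewrite le_root4// /Y; lra.
    have h3 : (2 * rho)^-1 ^+ 5 <= om ^+ 5.
      have h2' : 0 <= (2 * rho)^-1 by rewrite invr_ge0 mulr_ge0// ltW.
      by rewrite lerXn2r ?nnegrE// ltW.
    have h4 : c0 / 16 / 24 / rho <= gain.
      have -> : c0 / 16 / 24 / rho = r * (2 * rho)^-1 ^+ 5 * c0 / 12.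
        by rewrite rE; field; rewrite gt_eqF.
      by rewrite /gain ler_wpM2r// ler_wpM2r ?(ltW c00)// ler_wpM2l// ltW.
    apply: (@le_trans _ _ (C * (2 * (2 * s / rho)))).
      by rewrite ler_wpM2l// ler_wpM2l.
    have -> : C * (2 * (2 * s / rho)) = 4 * C * s / rho by ring.
    have : 4 * C * s / rho <= c0 / 16 / 64 / rho by rewrite ler_wpM2r// invr_ge0 ltW.
    have : 0 <= c0 / rho by rewrite divr_ge0// ltW.
    have e1 : c0 / 16 / 24 / rho = c0 / rho / 16 / 24 by ring.
    have e2 : c0 / 16 / 64 / rho = c0 / rho / 16 / 64 by ring.
    rewrite e1 in h4; rewrite e2; lra.
  apply: le_trans (lerD cs sum_fine); rewrite -big_split/=; apply: ler_sum => i _.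
  case: ifPn => im.
    rewrite (le_trans (gap_block_le _ _ r0 (M0 _)))// lerDl.
    by rewrite mulr_ge0// exprn_ge0.
  rewrite add0r; apply: le_trans (gs_w _) _; apply: w_fine.
  have mn : m.+1%:R <= `|(i%:Z - N%:Z)%:~R| + 1 :> R.
    rewrite -intr_norm -natr1 lerD2r (_ : m%:R = (m%:Z)%:~R)// ler_int.
    move: im; rewrite negb_and -leqNgt -ltnNge ; clear; lia.
  apply: (@le_trans _ _ ((s ^+ 2 * Num.sqrt r) ^+ 2)).
    rewrite exprMn sqr_sqrtr ?(ltW r0)// -exprM -mulrA ler_wpM2l ?exprn_ge0 ?(ltW s0)//.
    by rewrite /Y; lra.
  by rewrite lerXn2r ?nnegrE ?addr_ge0// (le_trans _ mn)// ltW.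
(* Now [|x| > 8 r]: blocks off [[x, x + 4 r]] contribute 0, and those that meet it satisfy
   [|n| + 1 >= Y / 4], so that all are fine. *)
apply: (@le_trans _ _ (4 * fine)); last by lra.
apply: le_trans sum_fine; apply: ler_sum => i _.
set n := i%:Z - N%:Z.
have far (y : R) : Y / 4 <= y -> s ^+ 4 * Y / 16 <= y ^+ 2.
  move=> Yy; apply: (@le_trans _ _ ((Y / 4) ^+ 2)); last first.
    by rewrite lerXn2r ?nnegrE// ?(le_trans _ Yy)// divr_ge0// ltW.
  have -> : (Y / 4) ^+ 2 = Y * Y / 16 by field.
  rewrite ler_wpM2r// ler_wpM2r ?(ltW Y0)// (le_trans _ Y1)//.
  by rewrite exprn_ile1// ltW.
have [h|h] := leP (n + 1)%:~R x.
  by rewrite /gs gap_block_out//; [rewrite mulr_ge0// exprn_ge0|left].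
have [h'|h'] := leP (x + 4 * r) n%:~R.
  by rewrite /gs gap_block_out//; [rewrite mulr_ge0// exprn_ge0|right].
apply: le_trans (gs_w _) _; apply: w_fine; apply: far; rewrite -/n /Y.
have nlo : - `|n%:~R : R| <= n%:~R by rewrite lerNl -normrN ler_norm.
have nhi : n%:~R <= `|n%:~R : R| by exact: ler_norm.
rewrite intrD in h.
have [xp|xp] := leP 0 x.
  by move: xr; rewrite ger0_norm// => xr; lra.
by move: xr; rewrite ltr0_norm// => xr; lra.
Qed.

End slab_positive.

(** * Strict monotonicity in the translation *)

Section slab_strict.
Context {R : realType}.
Variables (H f : R -> R).
Hypothesis dH : forall t : R, is_derive t 1 H (f t).

Lemma is_derive_rescale (a r x : R) :
  is_derive x 1 (fun x => H ((a - x) / r)) (- (f ((a - x) / r) / r)).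
Proof.
have d1 : is_derive x 1 (fun x : R => (a - x) / r) (- r^-1).
  have d2 : is_derive x 1 (fun x : R => r^-1 *: (cst a x - id x)) (r^-1 *: (0 - 1)).
    by apply: is_deriveZ.
  rewrite (_ : (fun x : R => (a - x) / r) = (fun x : R => r^-1 *: (cst a x - id x))).
    by rewrite (_ : - r^-1 = r^-1 *: (0 - 1))// sub0r scalerN [_ *: 1]mulr1.
  by apply/funext => y; rewrite /= [LHS]mulrC.
rewrite (_ : - (f ((a - x) / r) / r) = f ((a - x) / r) * (- r^-1)); last by ring.
exact: (is_derive1_comp (dH _) d1).
Qed.

Lemma is_derive_slab_sum M (r x : R) N :
  is_derive x 1 (fun x => slab_sum M H r x N) (- (slab_sum M f r x N / r)).
Proof.
pose h (i : 'I_(N + N)) (j : 'I_(M (i%:Z - N%:Z))) (x : R) :=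
  H ((slab_lo M (i%:Z - N%:Z) j - x) / r) - H ((slab_hi M (i%:Z - N%:Z) j - x) / r).
pose dh (i : 'I_(N + N)) (j : 'I_(M (i%:Z - N%:Z))) (x : R) :=
  - (f ((slab_lo M (i%:Z - N%:Z) j - x) / r) / r) - - (f ((slab_hi M (i%:Z - N%:Z) j - x) / r) / r).
rewrite (_ : (fun x => _) = \sum_(i < N + N) \sum_(j < M (i%:Z - N%:Z)) h i j); last first.
  apply/funext => y; rewrite fct_sumE /slab_sum; apply: eq_bigr => i _.
  by rewrite fct_sumE.
rewrite (_ : - _ = \sum_(i < N + N) \sum_(j < M (i%:Z - N%:Z)) dh i j x); last first.
  rewrite /slab_sum mulr_suml -sumrN; apply: eq_bigr => i _.
  by rewrite mulr_suml -sumrN; apply: eq_bigr => j _; rewrite /dh; ring.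
apply: is_derive_sum => i; apply: is_derive_sum => j.
by apply: is_deriveB; exact: is_derive_rescale.
Qed.

Lemma slab_sum_decr M (r x1 x2 : R) N : 0 < r -> x1 < x2 ->
  (forall x, x1 <= x -> x <= x2 -> 0 < slab_sum M f r x N) ->
  slab_sum M H r x2 N < slab_sum M H r x1 N.
Proof.
move=> r0 x12 fpos.
have d x := is_derive_slab_sum M r x N.
have [|c cI E] := @MVT _ (fun x => slab_sum M H r x N) _ _ _ x12 (fun x _ => d x).
  apply: continuous_subspaceT => x.
  by apply: differentiable_continuous; apply/derivable1_diffP; have [] := d x.
rewrite -subr_lt0 E nmulr_rlt0 ?subr_gt0// oppr_lt0 divr_gt0//.
by move: cI; rewrite in_itv/= => /andP[c1 c2]; apply: fpos; exact: ltW.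
Qed.

End slab_strict.

(** * Lebesgue measure on R^d *)

Section outer_measure_rV.
Context {R : realType}.
Local Open Scope ereal_scope.
Implicit Types (d n : nat).

Lemma box_volume_ge0 d (B : 'rV[R]_d * 'rV[R]_d) : (0 <= box_volume B)%R.
Proof. by apply: prodr_ge0 => i _; rewrite le_max lexx. Qed.

Lemma cover_sum_ge0 d (B : nat -> 'rV[R]_d * 'rV[R]_d) :
  0 <= \sum_(k <oo) (box_volume (B k))%:E.
Proof. by apply: nneseries_ge0 => k _ _; rewrite lee_fin box_volume_ge0. Qed.

Lemma lebesgue_rV_ge0 d (A : set 'rV[R]_d) : 0 <= lebesgue_rV A.
Proof. by apply: le_ereal_inf_tmp => _ [B AB <-]; exact: cover_sum_ge0. Qed.

Lemma le_lebesgue_rV d : {homo @lebesgue_rV R d : A B / A `<=` B >-> A <= B}.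
Proof.
move=> A B AB; apply: ereal_inf_le_tmp => _ [C BC <-].
by exists C => //; exact: subset_trans BC.
Qed.

Lemma lebesgue_rV0 n : @lebesgue_rV R n.+1 set0 = 0.
Proof.
apply/eqP; rewrite eq_le lebesgue_rV_ge0 andbT.
apply: ereal_inf_lbound; exists (fun=> (0%R, 0%R)) => //.
apply: eseries0 => k _ _; congr (_%:E); rewrite /box_volume.
by rewrite big_ord_recl /= subrr maxxx mul0r.
Qed.

Lemma lebesgue_rV_sigma_subadditive d : sigma_subadditive (@lebesgue_rV R d).
Proof.
move=> A; have [[i ioo]|] := pselect (exists i, lebesgue_rV (A i) = +oo).
  rewrite (eseries_pinfty _ _ ioo) ?leey// => k _.
  by rewrite -ltNye (lt_le_trans _ (lebesgue_rV_ge0 _)).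
rewrite -forallNE => Aoo; apply/lee_addgt0Pr => e e0.
apply: le_trans (epsilon_trick _ (fun n => lebesgue_rV_ge0 _) (ltW e0)).
have fA n : lebesgue_rV (A n) \is a fin_num.
  by rewrite ge0_fin_numE ?lebesgue_rV_ge0// ltey; apply/eqP; exact: Aoo.
have /choice[G GP] n : exists B : nat -> 'rV[R]_d * 'rV[R]_d,
    A n `<=` \bigcup_k box (B k) /\
    \sum_(k <oo) (box_volume (B k))%:E <= lebesgue_rV (A n) + (e / (2 ^ n.+1)%:R)%:E.
  have en : (0 < e / (2 ^ n.+1)%:R)%R by rewrite divr_gt0// ltr0n expn_gt0.
  have [_ [B AB <-] /ltW lB] := lb_ereal_inf_adherent en (fA n).
  by exists B.
have /card_esym/ppcard_eqP[f] := card_nat2.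
have vol0 (x : nat * nat) : 0 <= (box_volume (G x.1 x.2))%:E.
  by rewrite lee_fin box_volume_ge0.
apply: (@le_trans _ _ (\sum_(i <oo) \sum_(j <oo) (box_volume (G i j))%:E)).
  apply: ereal_inf_lbound; exists (fun k => G (f k).1 (f k).2).
    move=> x [i _ /(proj1 (GP i))[j _ xij]].
    by exists (f^-1%FUN (i, j)) => //; rewrite invK ?inE.
  rewrite [LHS](nneseries_esumT (fun k => vol0 (f k))).
  rewrite [RHS]nneseries_esumT; last by move=> i; exact: cover_sum_ge0.
  rewrite (eq_esum (fun i _ => nneseries_esumT (fun j => vol0 (i, j)))).
  rewrite esum_esum => [|i j _ _]; last exact: (vol0 (i, j)).
  rewrite (_ : setT `*`` _ = setT); last by apply/seteqP; split.
  by rewrite (@reindex_esum _ _ _ setT setT f)//; exact: bijTT.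
by apply: lee_nneseries => [n _ _|n _]; [exact: cover_sum_ge0|exact: (GP n).2].
Qed.

HB.instance Definition _ n := isOuterMeasure.Build R 'rV[R]_n.+1
  (@lebesgue_rV R n.+1) (lebesgue_rV0 n) (@lebesgue_rV_ge0 n.+1)
  (@le_lebesgue_rV n.+1) (@lebesgue_rV_sigma_subadditive n.+1).

End outer_measure_rV.

Section measurable_rV.
Context {R : realType}.
Implicit Types (d n : nat).

Lemma normr_coord d (x : 'rV[R]_d) i : `|x 0 i| <= `|x|.
Proof.
rewrite [leRHS]/Num.norm/= mx_normrE; apply/bigmax_geP; right.
by exists (0, i).
Qed.

Lemma normr_rV_le d (x : 'rV[R]_d) (e : R) : 0 <= e ->
  (forall i, `|x 0 i| <= e) -> `|x| <= e.
Proof.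
move=> e0 xe; rewrite [leLHS]/Num.norm/= mx_normrE; apply/bigmax_leP; split => //=.
by move=> [i j] _ /=; rewrite (ord1 i).
Qed.

Definition set_coord d (v : 'rV[R]_d) i (t : R) : 'rV[R]_d :=
  \row_j (if j == i then t else v 0 j).

Lemma box_volume_split d (B : 'rV[R]_d * 'rV[R]_d) i c :
  box_volume (B.1, set_coord B.2 i (Num.min (B.2 0 i) c)) +
  box_volume (set_coord B.1 i (Num.max (B.1 0 i) c), B.2) = box_volume B.
Proof.
have split1 (l u : R) : Num.max 0 (Num.min u c - l) + Num.max 0 (u - Num.max l c) =
    Num.max 0 (u - l).
  by case: (leP u c) => ?; case: (leP l c) => ?; rewrite /Num.max;
    do ?case: ltP => ?; lra.
rewrite /box_volume (bigD1 i)//= [X in _ + X](bigD1 i)//= [RHS](bigD1 i)//=.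
rewrite !mxE eqxx -[in RHS]split1 mulrDl.
by congr (_ * _ + _ * _); apply: eq_bigr => j /negbTE ji; rewrite mxE ji.
Qed.

(** Cutting every box of a cover along the hyperplane yields covers of the two parts with the same
    total volume. *)
Lemma halfspace_coord_measurable n (i : 'I_n.+1) (c : R) :
  lebesgue_measurable [set x : 'rV[R]_n.+1 | x 0 i <= c].
Proof.
apply: le_caratheodory_measurable => X; apply: le_ereal_inf_tmp => _ [B XB <-].
pose B1 k := ((B k).1, set_coord (B k).2 i (Num.min ((B k).2 0 i) c)).
pose B2 k := (set_coord (B k).1 i (Num.max ((B k).1 0 i) c), (B k).2).
have -> : (\sum_(k <oo) (box_volume (B k))%:E =
    \sum_(k <oo) (box_volume (B1 k))%:E + \sum_(k <oo) (box_volume (B2 k))%:E)%E.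
  rewrite -nneseriesD => [|k _ _|k _ _]; try by rewrite lee_fin box_volume_ge0.
  by apply: eq_eseriesr => k _; rewrite -EFinD box_volume_split.
apply: leeD; apply: ereal_inf_lbound.
  exists B1 => // x [/XB[k _ xk]] /= xc; exists k => // j /=.
  have := xk j; rewrite !in_itv/= mxE; case: eqP => // -> /andP[-> h].
  by rewrite le_min h xc.
exists B2 => // x [/XB[k _ xk]] /= /negP; rewrite -ltNge => xc; exists k => // j /=.
have := xk j; rewrite !in_itv/= mxE; case: eqP => // -> /andP[h ->].
by rewrite gt_max h xc.
Qed.

Lemma box_measurable n (B : 'rV[R]_n.+1 * 'rV[R]_n.+1) : lebesgue_measurable (box B).
Proof.
pose S (i : 'I_n.+1) := [set x : 'rV[R]_n.+1 | x 0 i <= B.2 0 i] `\`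
  [set x : 'rV[R]_n.+1 | x 0 i <= B.1 0 i].
(* A finite intersection, written through a countable union; [inord k] reaches every coordinate. *)
have -> : box B = ~` \bigcup_k ~` S (inord k).
  rewrite setC_bigcup; apply/seteqP; split => x xB i => [_|].
    rewrite setCK; have := xB (inord i); rewrite in_itv/= => /andP[h1 h2].
    by split => //=; apply/negP; rewrite -ltNge.
  have := xB i I; rewrite setCK inord_val => -[/= h1 /negP].
  by rewrite -ltNge in_itv/= h1 => ->.
apply: caratheodory_measurable_setC; apply: caratheodory_measurable_bigcup => k.
apply: caratheodory_measurable_setC.
by apply: caratheodory_measurable_setD; exact: halfspace_coord_measurable.
Qed.

Definition lattice_box n (m : nat) (z : 'rV[int]_n) : 'rV[R]_n * 'rV[R]_n :=
  (\row_i ((z 0 i)%:~R / m.+1%:R), \row_i ((z 0 i + 1)%:~R / m.+1%:R)).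

(** An open set is the union of the boxes of the lattices of mesh [1 / (m + 1)] contained in it;
    [pickle] enumerates the pairs of a mesh and a lattice point. *)
Lemma open_measurable n (A : set 'rV[R]_n.+1) : open A -> lebesgue_measurable A.
Proof.
move=> oA; pose C (k : nat) : set 'rV[R]_n.+1 :=
  if @unpickle (nat * 'rV[int]_n.+1)%type k is Some (m, z) then
    if `[< box (lattice_box m z) `<=` A >] then box (lattice_box m z) else set0
  else set0.
have -> : A = \bigcup_k C k.
  apply/seteqP; split => x; last first.
    by move=> [k _]; rewrite /C; case: unpickle => [[m z]|//]; case: asboolP => // h /h.
  move=> Ax; have /nbhs_ballP[e /= e0 xeA] : nbhs x A by exact: open_nbhs_nbhs.
  pose m := Num.truncn e^-1.
  have m0 : 0 < m.+1%:R :> R by rewrite ltr0n.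
  have me : m.+1%:R^-1 < e by rewrite -[ltRHS]invrK ltf_pV2 ?posrE ?invr_gt0// truncnS_gt.
  pose z := \row_i (Num.ceil (x 0 i * m.+1%:R) - 1).
  have zx i : (z 0 i)%:~R < x 0 i * m.+1%:R <= (z 0 i + 1)%:~R.
    by rewrite mxE subrK ceil_ge andbT; have := ceil_itv (x 0 i * m.+1%:R) => /andP[].
  exists (pickle (m, z)) => //; rewrite /C pickleK asboolT.
    move=> i; rewrite in_itv/= !mxE ltr_pdivrMr// ler_pdivlMr//.
    by have := zx i; rewrite mxE.
  move=> y yb; apply: xeA; split => // i j; rewrite (ord1 i) -ball_normE/=.
  have := yb j; rewrite in_itv/= !mxE ltr_pdivrMr// ler_pdivlMr//.
  have := zx j; rewrite mxE intrD => /andP[h1 h2] /andP[h3 h4].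
  rewrite (le_lt_trans _ me)// -[leLHS](mulfK (lt0r_neq0 m0)) ler_pdivrMr//.
  rewrite mulVf ?lt0r_neq0// -[X in _ * X]gtr0_norm// -normrM mulrBl ler_norml; lra.
apply: caratheodory_measurable_bigcup => k; rewrite /C.
case: unpickle => [[m z]|]; last exact: caratheodory_measurable_set0.
by case: ifP => _; [exact: box_measurable|exact: caratheodory_measurable_set0].
Qed.

End measurable_rV.

Section unit_cover.
Context {R : realType}.

(* Induction on the dimension, integrating the covering inequality over the last
   coordinate, shows that the unit box has measure at least 1. *)
Lemma unit_cover d (w : nat -> R) (l u : nat -> nat -> R) : (forall k, 0 <= w k) ->
  (forall x : nat -> R, (forall i, 0 < x i <= 1) ->
    (1 <= \sum_(k <oo) (w k * \prod_(i < d) (l k i < x i <= u k i)%R%:R)%:E)%E) ->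
  (1 <= \sum_(k <oo) (w k * \prod_(i < d) Num.max 0 (u k i - l k i))%:E)%E.
Proof.
elim: d w => [|d IH] w w0 cov.
  have x01 (i : nat) : (0 : R) < 1 <= (1 : R) by rewrite ltr01 lexx.
  have := cov (fun=> 1) x01.
  by under eq_eseriesr do rewrite big_ord0; under [X in _ -> (_ <= X)%E]eq_eseriesr do rewrite big_ord0.
(* The last side length is absorbed into the weight; this is why the statement carries weights
   [w]. *)
under eq_eseriesr do rewrite big_ord_recr/= [X in _ * X]mulrC mulrA.
apply: IH => [k|x x01]; first by rewrite mulr_ge0// le_max lexx.
pose c k := w k * \prod_(i < d) (l k i < x i <= u k i)%R%:R.
have c0 k : 0 <= c k by rewrite mulr_ge0// prodr_ge0.
pose I k : set R := `]l k d, u k d]%classic.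
have mI k : measurable (I k) by exact: measurable_itv.
pose D : set R := `]0, 1]%classic.
have mD : measurable D by exact: measurable_itv.
have mf k : measurable_fun D ((fun t : R => ((c k)%:E * (\1_(I k) t)%:E)%E) : R -> \bar R).
  suff : measurable_fun D (EFin \o (fun t : R => c k * \1_(I k) t)) by [].
  by apply/measurable_EFinP; apply: measurable_funM => //; exact: measurable_indic.
have f0 k t : (0 <= (c k)%:E * (\1_(I k) t)%:E)%E.
  by rewrite -EFinM lee_fin mulr_ge0// indicE ler0n.
have cov1 t : D t -> (1 <= \sum_(k <oo) (c k)%:E * (\1_(I k) t)%:E)%E.
  rewrite /D/= in_itv/= => t01.
  pose y i := if i == d then t else x i.
  have y01 i : 0 < y i <= 1 by rewrite /y; case: eqP.
  have H := cov y y01.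
  apply: le_trans H _.
  apply: lee_nneseries => [k _ _|k _].
    by rewrite lee_fin mulr_ge0// prodr_ge0.
  rewrite -EFinM lee_fin big_ord_recr/= mulrA le_eqVlt; apply/orP; left; apply/eqP.
  congr (_ * _ * _).
    by apply: eq_bigr => i _; rewrite /y ltn_eqF.
  by rewrite /y eqxx indicE /I/= mem_setE in_itv.
have -> : 1%E = (\int[lebesgue_measure]_(t in D) (cst 1 t))%E :> \bar R.
  by rewrite integral_cst//= /D lebesgue_measure_itv/= lte_fin ltr01 sube0 mule1.
apply: (@le_trans _ _ (\int[lebesgue_measure]_(t in D) \sum_(k <oo) ((c k)%:E * (\1_(I k) t)%:E))%E).
  apply: ge0_le_integral => //.
  rewrite (_ : (fun t => _) = fun t => (\sum_(k <oo | k \in predT) (c k)%:E * (\1_(I k) t)%:E)%E).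
    by apply: ge0_emeasurable_sum => [k t _ _|k _]; [exact: f0|exact: mf].
  by [].
rewrite integral_nneseries//.
apply: lee_nneseries => [k _ _|k _]; first by apply: integral_ge0 => t _.
rewrite ge0_integralZl_EFin//; last first.
  by apply/measurable_EFinP; exact: (measurable_indic (D := D) (mI k)).
rewrite integral_indic//=; last exact: mI.
apply: (@le_trans _ _ ((c k)%:E * lebesgue_measure (I k))%E).
  apply: lee_wpmul2l; rewrite ?lee_fin//; apply: le_measure; rewrite ?inE//.
  - by apply: measurableI; [exact: mI|exact: mD].
  - exact: mI.
rewrite /I lebesgue_measure_itv/= lte_fin; case: ifPn => lu.
  rewrite -EFinB -EFinM lee_fin (max_r (_ : 0 <= _)) ?subr_ge0 ?(ltW lu)//.
  by rewrite /c mulrC mulrCA mulrA.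
rewrite mule0 lee_fin !mulr_ge0 ?le_max ?lexx//.
by rewrite prodr_ge0.
Qed.

End unit_cover.

Section volume.
Context {R : realType} (n : nat).
Notation rV := 'rV[R]_n.+1.
Implicit Types (A B : set rV) (x : rV) (r : R).

Definition affine_image r x A : set rV := [set r *: y + x | y in A].

Lemma affine_imageE r x A y : r != 0 -> affine_image r x A y <-> A (r^-1 *: (y - x)).
Proof.
move=> r0; split=> [[z Az <-]|Ay]; first by rewrite addrK scalerA mulVf// scale1r.
by exists (r^-1 *: (y - x)) => //; rewrite scalerA mulfV// scale1r subrK.
Qed.

Lemma lebesgue_rV_affine_le r x A : 0 < r ->
  (lebesgue_rV (affine_image r x A) <= (r ^+ n.+1)%:E * lebesgue_rV A)%E.
Proof.
move=> r0; have rn0 : 0 < r ^+ n.+1 by rewrite exprn_gt0.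
rewrite -lee_pdivrMl//; apply: le_ereal_inf_tmp => _ [B AB <-].
rewrite lee_pdivrMl// -nneseriesZl => [|k _]; last by rewrite lee_fin box_volume_ge0.
apply: ereal_inf_lbound.
exists (fun k => (r *: (B k).1 + x, r *: (B k).2 + x)).
  move=> _ [y /AB[k _ yk] <-]; exists k => // i; have := yk i.
  by rewrite !in_itv/= !mxE ltrD2r lerD2r ltr_pM2l// ler_pM2l.
apply: eq_eseriesr => k _; rewrite -EFinM; congr (_%:E); rewrite /box_volume /=.
rewrite -[X in r ^+ X]card_ord -prodr_const -big_split/=; apply: eq_bigr => i _.
rewrite !mxE opprD addrACA subrr addr0 -mulrBr.
by rewrite -{1}(mulr0 r) maxr_pMr// ltW.
Qed.

Lemma lebesgue_rV_affine r x A : 0 < r ->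
  lebesgue_rV (affine_image r x A) = ((r ^+ n.+1)%:E * lebesgue_rV A)%E.
Proof.
move=> r0; apply/eqP; rewrite eq_le lebesgue_rV_affine_le//=.
have rV0 : 0 < r^-1 by rewrite invr_gt0.
rewrite -lee_pdivlMl ?exprn_gt0// -exprVn.
have e : affine_image r^-1 (- (r^-1 *: x)) (affine_image r x A) = A.
  apply/seteqP; split => y.
    move=> [_ [z Az <-] <-].
    by rewrite scalerDr scalerA mulVf ?gt_eqF// scale1r addrK.
  move=> Ay; exists (r *: y + x); first by exists y.
  by rewrite scalerDr scalerA mulVf ?gt_eqF// scale1r addrK.
by rewrite -{1}e; exact: lebesgue_rV_affine_le.
Qed.

Definition cube x r : set rV := [set y | forall i, `|y 0 i - x 0 i| <= r].

Lemma lebesgue_rV_cube x r : 0 < r -> (lebesgue_rV (cube x r) <= ((3 * r) ^+ n.+1)%:E)%E.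
Proof.
move=> r0; apply: ereal_inf_lbound.
(* Boxes are open on the left, so the left face is moved out by [r]: hence side [3 r] instead of
   [2 r]. The remaining boxes of the cover are empty. *)
pose B0 : rV * rV := (\row_i (x 0 i - 2 * r), \row_i (x 0 i + r)).
exists (fun k => if k == 0%N then B0 else (0, 0)).
  move=> y yx; exists 0%N => // i; rewrite in_itv/= !mxE.
  by have := yx i; rewrite ler_norml; lra.
rewrite nneseries_recl//; last by move=> k _; rewrite lee_fin box_volume_ge0.
rewrite [X in (_ + X)%E]eseries0 ?adde0.
  congr (_%:E); rewrite /box_volume -[X in _ ^+ X]card_ord -prodr_const.
  by apply: eq_bigr => i _; rewrite !mxE max_r; [ring|lra].
by move=> [|k]//= _ _; rewrite /box_volume big_ord_recl/= subrr maxxx mul0r.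
Qed.

Definition unit_box : set rV := box (0 : rV, const_mx 1 : rV).

Lemma lebesgue_rV_unit_box : (1 <= lebesgue_rV unit_box)%E.
Proof.
apply: le_ereal_inf_tmp => _ [B BB <-].
pose l k i := (B k).1 0 (inord i : 'I_n.+1); pose u k i := (B k).2 0 (inord i : 'I_n.+1).
have := @unit_cover R n.+1 (fun=> 1) l u (fun=> ler01).
have -> : (\sum_(k <oo) (box_volume (B k))%:E = \sum_(k <oo)
   (1 * \prod_(i < n.+1) Num.max 0 (u k i - l k i))%:E)%E.
  apply: eq_eseriesr => k _; rewrite mul1r /box_volume; congr (_%:E).
  by apply: eq_bigr => i _; rewrite /u /l inord_val.
apply => x x01.
have [k _ xk] : (\bigcup_k box (B k)) (\row_i x i).
  by apply: BB => i; rewrite in_itv/= !mxE.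
rewrite (nneseriesD1 (n := k))// => [|j _]; last by rewrite lee_fin mul1r prodr_ge0.
rewrite (_ : 1 * \prod_(i < n.+1) _ = 1) ?leeDl//.
  by apply: nneseries_ge0 => j _ _; rewrite lee_fin mul1r prodr_ge0.
rewrite mul1r big1// => i _; have := xk i.
by rewrite in_itv/= !mxE /l /u inord_val => ->.
Qed.

End volume.

Section vol.
Context {R : realType} (n : nat).
Notation rV := 'rV[R]_n.+1.
Implicit Types (A B M : set rV) (x y c : rV) (r t : R).

(** [fine] sends [+oo] to 0, so [vol] is meaningful for sets of finite outer measure; the lemmas
    about it assume boundedness where this matters, and additivity asks for measurability of the
    cutting set only. *)
Definition vol A : R := fine (lebesgue_rV A).

Lemma bounded_cube A : bounded_set A -> exists2 r, 0 < r & A `<=` cube 0 r.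
Proof.
move=> [k [_ kA]]; exists (Num.max 1 (k + 1)); first by rewrite lt_max ltr01.
move=> y Ay i; rewrite !mxE subr0 (le_trans (normr_coord _ _))// le_max.
by rewrite (kA (k + 1) _ y Ay) ?orbT// ltrDl.
Qed.

Lemma cube_bounded A r : A `<=` cube 0 r -> bounded_set A.
Proof.
move=> Ar; exists r; split; first exact: num_real.
move=> k rk y /Ar yr.
have r0 : 0 <= r by apply: le_trans (yr 0).
apply: normr_rV_le => [|i]; first exact: le_trans (ltW rk).
by have := yr i; rewrite mxE subr0 => /le_trans; apply; exact: ltW.
Qed.

Lemma lebesgue_rV_vol A : bounded_set A -> lebesgue_rV A = (vol A)%:E.
Proof.
move=> /bounded_cube[r r0 Ar]; rewrite /vol fineK// ge0_fin_numE ?lebesgue_rV_ge0//.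
apply: le_lt_trans (le_lebesgue_rV Ar) _.
by apply: le_lt_trans (lebesgue_rV_cube _ r0) _; rewrite ltry.
Qed.

Lemma sub_bounded A B : A `<=` B -> bounded_set B -> bounded_set A.
Proof.
by move=> AB /bounded_cube[r _ Br]; apply: (@cube_bounded _ r); exact: subset_trans Br.
Qed.

Lemma vol_ge0 A : 0 <= vol A.
Proof. by rewrite /vol fine_ge0// lebesgue_rV_ge0. Qed.

Lemma le_vol A B : A `<=` B -> bounded_set B -> vol A <= vol B.
Proof.
move=> AB bB; rewrite -lee_fin -!lebesgue_rV_vol ?le_lebesgue_rV//.
exact: sub_bounded bB.
Qed.

Lemma vol_split M A : lebesgue_measurable M -> bounded_set A ->
  vol A = vol (A `&` M) + vol (A `&` ~` M).
Proof.
move=> mM bA; apply: EFin_inj; rewrite EFinD -!lebesgue_rV_vol//.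
  exact: sub_bounded bA.
exact: sub_bounded bA.
Qed.

Lemma bounded_affine r x A : bounded_set A -> bounded_set (affine_image r x A).
Proof.
move=> /bounded_cube[k k0 Ak]; apply: (@cube_bounded _ (`|r| * k + `|x|)).
move=> _ [y /Ak yk <-] i; rewrite !mxE subr0 (le_trans (ler_normD _ _))//.
rewrite lerD ?normr_coord// normrM ler_wpM2l//.
by have := yk i; rewrite mxE subr0.
Qed.

Lemma vol_affine r x A : 0 < r -> bounded_set A ->
  vol (affine_image r x A) = r ^+ n.+1 * vol A.
Proof.
move=> r0 bA; apply: EFin_inj.
rewrite -lebesgue_rV_vol; last exact: bounded_affine.
by rewrite lebesgue_rV_affine// lebesgue_rV_vol.
Qed.

Lemma bounded_cubeP x r : bounded_set (cube x r).
Proof.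
apply: (@cube_bounded _ (r + `|x|)) => y yr i; rewrite mxE subr0.
rewrite (_ : y 0 i = (y 0 i - x 0 i) + x 0 i); last by rewrite subrK.
by rewrite (le_trans (ler_normD _ _))// lerD ?normr_coord.
Qed.

Lemma vol_cube_le x r A : 0 < r -> A `<=` cube x r -> vol A <= (3 * r) ^+ n.+1.
Proof.
move=> r0 Ax; apply: (@le_trans _ _ (vol (cube x r))).
  by apply: le_vol => //; exact: bounded_cubeP.
rewrite -lee_fin -lebesgue_rV_vol; first exact: lebesgue_rV_cube.
exact: bounded_cubeP.
Qed.

Lemma interior_cube A : interior A !=set0 ->
  exists x r, 0 < r /\ (forall y, (forall i, `|y 0 i - x 0 i| <= r) -> A y).
Proof.
move=> [x /nbhs_ballP[e /= e0 xA]]; exists x, (e / 2); split; first by rewrite divr_gt0.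
move=> y yx; apply: xA; split => // i j; rewrite (ord1 i) -ball_normE/= distrC.
by rewrite (le_lt_trans (yx j))//; lra.
Qed.

Lemma vol_gt0 A : interior A !=set0 -> bounded_set A -> 0 < vol A.
Proof.
move=> /interior_cube[x [r [r0 xA]]] bA.
apply: (@lt_le_trans _ _ (vol (affine_image r x (@unit_box R n)))).
  have bU : bounded_set (@unit_box R n).
    apply: (@cube_bounded _ 1) => y yu i; have := yu i.
    by rewrite in_itv/= !mxE subr0 => /andP[h1 h2]; rewrite ger0_norm// ltW.
  rewrite vol_affine// mulr_gt0 ?exprn_gt0//.
  rewrite -lte_fin -lebesgue_rV_vol// (lt_le_trans _ (lebesgue_rV_unit_box _))//.
apply: le_vol => // _ [y yu <-]; apply: xA => i; rewrite !mxE addrK normrM gtr0_norm//.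
rewrite ler_piMr ?(ltW r0)//; have := yu i.
by rewrite in_itv/= !mxE => /andP[h1 h2]; rewrite ger0_norm// ltW.
Qed.

Definition lin c y : R := \sum_i c 0 i * y 0 i.

Lemma linD c x y : lin c (x + y) = lin c x + lin c y.
Proof. by rewrite /lin -big_split; apply: eq_bigr => i _; rewrite mxE mulrDr. Qed.

Lemma linZ c r y : lin c (r *: y) = r * lin c y.
Proof. by rewrite /lin mulr_sumr; apply: eq_bigr => i _; rewrite mxE mulrCA. Qed.

Lemma linN c y : lin c (- y) = - lin c y.
Proof. by rewrite -scaleN1r linZ mulN1r. Qed.

Lemma linB c x y : lin c (x - y) = lin c x - lin c y.
Proof. by rewrite linD linN. Qed.

Lemma linNl c y : lin (- c) y = - lin c y.
Proof. by rewrite /lin -sumrN; apply: eq_bigr => i _; rewrite mxE mulNr. Qed.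

Lemma lin_bound c y : `|lin c y| <= (\sum_i `|c 0 i|) * `|y|.
Proof.
rewrite mulr_suml; apply: le_trans (ler_norm_sum _ _ _) _.
by apply: ler_sum => i _; rewrite normrM ler_wpM2l// normr_coord.
Qed.

Lemma halfspace_measurable c t : lebesgue_measurable [set y | lin c y < t].
Proof.
apply: open_measurable; rewrite openE => y /= yt.
pose L := \sum_i `|c 0 i| + 1.
have L0 : 0 < L by rewrite ltr_pwDr// sumr_ge0.
apply/nbhs_ballP; exists ((t - lin c y) / L); first by rewrite /= divr_gt0// subr_gt0.
move=> z; rewrite -ball_normE/= distrC => zy.
have h : lin c (z - y) < t - lin c y.
  apply: le_lt_trans (ler_norm _) _; apply: le_lt_trans (lin_bound _ _) _.
  apply: (@le_lt_trans _ _ (L * `|z - y|)); first by rewrite ler_wpM2r// lerDl.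
  by rewrite mulrC -ltr_pdivlMr.
by rewrite linB in h; lra.
Qed.

End vol.

(** * Sections of a convex body *)

Section cone.
Context {R : realType} (n : nat).
Notation rV := 'rV[R]_n.+1.
Implicit Types (A B K : set rV) (x y c v : rV) (r s t : R).

Definition below c t : set rV := [set y | lin c y < t].

Lemma vol_slab A c s t : bounded_set A -> s <= t ->
  vol (A `&` below c t) =
  vol (A `&` below c s) + vol (A `&` [set y | s <= lin c y < t]).
Proof.
move=> bA st; rewrite (vol_split (@halfspace_measurable _ _ c s)); last first.
  by apply: sub_bounded bA => y [].
congr (_ + _); congr vol; apply/seteqP; split => y /=.
- by move=> [[? ?] ?].
- by move=> [? ys]; split=> //; split=> //; exact: lt_le_trans ys st.
- by move=> [[? yt] /negP]; rewrite -leNgt => ->.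
- by move=> [? /andP[ys yt]]; split => //; apply/negP; rewrite -leNgt.
Qed.

(* [N] translates of [B] along [v] are disjoint. *)
Lemma packing B c v (s t : R) (N : nat) (x : rV) (e : R) : lin c v = 1 ->
  0 < t -> 0 < e -> B `<=` cube x e -> (forall y, B y -> s <= lin c y < s + t) ->
  N%:R * vol B <= (3 * (e + N%:R * t * `|v|)) ^+ n.+1.
Proof.
move=> cv t0 e0 Bx Bs; set rho := e + _.
have rho0 : 0 < rho by rewrite ltr_pwDl// !mulr_ge0// ltW.
have bB : bounded_set B by apply: sub_bounded Bx _; exact: bounded_cubeP.
apply: le_trans (vol_cube_le rho0 (_ : cube x rho `<=` cube x rho)) => //.
suff H (m : nat) : (m <= N)%N -> m%:R * vol B <= vol (cube x rho `&` below c (s + m%:R * t)).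
  apply: le_trans (H N _) _ => //; apply: le_vol => [y []//|]; exact: bounded_cubeP.
elim: m => [_|m IH mN]; first by rewrite mul0r vol_ge0.
rewrite (@vol_slab _ _ (s + m%:R * t)); last 2 first.
- exact: bounded_cubeP.
- by rewrite lerD2l ler_wpM2r ?ler_nat// ltW.
rewrite -natr1 mulrDl mul1r lerD ?IH//; first exact: ltnW.
have -> : vol B = vol (affine_image 1 (m%:R * t *: v) B).
  by rewrite vol_affine// expr1n mul1r.
apply: le_vol; last by apply: sub_bounded (bounded_cubeP x rho) => y [].
move=> _ [y By <-]; split.
  move=> i; rewrite !mxE mul1r.
  have := Bx y By i; rewrite /rho => yx.
  rewrite (_ : _ - _ = (y 0 i - x 0 i) + m%:R * t * v 0 i); last by ring.
  rewrite (le_trans (ler_normD _ _))// lerD// normrM ger0_norm ?mulr_ge0 ?(ltW t0)//.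
  rewrite ler_pM ?mulr_ge0 ?(ltW t0) ?normr_coord//.
  by rewrite ler_wpM2r ?(ltW t0)// ler_nat ltnW.
by rewrite /= linD !linZ cv mul1r; have := Bs y By; lra.
Qed.

(** For every [N], translates by multiples of [v / N] put [N] disjoint copies of the section into
    one fixed cube. *)
Lemma vol_hyperplane A c v t : lin c v = 1 -> bounded_set A ->
  vol (A `&` [set y | lin c y = t]) = 0.
Proof.
move=> cv /bounded_cube[e e0 Ae]; apply/eqP; rewrite eq_le vol_ge0 andbT.
set B := _ `&` _; pose C := (3 * (e + `|v|)) ^+ n.+1.
have H (N : nat) : (0 < N)%N -> N%:R * vol B <= C.
  move=> N0; have N0' : 0 < N%:R :> R by rewrite ltr0n.
  have -> : C = (3 * (e + N%:R * N%:R^-1 * `|v|)) ^+ n.+1.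
    by rewrite /C mulfV ?gt_eqF// mul1r.
  apply: (@packing B c v t N%:R^-1 N 0 e) => //; rewrite ?invr_gt0//.
    by move=> y [/Ae].
  by move=> y [_ /= ->]; rewrite lexx ltrDl invr_gt0.
rewrite leNgt; apply/negP => B0.
have := H (Num.truncn (C / vol B)).+1 isT; rewrite leNgt => /negP; apply.
by rewrite -ltr_pdivrMr// truncnS_gt.
Qed.

Section apex.
Variables (K : set rV) (c z v : rV).
Hypotheses (cv : lin c v = 1) (bK : bounded_set K) (Kz : K z).
Hypothesis (Kcvx : forall x y t, K x -> K y -> 0 <= t <= 1 -> K (x + t *: (y - x))).

Hypothesis (Kge : forall y, K y -> lin c z <= lin c y).

Definition level (y : rV) : R := lin c y - lin c z.

(* By convexity, [K] lies inside the cone over its section at level [b] above that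
   level, and outside it below. *)
Definition section_cone (b t : R) : set rV :=
  [set y | exists s k, [/\ 0 <= s, K k, level k = b, y = z + s *: (k - z) & level y < t]].

Lemma level_ray s k : level (z + s *: (k - z)) = s * level k.
Proof. by rewrite /level linD linZ linB; ring. Qed.

Lemma bounded_section_cone b t : 0 < b -> bounded_set (section_cone b t).
Proof.
move=> b0; have [e e0 Ke] := bounded_cube bK.
apply: (@cube_bounded _ _ _ (e + t / b * (e + e))) => _ [s [k [s0 Kk kb -> yt]]] i.
rewrite level_ray kb -ltr_pdivlMr// in yt.
rewrite !mxE subr0 (le_trans (ler_normD _ _))//.
have := Ke _ Kz i; have := Ke _ Kk i; rewrite !mxE !subr0 => ki zi.
rewrite lerD// normrM (ger0_norm s0) ler_pM//; first exact: ltW.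
by rewrite (le_trans (ler_normB _ _))// lerD.
Qed.

(** The homothety of ratio [t] centred at the apex [z] maps the cone truncated at level 1 onto the
    one truncated at level [t]. *)
Lemma vol_section_cone b t : 0 < b -> 0 < t ->
  vol (section_cone b t) = t ^+ n.+1 * vol (section_cone b 1).
Proof.
move=> b0 t0; rewrite -(@vol_affine _ _ t ((1 - t) *: z))//; last exact: bounded_section_cone.
congr vol; apply/seteqP; split => y.
  move=> [s [k [s0 Kk kb -> yt]]].
  exists (z + (s / t) *: (k - z)); last first.
    by apply/rowP => i; rewrite !mxE; field; rewrite gt_eqF.
  exists (s / t), k; split => //; first by rewrite divr_ge0// ltW.
  by move: yt; rewrite !level_ray kb mulrAC ltr_pdivrMr// mul1r.
move=> [_ [s [k [s0 Kk kb -> yt]]] <-].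
exists (t * s), k; split => //; first by rewrite mulr_ge0// ltW.
  by apply/rowP => i; rewrite !mxE; ring.
have -> : t *: (z + s *: (k - z)) + (1 - t) *: z = z + (t * s) *: (k - z).
  by apply/rowP => i; rewrite !mxE; ring.
by move: yt; rewrite !level_ray kb => yt; rewrite -mulrA -[ltRHS]mulr1 ltr_pM2l.
Qed.

Let lt_level (y : rV) t : (level y < t) = (lin c y < lin c z + t).
Proof. by rewrite /level ltrBlDl. Qed.

Lemma vol_level_slab A a b : bounded_set A -> a <= b ->
  vol (A `&` [set y | a <= level y < b]) =
  vol (A `&` [set y | level y < b]) - vol (A `&` [set y | level y < a]).
Proof.
move=> bA ab; have h := @vol_slab A c (lin c z + a) (lin c z + b) bA.
have e t : [set y | level y < t] = below c (lin c z + t).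
  by apply/seteqP; split=> y /=; rewrite lt_level.
rewrite !e h ?lerD2l// addrC addKr; congr vol; apply/seteqP; split => y /= [Ay];
  by rewrite /level lerBrDl ltrBlDl.
Qed.

Lemma section_cone_below b s t : s <= t ->
  section_cone b t `&` [set y | level y < s] = section_cone b s.
Proof.
move=> st; apply/seteqP; split => y.
  by move=> [[k [x [? ? ? ? ?]]] ?]; exists k, x; split.
move=> [k [x [? ? ? ? ys]]]; split => //; exists k, x; split => //.
exact: lt_le_trans ys st.
Qed.

Lemma vol_section_cone_slab b s t : 0 < b -> 0 <= s -> s <= t ->
  vol (section_cone b t `&` [set y | s <= level y < t]) =
  (t ^+ n.+1 - s ^+ n.+1) * vol (section_cone b 1).
Proof.
move=> b0 s0 st; rewrite vol_level_slab//; last exact: bounded_section_cone.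
rewrite !section_cone_below// mulrBl.
have V r : 0 <= r -> vol (section_cone b r) = r ^+ n.+1 * vol (section_cone b 1).
  rewrite le_eqVlt => /orP[/eqP <-|]; last exact: vol_section_cone.
  rewrite expr0n/= mul0r (_ : section_cone b 0 = set0).
    by rewrite /vol lebesgue_rV0.
  apply/seteqP; split => // y [k [x [k0 _ xb -> ]]].
  by rewrite level_ray xb ltNge mulr_ge0// ltW.
by rewrite (V t) ?(V s) ?(le_trans s0).
Qed.

Lemma slab_le_cone b t : 0 < b -> b <= t ->
  vol (K `&` [set y | b <= level y < t]) <=
  (t ^+ n.+1 - b ^+ n.+1) * vol (section_cone b 1).
Proof.
move=> b0 bt; rewrite -vol_section_cone_slab//; last exact: ltW.
apply: le_vol; last by apply: sub_bounded (bounded_section_cone t b0) => y [].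
move=> y [Ky /andP[yb yt]]; have ly0 : 0 < level y by exact: lt_le_trans yb.
split; last by rewrite /= yb yt.
(* The second witness is the point at level [b] of the segment from [z] to [y]. *)
exists (level y / b), (z + (b / level y) *: (y - z)); split => //.
- by rewrite divr_ge0// ltW.
- apply: Kcvx => //; rewrite divr_ge0 ?(ltW b0) ?(ltW ly0)//=.
  by rewrite ler_pdivrMr// mul1r.
- by rewrite level_ray mulfVK// gt_eqF.
- by apply/rowP => i; rewrite !mxE; field; rewrite !gt_eqF.
Qed.

Lemma slab_ge_cone b s : 0 < b -> 0 <= s -> s <= b ->
  (b ^+ n.+1 - s ^+ n.+1) * vol (section_cone b 1) <=
  vol (K `&` [set y | s <= level y < b]).
Proof.
move=> b0 s0 sb; rewrite -vol_section_cone_slab//.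
apply: le_vol; last by apply: sub_bounded bK => y [].
move=> y [[k [x [k0 Kx xb yE yt]]] h]; split => //; rewrite yE.
apply: Kcvx => //; rewrite k0/=.
by move: yt; rewrite yE level_ray xb gtr_pMl// => /ltW.
Qed.

End apex.
End cone.

(** * Derivative of the volume below a level *)

Section profile.
Context {R : realType}.
Implicit Types (f g : R -> R) (a b t e : R).

Lemma is_derive_epsP f a df : is_derive a 1 f df <->
  (forall e, 0 < e -> exists2 d, 0 < d &
     forall h, `|h| < d -> `|f (a + h) - f a - df * h| <= e * `|h|).
Proof.
pose q h := h^-1 *: ((f \o shift a) (h *: 1) - f a).
have qE h : h != 0 -> `|f (a + h) - f a - df * h| = `|df - q h| * `|h|.
  move=> h0; rewrite distrC -normrM; congr (`| _ |).
  rewrite (_ : q h = h^-1 * (f (a + h) - f a)); first by field.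
  by rewrite /q /= /shift [h *: 1]mulr1 [h + a]addrC.
split=> [dfa e e0|H].
  have [/cvg_ex[l ql] dE] := dfa.
  have lE : df = l by rewrite -dE /derive; exact: cvg_lim.
  move: ql; rewrite -lE => /cvgrPdist_le/(_ e e0).
  rewrite /dnbhs /within /= => /nbhs_ballP[d /= d0 dP]; exists d => // h hd.
  have [->|h0] := eqVneq h 0; first by rewrite addr0 subrr mulr0 subrr normr0 mulr0.
  rewrite qE// ler_wpM2r//; apply: dP => //.
  by rewrite -ball_normE/= sub0r normrN.
have ql : q h @[h --> 0^'] --> df.
  apply/cvgrPdist_le => e e0; have [d d0 dP] := H e e0.
  rewrite /dnbhs /within; apply/nbhs_ballP; exists d => //= h.
  rewrite -ball_normE/= sub0r normrN => hd h0.
  by rewrite -(@ler_pM2r _ `|h|) ?normr_gt0// -qE//; exact: dP.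
by apply: DeriveDef; [apply/cvg_ex; exists df|exact: cvg_lim].
Qed.

Lemma is_derive_squeeze (lo H up : R -> R) a m1 m2 r : 0 < r ->
  is_derive a 1 lo m1 -> is_derive a 1 up m2 -> lo a = H a -> up a = H a ->
  (forall t, `|t - a| < r -> lo t <= H t <= up t) ->
  m1 = m2 /\ is_derive a 1 H m2.
Proof.
move=> r0 /is_derive_epsP dlo /is_derive_epsP dup loa upa squeeze.
have near e : 0 < e -> exists2 d, 0 < d & forall h, `|h| < d ->
    m1 * h - e * `|h| <= H (a + h) - H a <= m2 * h + e * `|h|.
  move=> e0; have [d1 d10 D1] := dlo e e0; have [d2 d20 D2] := dup e e0.
  exists (Num.min r (Num.min d1 d2)); first by rewrite !lt_min r0 d10.
  move=> h; rewrite !lt_min => /and3P[hr /D1 + /D2].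
  rewrite loa upa !ler_norml => h1 h2.
  have /squeeze : `|a + h - a| < r by rewrite addrC addKr.
  lra.
have m12 : m1 = m2.
  apply/eqP; rewrite -subr_eq0 -normr_le0 leNgt; apply/negP => m0.
  have e0 : 0 < `|m1 - m2| / 4 by rewrite divr_gt0.
  have [d d0 D] := near _ e0.
  have d2 : `|d / 2| < d by rewrite gtr0_norm ?divr_gt0//; lra.
  have := D (d / 2) d2; have := D (- (d / 2)).
  rewrite normrN gtr0_norm ?divr_gt0// => /(_ ltac:(lra)) h1 h2.
  set k := `|m1 - m2| in m0 e0 h1 h2.
  have kd : 0 < k * d by rewrite mulr_gt0.
  have : k * d = (m1 - m2) * d \/ k * d = (m2 - m1) * d.
    have [h|h] := leP 0 (m1 - m2); [left|right]; rewrite /k.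
      by rewrite ger0_norm.
    by rewrite ltr0_norm// opprB.
  by case=> hk; lra.
split => //; apply/is_derive_epsP => e e0; have [d d0 D] := near e e0.
by exists d => // h /D; rewrite m12 ler_norml; lra.
Qed.

Lemma is_derive_pow (k : R) m (t : R) :
  is_derive t 1 (fun t => k * t ^+ m.+1) (k * (m.+1%:R * t ^+ m)).
Proof.
have h : is_derive t 1 (fun x : R => x ^+ m.+1) (m.+1%:R * t ^+ m).
  apply: DeriveDef; first exact: exprn_derivable.
  by rewrite exp_derive [LHS]mulr1.
exact: (is_deriveZ k h).
Qed.

Lemma is_derive_powB (k b : R) m (t : R) :
  is_derive t 1 (fun t => k - b * (4 - t) ^+ m.+1) (b * (m.+1%:R * (4 - t) ^+ m)).
Proof.
have d1 : is_derive t 1 (fun t : R => 4 - t) (- 1).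
  have : is_derive t 1 (cst 4 - id : R -> R) (0 - 1) by exact: is_deriveB.
  by rewrite sub0r.
have d2 := @is_derive1_comp R (fun t => b * t ^+ m.+1) (fun t : R => 4 - t) t _ _
  (is_derive_pow b m (4 - t)) d1.
have : is_derive t 1 (cst k - ((fun t => b * t ^+ m.+1) \o (fun t : R => 4 - t)))
    (0 - (b * (m.+1%:R * (4 - t) ^+ m) * - 1)) by exact: is_deriveB.
by rewrite mulrN1 sub0r opprK.
Qed.

(** The mean value bound [y^m - x^m <= m y^(m-1) (y - x)], multiplied by [y] to avoid the exponent
    [m - 1]. *)
Lemma bernoulli_pow (x y : R) m : 0 <= x -> x <= y ->
  (y ^+ m - x ^+ m) * y <= m%:R * y ^+ m * (y - x).
Proof.
move=> x0 xy; have y0 : 0 <= y by exact: le_trans xy.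
elim: m => [|m IH]; first by rewrite !expr0 subrr !mul0r.
have -> : y ^+ m.+1 - x ^+ m.+1 = y * (y ^+ m - x ^+ m) + x ^+ m * (y - x).
  by rewrite !exprS; ring.
have -> : m.+1%:R * y ^+ m.+1 * (y - x) = y * (m%:R * y ^+ m * (y - x)) + y ^+ m * (y - x) * y.
  by rewrite -natr1 exprS; ring.
rewrite mulrDl lerD//; first by rewrite -mulrA ler_wpM2l.
by rewrite ler_wpM2r// ler_wpM2r ?subr_ge0// lerXn2r.
Qed.

Lemma powB_gt0 (x y : R) m : 0 <= x -> x < y -> 0 < y ^+ m.+1 - x ^+ m.+1.
Proof.
by move=> x0 xy; rewrite subr_gt0 ltrXn2r// nnegrE// (le_trans x0)// ltW.
Qed.

Section regularity.
Variables (m : nat) (H ga gb : R -> R) (V C1 : R).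
Hypotheses (V0 : 0 < V) (C10 : 0 <= C1).
Hypotheses (H0 : forall t : R, t <= 0 -> H t = 0) (H4 : forall t : R, 4 <= t -> H t = V).
Hypotheses (ga0 : forall b, 0 <= ga b) (gb0 : forall b, 0 <= gb b).
Hypothesis H_le : forall b t : R, 0 < b -> b < 4 -> 0 <= t -> t <= 4 ->
  H t <= H b + ga b * (t ^+ m.+1 - b ^+ m.+1).
Hypothesis H_ge : forall b t : R, 0 < b -> b < 4 -> 0 <= t -> t <= 4 ->
  H b + gb b * ((4 - b) ^+ m.+1 - (4 - t) ^+ m.+1) <= H t.
Hypothesis cap_lo : forall t : R, 0 <= t -> t <= 4 -> H t <= C1 * (t * Num.sqrt t).
Hypothesis cap_hi : forall t : R, 0 <= t -> t <= 4 ->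
  V - H t <= C1 * ((4 - t) * Num.sqrt (4 - t)).

(** The slope at [t] of the upper bound [H_le] with [b = t], that is, the volume growth of the cone
    over the section at level [t]. The cones from the two extreme points replace an integration over
    sections. *)
Definition density t : R := if (0 < t) && (t < 4) then ga t * (m.+1%:R * t ^+ m) else 0.

Lemma density_in t : 0 < t -> t < 4 -> density t = ga t * (m.+1%:R * t ^+ m).
Proof. by move=> t0 t4; rewrite /density t0 t4. Qed.

(** The bounds [H_le] and [H_ge] both touch [H] at [b], so the squeeze applies. *)
Lemma density_interior b : 0 < b -> b < 4 ->
  density b = gb b * (m.+1%:R * (4 - b) ^+ m) /\ is_derive b 1 H (density b).
Proof.
move=> b0 b4; rewrite density_in//.
pose up (t : R) := (H b - ga b * b ^+ m.+1) + ga b * t ^+ m.+1.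
pose lo (t : R) := (H b + gb b * (4 - b) ^+ m.+1) - gb b * (4 - t) ^+ m.+1.
have dup : is_derive b 1 up (ga b * (m.+1%:R * b ^+ m)).
  have : is_derive b 1 (cst (H b - ga b * b ^+ m.+1) + (fun t => ga b * t ^+ m.+1))
    (0 + ga b * (m.+1%:R * b ^+ m)) by apply: is_deriveD; exact: is_derive_pow.
  by rewrite add0r.
have dlo : is_derive b 1 lo (gb b * (m.+1%:R * (4 - b) ^+ m)) by exact: is_derive_powB.
have r0 : 0 < Num.min b (4 - b) by rewrite lt_min b0 subr_gt0.
have lob : lo b = H b by rewrite /lo; ring.
have upb : up b = H b by rewrite /up; ring.
have [t|e dH] := is_derive_squeeze r0 dlo dup lob upb; last by rewrite -e; split; rewrite ?e.
rewrite lt_min ltr_norml [X in _ && X]ltr_norml => /andP[h1 h2].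
have t0 : 0 <= t by lra.
have t4 : t <= 4 by lra.
by have := H_le b0 b4 t0 t4; have := H_ge b0 b4 t0 t4; rewrite /lo /up; lra.
Qed.

Lemma H_ge0 t : 0 <= H t.
Proof.
have [t0|t0] := leP t 0; first by rewrite H0.
have [t4|t4] := leP 4 t; first by rewrite H4// ltW.
have := H_le t0 t4 (lexx 0) (ler0n _ 4); rewrite (H0 (lexx 0)) expr0n/= sub0r mulrN.
have : 0 <= ga t * t ^+ m.+1 by rewrite mulr_ge0// exprn_ge0// ltW.
lra.
Qed.

Lemma H_leV t : H t <= V.
Proof.
have [t0|t0] := leP t 0; first by rewrite H0// ltW.
have [t4|t4] := leP 4 t; first by rewrite H4.
have := H_ge t0 t4 (ler0n _ 4) (lexx 4); rewrite (H4 (lexx 4)) subrr expr0n/= subr0.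
have : 0 <= gb t * (4 - t) ^+ m.+1 by rewrite mulr_ge0// exprn_ge0// subr_ge0 ltW.
lra.
Qed.

Lemma sqrt_small e : 0 < e -> exists2 d, 0 < d & forall h : R, `|h| < d ->
  C1 * (`|h| * Num.sqrt `|h|) <= e * `|h|.
Proof.
move=> e0; have C11 : 0 < C1 + 1 by rewrite ltr_pwDr.
exists ((e / (C1 + 1)) ^+ 2); first by rewrite exprn_gt0// divr_gt0.
move=> h hd; rewrite [_ * Num.sqrt _]mulrC mulrA ler_wpM2r//.
have : Num.sqrt `|h| <= e / (C1 + 1).
  by rewrite -[leRHS]gtr0_norm ?divr_gt0// -(sqrtr_sqr (e / _)) ler_wsqrtr// ltW.
rewrite ler_pdivlMr// => h1; have := sqrtr_ge0 `|h|.
by move: h1; rewrite mulrDr mulr1 mulrC; lra.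
Qed.

(** At 0 and 4 the cap bounds are of order [h^(3/2)], so [H] has derivative 0 from inside as well as
    from outside. *)
Lemma is_derive_density t : is_derive t 1 H (density t).
Proof.
have [/andP[t0 t4]|out] := boolP ((0 < t) && (t < 4)); first exact: (density_interior t0 t4).2.
rewrite /density (negbTE out); apply/is_derive_epsP => e e0.
have [d d0 D] := sqrt_small e0.
have [tlt|tge] := leP t 0.
  have [->|tn] := eqVneq t 0; last first.
    have {tlt tn}tn : t < 0 by rewrite lt_neqAle tn.
    exists (- t); first by rewrite oppr_gt0.
    move=> h; rewrite ltr_norml => ht.
    by rewrite !H0 ?mul0r ?subrr ?normr0 ?mulr_ge0 ?(ltW e0)//; lra.
  exists (Num.min d 4); first by rewrite lt_min d0/=.
  move=> h; rewrite lt_min => /andP[hd h4]; rewrite add0r mul0r subr0 (H0 (lexx 0)) subr0.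
  have [h0|h0] := leP h 0; first by rewrite H0// normr0 mulr_ge0// ltW.
  rewrite ger0_norm ?H_ge0//; apply: le_trans (D _ hd).
  rewrite gtr0_norm//; apply: cap_lo; first exact: ltW.
  by move: h4; rewrite gtr0_norm// => /ltW.
have {}out : 4 <= t by move: out; rewrite tge/= -leNgt.
have [->|tn] := eqVneq t 4; last first.
  have {out tn}tn : 4 < t by rewrite lt_neqAle eq_sym tn.
  exists (t - 4); first by rewrite subr_gt0.
  move=> h; rewrite ltr_norml => ht.
  by rewrite !H4 ?mul0r ?subrr ?subr0 ?normr0 ?mulr_ge0 ?(ltW e0)//; lra.
exists (Num.min d 4); first by rewrite lt_min d0/=.
move=> h; rewrite lt_min => /andP[hd h4]; rewrite mul0r subr0 (H4 (lexx 4)).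
have [h0|h0] := leP 0 h; first by rewrite H4 ?lerDl// subrr normr0 mulr_ge0// ltW.
rewrite ler0_norm ?subr_le0 ?H_leV// opprB; apply: le_trans (D _ hd).
rewrite ltr0_norm// in h4; rewrite ltr0_norm//.
have -> : - h = 4 - (4 + h) by ring.
by apply: cap_hi; lra.
Qed.

Lemma density_ge0 t : 0 <= density t.
Proof.
rewrite /density; case: ifP => // /andP[t0 _].
by rewrite !mulr_ge0// exprn_ge0// ltW.
Qed.

(** Using [H_le] from [b] to [b'] and back, the quotient of [H b' - H b] by [b'^(m+1) - b^(m+1)]
    lies between [ga b'] and [ga b]. *)
Lemma ga_decr b b' : 0 < b -> b < b' -> b' < 4 -> ga b' <= ga b.
Proof.
move=> b0 bb' b4'; have b0' : 0 < b' by apply: lt_trans bb'.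
have b4 : b < 4 by apply: lt_trans b4'.
have := H_le b0 b4 (ltW b0') (ltW b4'); have := H_le b0' b4' (ltW b0) (ltW b4).
have p0 : 0 < b' ^+ m.+1 - b ^+ m.+1 by apply: powB_gt0 => //; exact: ltW.
move=> h1 h2; rewrite -(ler_pM2r p0).
have e : b ^+ m.+1 - b' ^+ m.+1 = - (b' ^+ m.+1 - b ^+ m.+1) by rewrite opprB.
by rewrite e mulrN in h1; lra.
Qed.

Lemma gb_incr b b' : 0 < b -> b < b' -> b' < 4 -> gb b <= gb b'.
Proof.
move=> b0 bb' b4'; have b0' : 0 < b' by apply: lt_trans bb'.
have b4 : b < 4 by apply: lt_trans b4'.
have := H_ge b0 b4 (ltW b0') (ltW b4'); have := H_ge b0' b4' (ltW b0) (ltW b4).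
have p0 : 0 < (4 - b) ^+ m.+1 - (4 - b') ^+ m.+1 by apply: powB_gt0; lra.
move=> h1 h2; rewrite -(ler_pM2r p0).
have e : (4 - b') ^+ m.+1 - (4 - b) ^+ m.+1 = - ((4 - b) ^+ m.+1 - (4 - b') ^+ m.+1).
  by rewrite opprB.
by rewrite e mulrN in h1; lra.
Qed.

Lemma density_cap_lo b : 0 < b -> b < 4 -> density b <= m.+1%:R * C1 * Num.sqrt b.
Proof.
move=> b0 b4; rewrite density_in//.
have := H_le b0 b4 (lexx 0) (ler0n _ 4); rewrite (H0 (lexx 0)) expr0n/= sub0r mulrN => h.
have := cap_lo (ltW b0) (ltW b4) => h'.
rewrite -(ler_pM2r b0).
have -> : ga b * (m.+1%:R * b ^+ m) * b = m.+1%:R * (ga b * b ^+ m.+1) by rewrite exprS; ring.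
have -> : m.+1%:R * C1 * Num.sqrt b * b = m.+1%:R * (C1 * (b * Num.sqrt b)) by ring.
by rewrite ler_wpM2l//; lra.
Qed.

Lemma density_cap_hi b : 0 < b -> b < 4 -> density b <= m.+1%:R * C1 * Num.sqrt (4 - b).
Proof.
move=> b0 b4; rewrite (density_interior b0 b4).1.
have := H_ge b0 b4 (ler0n _ 4) (lexx 4); rewrite (H4 (lexx 4)) subrr expr0n/= subr0 => h.
have := cap_hi (ltW b0) (ltW b4) => h'.
have b4' : 0 < 4 - b by rewrite subr_gt0.
rewrite -(ler_pM2r b4').
have -> : gb b * (m.+1%:R * (4 - b) ^+ m) * (4 - b) = m.+1%:R * (gb b * (4 - b) ^+ m.+1).
  by rewrite exprS; ring.
have -> : m.+1%:R * C1 * Num.sqrt (4 - b) * (4 - b) =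
  m.+1%:R * (C1 * ((4 - b) * Num.sqrt (4 - b))) by ring.
by rewrite ler_wpM2l//; lra.
Qed.

(* A function of the form [x ^+ m * (nonincreasing)] bounded by [A * sqrt x] can
   only increase at the rate of [sqrt]. *)
Lemma growth_sqrt (x y gx gy A : R) : 0 < x -> x < y -> 0 <= gy -> gy <= gx ->
  gy * (m.+1%:R * y ^+ m) <= A * Num.sqrt y ->
  gy * (m.+1%:R * y ^+ m) - gx * (m.+1%:R * x ^+ m) <=
  2 * m%:R * A * (Num.sqrt y - Num.sqrt x).
Proof.
move=> x0 xy gy0 gyx gyA; have y0 : 0 < y by apply: lt_trans xy.
have sx0 : 0 < Num.sqrt x by rewrite sqrtr_gt0.
have sy0 : 0 < Num.sqrt y by rewrite sqrtr_gt0.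
have sxy : Num.sqrt x <= Num.sqrt y by rewrite ler_wsqrtr// ltW.
apply: (@le_trans _ _ (gy * m.+1%:R * (y ^+ m - x ^+ m))).
  have : gy * (m.+1%:R * x ^+ m) <= gx * (m.+1%:R * x ^+ m).
    by rewrite ler_wpM2r// mulr_ge0// exprn_ge0// ltW.
  have -> : gy * m.+1%:R * (y ^+ m - x ^+ m) =
    gy * (m.+1%:R * y ^+ m) - gy * (m.+1%:R * x ^+ m) by ring.
  lra.
have yE : y = Num.sqrt y ^+ 2 by rewrite sqr_sqrtr// ltW.
have xE : x = Num.sqrt x ^+ 2 by rewrite sqr_sqrtr// ltW.
rewrite -(ler_pM2r y0).
apply: (@le_trans _ _ (gy * m.+1%:R * (m%:R * y ^+ m * (y - x)))).
  rewrite -[leLHS]mulrA ler_wpM2l ?mulr_ge0//; apply: bernoulli_pow; exact: ltW.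
have -> : gy * m.+1%:R * (m%:R * y ^+ m * (y - x)) =
  (gy * (m.+1%:R * y ^+ m)) * (m%:R * (y - x)) by ring.
apply: (@le_trans _ _ (A * Num.sqrt y * (m%:R * (y - x)))).
  by rewrite ler_wpM2r// mulr_ge0// subr_ge0 ltW.
have A0 : 0 <= A.
  rewrite -(ler_pM2r sy0) mul0r; apply: le_trans gyA.
  by rewrite !mulr_ge0// exprn_ge0// ltW.
have -> : y - x = (Num.sqrt y - Num.sqrt x) * (Num.sqrt y + Num.sqrt x).
  by rewrite -subr_sqr -yE -xE.
apply: (@le_trans _ _ (2 * m%:R * A * (Num.sqrt y - Num.sqrt x) * Num.sqrt y ^+ 2)); last first.
  by rewrite -yE.
move: (Num.sqrt x) (Num.sqrt y) sx0 sy0 sxy {xE yE gyA} => a b a0 b0 ab.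
have -> : A * b * (m%:R * ((b - a) * (b + a))) = (A * m%:R * b * (b - a)) * (b + a) by ring.
have -> : 2 * m%:R * A * (b - a) * b ^+ 2 = (A * m%:R * b * (b - a)) * (2 * b) by ring.
rewrite ler_wpM2l//; last by lra.
by rewrite !mulr_ge0 ?(ltW b0)// subr_ge0.
Qed.

Let C2 := m.+1%:R * C1.
Let C3 := 2 * m%:R * C2 + C2.

Lemma C20 : 0 <= C2. Proof. by rewrite mulr_ge0. Qed.

Lemma C30 : 0 <= C3. Proof. by rewrite addr_ge0 ?mulr_ge0 ?C20. Qed.

(** Increases are bounded by [growth_sqrt] for the formula with [ga], decreases by the same lemma
    for the formula with [gb], read in the variable [4 - t]. When one point is an end of [[0, 4]], a
    cap bound does it; this is the second summand of [C3]. *)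
Lemma density_gauge s t : 0 <= s -> s <= t -> t <= 4 ->
  `|density t - density s| <= C3 * (psi t - psi s).
Proof.
move=> s0 st t4; have c20 := C20.
have mc : 0 <= 2 * m%:R * C2 by rewrite !mulr_ge0.
have q1 : Num.sqrt s <= Num.sqrt t by rewrite ler_wsqrtr.
have q2 : Num.sqrt (4 - t) <= Num.sqrt (4 - s) by rewrite ler_wsqrtr//; lra.
have [->|st'] := eqVneq s t; first by rewrite !subrr normr0 mulr0.
have {st st'}st : s < t by rewrite lt_neqAle st'.
have sqs := sqrtr_ge0 s; have sq4t := sqrtr_ge0 (4 - t).
set P := Num.sqrt t - Num.sqrt s; set Q := Num.sqrt (4 - s) - Num.sqrt (4 - t).
have P0 : 0 <= P by rewrite subr_ge0.
have Q0 : 0 <= Q by rewrite subr_ge0.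
have -> : C3 * (psi t - psi s) = C3 * P + C3 * Q by rewrite /psi /P /Q; ring.
have c3P : C3 * P = 2 * m%:R * C2 * P + C2 * P by rewrite /C3; ring.
have c3Q : C3 * Q = 2 * m%:R * C2 * Q + C2 * Q by rewrite /C3; ring.
have p1 : 0 <= 2 * m%:R * C2 * P by rewrite mulr_ge0.
have p2 : 0 <= C2 * P by rewrite mulr_ge0.
have p3 : 0 <= 2 * m%:R * C2 * Q by rewrite mulr_ge0.
have p4 : 0 <= C2 * Q by rewrite mulr_ge0.
have up : density t - density s <= C3 * P + C3 * Q.
  have [t4'|t4'] := leP 4 t.
    have -> : density t = 0 by rewrite /density [t < 4]ltNge t4' andbF.
    by have := density_ge0 s; lra.
  have [s0'|s0'] := leP s 0.
    have t0 : 0 < t by lra.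
    have := density_cap_lo t0 t4'; rewrite -/C2 => h.
    have eP : C2 * P = C2 * Num.sqrt t by rewrite /P (ler0_sqrtr s0') subr0.
    have := density_ge0 s; lra.
  have t0 : 0 < t by apply: lt_trans st.
  have s4 : s < 4 by apply: lt_trans t4'.
  have := density_cap_lo t0 t4'; rewrite !density_in// => h.
  have := growth_sqrt s0' st (ga0 t) (ga_decr s0' st t4') h.
  rewrite -/C2 -/P; lra.
have dn : density s - density t <= C3 * P + C3 * Q.
  have [s0'|s0'] := leP s 0.
    have -> : density s = 0 by rewrite /density ltNge s0'.
    by have := density_ge0 t; lra.
  have s4 : s < 4 by apply: lt_le_trans t4.
  have [t4'|t4'] := leP 4 t.
    have := density_cap_hi s0' s4; have := density_ge0 t.
    have : C2 * Q = C2 * Num.sqrt (4 - s).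
      by rewrite /Q (ler0_sqrtr (_ : 4 - t <= 0)) ?subr0//; lra.
    rewrite -/C2; lra.
  have t0 : 0 < t by apply: lt_trans st.
  have := density_cap_hi s0' s4.
  rewrite (density_interior s0' s4).1 (density_interior t0 t4').1 => h.
  have s4' : 4 - t < 4 - s by lra.
  have t4'' : 0 < 4 - t by lra.
  have := growth_sqrt t4'' s4' (gb0 s) (gb_incr s0' st t4') h.
  rewrite -/C2 -/Q; lra.
by rewrite ler_norml; lra.
Qed.

(** If [ga 2 = gb 2] were 0, then [V <= H 2] and [H 2 <= 0]. Away from 2 the monotonicity of [ga]
    (to the left) and [gb] (to the right) helps; on [[1, 3]] the relevant power of [t] or [4 - t] is
    at least 1. *)
Lemma density_pos : exists2 c0, 0 < c0 & forall t : R, 1 <= t -> t <= 3 -> c0 <= density t.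
Proof.
have two0 : (0 : R) < 2 by []. have two4 : (2 : R) < 4 by lra.
have [dE _] := density_interior two0 two4; rewrite density_in// in dE.
have p2 : 0 < m.+1%:R * 2 ^+ m :> R by rewrite mulr_gt0// exprn_gt0.
have e42 : 4 - 2 = 2 :> R by ring.
rewrite e42 in dE; have {}dE : ga 2 = gb 2 by apply: (mulIf (lt0r_neq0 p2)).
have ga2 : 0 < ga 2.
  rewrite lt_neqAle ga0 andbT; apply/eqP => g0.
  have := H_le two0 two4 (ler0n _ 4) (lexx 4); rewrite -g0 mul0r addr0 (H4 (lexx 4)).
  have := H_ge two0 two4 (lexx 0) (ler0n _ 4); rewrite -dE -g0 mul0r addr0 (H0 (lexx 0)).
  by have := V0; lra.
exists (m.+1%:R * ga 2); first by rewrite mulr_gt0.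
move=> t t1 t3; have t0 : 0 < t by lra.
have t4 : t < 4 by lra.
have [t2|t2] := leP t 2.
  rewrite density_in// mulrCA ler_wpM2l// -[leLHS]mulr1 ler_pM ?ler01//.
    by move: t2; rewrite le_eqVlt => /orP[/eqP ->//|t2]; exact: ga_decr.
  by rewrite exprn_ege1.
rewrite (density_interior t0 t4).1 dE mulrCA ler_wpM2l// -[leLHS]mulr1 ler_pM ?ler01//.
  exact: gb_incr.
by rewrite exprn_ege1//; lra.
Qed.

End regularity.

End profile.

Section apex_bounds.
Context {R : realType} (n : nat).
Notation rV := 'rV[R]_n.+1.
Implicit Types (y k : rV) (b s t e : R).
Variables (K : set rV) (c z v : rV).
Hypotheses (cv : lin c v = 1) (bK : bounded_set K) (Kz : K z).
Hypothesis Kcvx : forall x y t, K x -> K y -> 0 <= t <= 1 -> K (x + t *: (y - x)).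
Hypothesis Kge : forall y, K y -> lin c z <= lin c y.

Definition below_vol (t : R) : R := vol (K `&` [set y | level c z y < t]).

Lemma below_volB s t : s <= t ->
  vol (K `&` [set y | s <= level c z y < t]) = below_vol t - below_vol s.
Proof. by move=> st; rewrite vol_level_slab. Qed.

Lemma below_vol_le0 t : t <= 0 -> below_vol t = 0.
Proof.
move=> t0; rewrite /below_vol (_ : _ `&` _ = set0) ?/vol ?lebesgue_rV0//.
apply/seteqP; split => // y [/Kge Ky /=]; rewrite /level => yt.
by have := lt_le_trans yt t0; rewrite subr_lt0 ltNge Ky.
Qed.

Lemma below_vol_cone b t : 0 < b -> 0 <= t ->
  below_vol t <= below_vol b +
    vol (section_cone K c z b 1) * (t ^+ n.+1 - b ^+ n.+1).
Proof.
move=> b0 t0; have [tb|/ltW bt] := leP t b.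
  have := slab_ge_cone c bK Kz Kcvx b0 t0 tb; rewrite below_volB//.
  rewrite -[t ^+ _ - _]opprB mulrN [vol _ * _]mulrC; lra.
have := slab_le_cone c bK Kz Kcvx b0 bt; rewrite below_volB// [vol _ * _]mulrC.
lra.
Qed.

(** A cap of height [t] lies in a cube of size [O(sqrt t)] but is only [t] thick: about [1 / sqrt t]
    disjoint translates still fit into such a cube. So its volume is [O(t (sqrt t)^n)], and [n > 0]
    leaves at least one factor [sqrt t]. *)
Lemma below_vol_cap (C : R) : (0 < n)%N -> 0 < C ->
  (forall y, K y -> cube z (C * Num.sqrt (level c z y)) y) ->
  exists2 C1, 0 <= C1 & forall t, 0 <= t -> t <= 4 ->
    below_vol t <= C1 * (t * Num.sqrt t).
Proof.
move=> n0 C0 cap; pose D := 3 * (C + (C + 2) * `|v|).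
have D0 : 0 <= D by rewrite mulr_ge0// addr_ge0 ?mulr_ge0 ?(ltW C0)//; lra.
exists (D ^+ n.+1 / C * 2 ^+ n.-1).
  by rewrite mulr_ge0 ?exprn_ge0// divr_ge0 ?exprn_ge0// ltW.
move=> t; rewrite le_eqVlt => /orP[/eqP <- _|t0 t4].
  by rewrite below_vol_le0// mul0r mulr0.
set q := Num.sqrt t; have q0 : 0 < q by rewrite sqrtr_gt0.
have tq : t = q ^+ 2 by rewrite sqr_sqrtr// ltW.
have q2 : q <= 2.
  rewrite -(ler_sqr (ltW q0 : q \in Num.nneg))// -?tq; last by rewrite nnegrE.
  by rewrite (le_trans t4)// expr2; lra.
pose e := C * q; have e0 : 0 < e by rewrite mulr_gt0.
pose N := (Num.truncn (e / t)).+1.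
have et0 : 0 <= e / t by rewrite divr_ge0// ltW.
have N1 : e / t <= N%:R by rewrite ltW// truncnS_gt.
have N2 : N%:R * t <= (C + 2) * q.
  have : N%:R <= e / t + 1 by rewrite /N -natr1 lerD2r truncn_le.
  move=> /(ler_wpM2r (ltW t0)); rewrite mulrDl mul1r divfK ?gt_eqF// => h.
  apply: le_trans h _; rewrite mulrDl lerD2l [X in X <= _]tq expr2.
  by rewrite ler_wpM2r// ltW.
have capB : (K `&` [set y | level c z y < t]) `<=` cube z e.
  move=> y [/cap Ky yt] i; apply: le_trans (Ky i) _.
  by rewrite ler_wpM2l ?(ltW C0)// ler_wsqrtr// ltW.
have slabB y : (K `&` [set y | level c z y < t]) y -> lin c z <= lin c y < lin c z + t.
  by move=> [/Kge -> /=]; rewrite /level ltrBlDl.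
have := packing N cv t0 e0 capB slabB; rewrite -/(below_vol t) => h.
have h2 : N%:R * below_vol t <= (D * q) ^+ n.+1.
  have k1 : 0 <= 3 * (e + N%:R * t * `|v|).
    by rewrite mulr_ge0// addr_ge0 ?(ltW e0)// !mulr_ge0// ltW.
  apply: le_trans h _; rewrite lerXn2r ?nnegrE//; first by rewrite mulr_ge0// ltW.
  rewrite /D -[leRHS]mulrA ler_wpM2l// mulrDl lerD2l [leRHS]mulrAC ler_wpM2r//.
have h3 : e / t * below_vol t <= (D * q) ^+ n.+1.
  by apply: le_trans h2; rewrite ler_wpM2r// vol_ge0.
have -> : below_vol t = (e / t * below_vol t) * (t / e).
  by field; rewrite !gt_eqF.
apply: le_trans (ler_wpM2r _ h3) _; first by rewrite divr_ge0// ltW.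
have -> : (D * q) ^+ n.+1 * (t / e) = D ^+ n.+1 / C * t * q ^+ n.
  by rewrite /e exprMn [q ^+ n.+1]exprS; field; rewrite !gt_eqF.
rewrite -mulrA -[leRHS]mulrA ler_wpM2l ?divr_ge0 ?exprn_ge0 ?(ltW C0)//.
rewrite mulrCA ler_wpM2l ?(ltW t0)//.
(* The other [n - 1] factors [q] are at most 2 each, since [t <= 4]. *)
rewrite -[X in q ^+ X](prednK n0) exprSr ler_wpM2r ?(ltW q0)//.
by rewrite lerXn2r ?nnegrE ?(ltW q0).
Qed.

End apex_bounds.

Section convex_profile.
Context {R : realType} (n : nat).
Notation rV := 'rV[R]_n.+1.
Implicit Types (y k : rV) (b s t e : R).
Variables (K : set rV) (c z z' v : rV) (C : R).
Hypotheses (n0 : (0 < n)%N) (cv : lin c v = 1) (bK : bounded_set K) (Kz : K z) (Kz' : K z').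
Hypothesis Kcvx : forall x y t, K x -> K y -> 0 <= t <= 1 -> K (x + t *: (y - x)).
Hypothesis Kge : forall y, K y -> lin c z <= lin c y.
Hypothesis Kle : forall y, K y -> lin c y <= lin c z'.
Hypothesis height : lin c z' = lin c z + 4.
Hypotheses (V0 : 0 < vol K) (C0 : 0 < C).
Hypothesis cap : forall y, K y -> cube z (C * Num.sqrt (lin c y - lin c z)) y.
Hypothesis cap' : forall y, K y -> cube z' (C * Num.sqrt (lin c z' - lin c y)) y.

Let H := below_vol K c z.

Lemma vol_level_le t : vol (K `&` [set y | level c z y <= t]) = H t.
Proof.
have -> : K `&` [set y | level c z y <= t] =
    K `&` [set y | lin c y <= lin c z + t].
  by apply/seteqP; split => y /=; rewrite /level lerBlDl.
rewrite (vol_split (@halfspace_measurable _ _ c (lin c z + t))); last first.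
  by apply: sub_bounded bK => y [].
rewrite [X in _ + X](_ : _ = 0) ?addr0.
  congr vol; apply/seteqP; split => y /=.
    by move=> [[Ky _] ?]; split=> //; rewrite /level ltrBlDl.
  by move=> [Ky]; rewrite /level ltrBlDl => yt; split=> //; split=> //; exact: ltW.
rewrite -(vol_hyperplane (lin c z + t) cv bK); congr vol; apply/seteqP; split => y /=.
  by move=> [[Ky yt] /negP]; rewrite -leNgt => ty; split=> //; apply/eqP; rewrite eq_le yt ty.
by move=> [Ky ->]; split=> //; apply/negP; rewrite -leNgt.
Qed.

Lemma level_opp y : level (- c) z' y = 4 - level c z y.
Proof. by rewrite /level !linNl height; ring. Qed.

(** Seen from [z'] along [- c], the same volume is counted from the top; so the bounds for an apex
    at the bottom also give those at the top. *)
Lemma below_vol_opp t : below_vol K (- c) z' t = vol K - H (4 - t).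
Proof.
rewrite -vol_level_le /below_vol.
rewrite [X in X - _](vol_split (@halfspace_measurable _ _ (- c) (lin (- c) z' + t)) bK).
rewrite (_ : K `&` ~` _ = K `&` [set y | level c z y <= 4 - t]).
  rewrite addrK; congr vol; apply/seteqP; split => y /= [Ky].
    by rewrite {1}/level ltrBlDl.
  by rewrite {1}/level ltrBlDl.
apply/seteqP; split => y /= [Ky].
  move=> /negP; rewrite -leNgt => h; split=> //.
  by have := level_opp y; rewrite {1}/level; lra.
move=> h; split=> //; apply/negP; rewrite -leNgt.
by have := level_opp y; rewrite {1}/level; lra.
Qed.

Lemma convex_profile : exists f C0 c0, [/\ 0 <= C0, 0 < c0,
   forall t, is_derive t 1 H (f t) &
  [/\ forall t, 0 <= f t, forall t, t <= 0 -> f t = 0, forall t, 4 <= t -> f t = 0,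
    forall s t, 0 <= s -> s <= t -> t <= 4 -> `|f t - f s| <= C0 * (psi t - psi s) &
    forall t, 1 <= t -> t <= 3 -> c0 <= f t]].
Proof.
pose ga b := vol (section_cone K c z b 1).
pose gb b := vol (section_cone K (- c) z' (4 - b) 1).
have cv' : lin (- c) (- v) = 1 by rewrite linNl linN opprK.
have Kge' y : K y -> lin (- c) z' <= lin (- c) y by move=> /Kle; rewrite !linNl lerN2.
have [C1 C10 lo] := below_vol_cap cv Kge n0 C0 cap.
have cap'' y : K y -> cube z' (C * Num.sqrt (level (- c) z' y)) y.
  move=> /cap'; congr (cube _ (_ * Num.sqrt _) _).
  by rewrite /level !linNl opprK addrC.
have [C2 C20 hi] := below_vol_cap cv' Kge' n0 C0 cap''.
have H0 t : t <= 0 -> H t = 0 by exact: below_vol_le0.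
have H4 t : 4 <= t -> H t = vol K.
  move=> t4; have := below_vol_opp (4 - t); rewrite subKr below_vol_le0//; last by lra.
  by move=> /eqP; rewrite eq_sym subr_eq0 => /eqP.
pose C' := Num.max C1 C2.
have C'0 : 0 <= C' by rewrite le_max C10.
have capl t : 0 <= t -> t <= 4 -> H t <= C' * (t * Num.sqrt t).
  move=> t0 t4; apply: le_trans (lo t t0 t4) _.
  by rewrite ler_wpM2r ?mulr_ge0 ?sqrtr_ge0// le_max lexx.
have caph t : 0 <= t -> t <= 4 -> vol K - H t <= C' * ((4 - t) * Num.sqrt (4 - t)).
  move=> t0 t4; have e : t = 4 - (4 - t) by ring.
  rewrite {1}e -below_vol_opp; apply: le_trans (hi _ _ _) _; try lra.
  by rewrite ler_wpM2r ?mulr_ge0 ?sqrtr_ge0 ?subr_ge0// le_max lexx orbT.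
have Hle b t : 0 < b -> b < 4 -> 0 <= t -> t <= 4 ->
    H t <= H b + ga b * (t ^+ n.+1 - b ^+ n.+1).
  by move=> b0 _ t0 _; exact: below_vol_cone.
have Hge b t : 0 < b -> b < 4 -> 0 <= t -> t <= 4 ->
    H b + gb b * ((4 - b) ^+ n.+1 - (4 - t) ^+ n.+1) <= H t.
  move=> b0 b4 t0 t4.
  have b4' : 0 < 4 - b by lra.
  have t4' : 0 <= 4 - t by lra.
  have := below_vol_cone (- c) bK Kz' Kcvx b4' t4'; rewrite !below_vol_opp.
  have -> : 4 - (4 - t) = t by ring.
  have -> : 4 - (4 - b) = b by ring.
  rewrite -/(gb b) -[(4 - t) ^+ _ - _]opprB mulrN; lra.
have ga0 b : 0 <= ga b by exact: vol_ge0.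
have gb0 b : 0 <= gb b by exact: vol_ge0.
have [c0 c00 f13] := density_pos V0 H0 H4 ga0 gb0 Hle Hge.
exists (density n ga), (2 * n%:R * (n.+1%:R * C') + n.+1%:R * C'), c0; split => //.
- exact: C30.
- by apply: (@is_derive_density _ n H ga gb (vol K) C').
split => //.
- exact: density_ge0.
- by move=> t t0; rewrite /density ltNge t0.
- by move=> t t4; rewrite /density [t < 4]ltNge t4 andbF.
- by apply: (@density_gauge _ n H ga gb (vol K) C').
Qed.

End convex_profile.

(** * A convex set and its closure *)

Section convex_body.
Context {R : realType} (n : nat).
Notation rV := 'rV[R]_n.+1.
Implicit Types (A E K : set rV) (x y z : rV) (r s t e : R).

Definition line_convex E := forall x y t, E x -> E y -> 0 <= t <= 1 ->
  E (x + t *: (y - x)).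

Lemma convex_set_line E : @convex_set R _ E -> line_convex E.
Proof.
move=> cE x y t Ex Ey /andP[t0 t1].
have t01 : Itv.spec (@Itv.num_sem R) (Itv.Real `[0%Z, 1%Z]) t.
  by rewrite /= /Itv.num_sem/= num_real/= in_itv/= t0 t1.
have := cE y x (Itv.mk t01); rewrite !inE => /(_ Ey Ex).
have -> : x + t *: (y - x) = t *: y + (1 - t) *: x by apply/rowP => i; rewrite !mxE; ring.
by [].
Qed.

Lemma closure_cubeP E y : closure E y <->
  forall e, 0 < e -> exists2 x, E x & forall i, `|x 0 i - y 0 i| <= e.
Proof.
split=> [Ey e e0|H].
  have [x [Ex xy]] := Ey (ball y e) (nbhsx_ballx y e e0).
  exists x => // i; have [_ /(_ 0 i)] := xy.
  by rewrite -ball_normE/= distrC => /ltW.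
move=> B /nbhs_ballP[e /= e0 yB].
have e20 : 0 < e / 2 by rewrite divr_gt0.
have [x Ex xy] := H (e / 2) e20.
exists x; split => //; apply: yB; split => // i j; rewrite (ord1 i) -ball_normE/= distrC.
by rewrite (le_lt_trans (xy j))//; lra.
Qed.

Lemma line_convex_closure E : line_convex E -> line_convex (closure E).
Proof.
move=> cE x y t /closure_cubeP Ex /closure_cubeP Ey /andP[t0 t1].
apply/closure_cubeP => e e0; have [x' Ex' xx] := Ex e e0; have [y' Ey' yy] := Ey e e0.
exists (x' + t *: (y' - x')); first by apply: cE; rewrite ?t0.
move=> i; rewrite !mxE; have := xx i; have := yy i.
set a := y' 0 i - y 0 i; set b := x' 0 i - x 0 i => ha hb.
rewrite (_ : _ - _ = t * a + (1 - t) * b); last by rewrite /a /b; ring.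
apply: le_trans (ler_normD _ _) _; rewrite !normrM ger0_norm// (ger0_norm (_ : 0 <= 1 - t)) ?subr_ge0//.
have : t * `|a| <= t * e by rewrite ler_wpM2l.
have : (1 - t) * `|b| <= (1 - t) * e by rewrite ler_wpM2l// subr_ge0.
lra.
Qed.

Lemma bounded_closure E : bounded_set E -> bounded_set (closure E).
Proof.
move=> /bounded_cube[k k0 Ek]; apply: (@cube_bounded _ _ _ (k + 1)) => y /closure_cubeP Ey i.
have [x /Ek/(_ i) xk /(_ i) xy] := Ey 1 ltr01.
move: xk xy; rewrite !mxE !subr0 => xk xy.
rewrite (_ : y 0 i = x 0 i - (x 0 i - y 0 i)); last by ring.
by rewrite (le_trans (ler_normB _ _))// lerD.
Qed.

Section shrink.
Variables (E : set rV) (c0 : rV) (rho : R).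
Hypotheses (cE : line_convex E) (bE : bounded_set E) (rho0 : 0 < rho).
Hypothesis (c0E : cube c0 rho `<=` E).

Lemma closure_shrink y s : closure E y -> 0 <= s -> s < 1 ->
  interior E (c0 + s *: (y - c0)).
Proof.
(* Two errors of size [e], in [u] and in the approximation [y'] of [y], add up to [(1 - s) rho];
   division by [1 - s] keeps [w] in the cube around [c0]. *)
move=> /closure_cubeP Ey s0 s1; pose e := (1 - s) * rho / 2.
have e0 : 0 < e by rewrite divr_gt0// mulr_gt0// subr_gt0.
have [y' Ey' yy] := Ey e e0.
apply/nbhs_ballP; exists e => //= u [_ cu].
have {}cu i : `|u 0 i - (c0 + s *: (y - c0)) 0 i| <= e.
  by have := cu 0 i; rewrite -ball_normE/= distrC => /ltW.
pose w := (1 - s)^-1 *: (u - s *: y').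
have s10 : 0 < 1 - s by rewrite subr_gt0.
have Ew : E w.
  apply: c0E => i.
  have -> : w 0 i - c0 0 i = ((u 0 i - (c0 + s *: (y - c0)) 0 i) - s * (y' 0 i - y 0 i)) / (1 - s).
    by rewrite !mxE; field; rewrite gt_eqF.
  rewrite normrM normfV (gtr0_norm s10) ler_pdivrMr//.
  apply: le_trans (ler_normB _ _) _; rewrite normrM ger0_norm//.
  have : s * `|y' 0 i - y 0 i| <= e.
    by apply: le_trans (yy i); rewrite ler_piMl// ltW.
  by have := cu i; rewrite /e; lra.
have -> : u = w + s *: (y' - w).
  by apply/rowP => i; rewrite !mxE; field; rewrite gt_eqF.
by apply: cE => //; rewrite s0 ltW.
Qed.

(** Shrinking the closure towards [c0] by any [s < 1] puts it into the interior, so the two volumes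
    agree in the limit [s = 1]. *)
Lemma vol_closureD_interior : vol (closure E `\` interior E) = 0.
Proof.
have bK := bounded_closure bE.
have mI : lebesgue_measurable (interior E) by apply: open_measurable; exact: open_interior.
have H s : 0 < s -> s < 1 -> s ^+ n.+1 * vol (closure E) <= vol (interior E).
  move=> s0 s1; rewrite -(@vol_affine _ _ s (c0 - s *: c0))//.
  apply: le_vol; last by apply: sub_bounded bE; exact: interior_subset.
  move=> _ [y Ky <-]; have := closure_shrink Ky (ltW s0) s1.
  have -> // : c0 + s *: (y - c0) = s *: y + (c0 - s *: c0).
  by apply/rowP => i; rewrite !mxE; ring.
have KI : vol (closure E) <= vol (interior E).
  rewrite leNgt; apply/negP => IK; pose d := vol (closure E) - vol (interior E).
  have d0 : 0 < d by rewrite subr_gt0.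
  have VK0 : 0 < vol (closure E) by apply: le_lt_trans IK; exact: vol_ge0.
  have V0 := @vol_ge0 R n (interior E).
  (* By Bernoulli the factor [(1 - q)^(n+1)] loses at most [(n+1) q], here half of the supposed
     difference [d]. *)
  pose q := d / (2 * n.+1%:R * vol (closure E)).
  have D0 : 0 < 2 * n.+1%:R * vol (closure E) by rewrite !mulr_gt0.
  have q0 : 0 < q by rewrite divr_gt0.
  have q1 : q < 1.
    rewrite ltr_pdivrMr// mul1r; apply: (@le_lt_trans _ _ (vol (closure E))); first by rewrite /d; lra.
    have : 1 <= n.+1%:R :> R by rewrite ler1n.
    move=> /(ler_wpM2r (ltW VK0)); lra.
  have := H (1 - q); rewrite subr_gt0 q1 => /(_ isT); rewrite gtrBl q0 => /(_ isT).
  have := @bernoulli_pow _ (1 - q) 1 n.+1; rewrite subr_ge0 (ltW q1) gerBl (ltW q0).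
  move=> /(_ isT isT); rewrite expr1n mulr1 mulr1 => h1 h2.
  have : (1 - (1 - q) ^+ n.+1) * vol (closure E) <= (n.+1%:R * (1 - (1 - q))) * vol (closure E).
    by rewrite ler_wpM2r// vol_ge0.
  have -> : n.+1%:R * (1 - (1 - q)) * vol (closure E) = d / 2.
    by rewrite /q; field; rewrite gt_eqF//=.
  by rewrite /d in d0 *; lra.
have := vol_split mI bK.
have -> : closure E `&` interior E = interior E.
  by apply/setIidPr => y /interior_subset; exact: subset_closure.
by rewrite -setDE; have := @vol_ge0 R n (closure E `\` interior E); lra.
Qed.

Lemma null_measurable A : bounded_set A -> vol A = 0 -> lebesgue_measurable A.
Proof.
move=> bA A0; apply: le_caratheodory_measurable => X.
have XA : lebesgue_rV (X `&` A) = 0%E.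
  apply/eqP; rewrite eq_le lebesgue_rV_ge0 andbT.
  have <- : lebesgue_rV A = 0%E by rewrite lebesgue_rV_vol// A0.
  by apply: le_lebesgue_rV => y [].
have : (lebesgue_rV (X `&` A) + lebesgue_rV (X `&` ~` A) <= lebesgue_rV X)%E.
  by rewrite XA add0e; apply: le_lebesgue_rV => y [].
exact.
Qed.

Lemma convex_measurable : lebesgue_measurable E.
Proof.
have -> : E = interior E `|` (E `\` interior E).
  by rewrite setDE setUIr setUCr setIT; apply/esym/setUidPr; exact: interior_subset.
apply: caratheodory_measurable_setU.
  by apply: open_measurable; exact: open_interior.
have bD : bounded_set (E `\` interior E) by apply: sub_bounded bE => y [].
apply: null_measurable => //; apply/eqP; rewrite eq_le vol_ge0 andbT.
rewrite -vol_closureD_interior; apply: le_vol.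
  by move=> y [Ey ?]; split=> //; exact: subset_closure.
by apply: sub_bounded (bounded_closure bE) => y [].
Qed.

(** A farthest pair needs compactness, so the analysis concerns the closure; the null set by which
    it exceeds [E] does not affect the observed volumes. *)
Lemma vol_affine_closure r x T : 0 < r ->
  vol (affine_image r x E `&` T) = vol (affine_image r x (closure E) `&` T).
Proof.
move=> r0; have bK := bounded_closure bE.
have bA : bounded_set (affine_image r x (closure E)) by exact: bounded_affine.
apply/eqP; rewrite eq_le; apply/andP; split.
  apply: le_vol; last by apply: sub_bounded bA => y [].
  by move=> _ [[y Ey <-] Ty]; split=> //; exists y => //; exact: subset_closure.
set N := affine_image r x (closure E `\` interior E).
have bN : bounded_set N.
  by apply: bounded_affine; apply: sub_bounded bK => y [].
have N0 : vol N = 0.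
  rewrite vol_affine// ?vol_closureD_interior ?mulr0//.
  by apply: sub_bounded bK => y [].
have mN : lebesgue_measurable N by exact: null_measurable.
have bB : bounded_set (affine_image r x (closure E) `&` T) by apply: sub_bounded bA => y [].
rewrite (vol_split mN bB).
have : vol (affine_image r x (closure E) `&` T `&` N) <= 0.
  by rewrite -N0; apply: le_vol => // y [].
have : vol (affine_image r x (closure E) `&` T `&` ~` N) <= vol (affine_image r x E `&` T).
  apply: le_vol.
    move=> _ [[[y Ky <-] Ty] Ny]; split=> //; exists y => //.
    have [/interior_subset//|yI] := pselect (interior E y).
    by exfalso; apply: Ny; exists y.
  by apply: sub_bounded (bounded_affine r x bE) => y [].
lra.
Qed.

End shrink.
End convex_body.

(** * Choice of the directions *)

Section direction.
Context {R : realType} (n : nat).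
Notation rV := 'rV[R]_n.+1.
Implicit Types (u v w x y z : rV) (M : R) (i j : 'I_n.+1).

Definition wt i M j : R := if j == i then M else 1.

Definition wdot i M u v : R := \sum_j wt i M j * u 0 j * v 0 j.

Lemma wdotBB i M u v :
  wdot i M (u - v) (u - v) = wdot i M u u - 2 * wdot i M u v + wdot i M v v.
Proof.
rewrite /wdot mulr_sumr -sumrB -big_split/=; apply: eq_bigr => j _.
by rewrite !mxE; ring.
Qed.

Lemma wt_ge1 i M j : 1 <= M -> 1 <= wt i M j.
Proof. by move=> M1; rewrite /wt; case: ifP. Qed.

Lemma wdot_coord i M u j : 1 <= M -> (u 0 j) ^+ 2 <= wdot i M u u.
Proof.
move=> M1; rewrite /wdot (bigD1 j)//= -[leLHS]addr0 lerD//.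
  by rewrite -mulrA -expr2 ler_peMl ?sqr_ge0// wt_ge1.
by apply: sumr_ge0 => k _; rewrite -mulrA -expr2 mulr_ge0 ?sqr_ge0// (le_trans ler01)// wt_ge1.
Qed.

Lemma wdot_continuous i M :
  continuous (fun p : rV * rV => wdot i M (p.2 - p.1) (p.2 - p.1)).
Proof.
move=> p; have cc j : (fun q : rV * rV => q.2 0 j - q.1 0 j) @ p --> p.2 0 j - p.1 0 j.
  apply: cvgB.
    by apply: (cvg_comp snd (fun m : rV => m 0 j)); [exact: cvg_snd|exact: coord_continuous].
  by apply: (cvg_comp fst (fun m : rV => m 0 j)); [exact: cvg_fst|exact: coord_continuous].
rewrite /wdot (_ : (fun _ => _) = fun q : rV * rV =>
   \sum_j wt i M j * ((q.2 0 j - q.1 0 j) * (q.2 0 j - q.1 0 j))); last first.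
  by apply/funext => q; apply: eq_bigr => j _; rewrite !mxE mulrA.
apply: (@cvg_big _ _ _ _ _ add_continuous) => j _.
by apply: cvgM; [exact: cvg_cst|apply: cvgM; exact: cc].
Qed.

Lemma wdot_maximizer i M K : bounded_set K -> closed K -> K !=set0 ->
  exists z z', [/\ K z, K z' & forall y y', K y -> K y' ->
    wdot i M (y' - y) (y' - y) <= wdot i M (z' - z) (z' - z)].
Proof.
move=> bK cK [k0 Kk0].
have cptK : compact K by apply: bounded_closed_compact.
have [||p /set_mem[/= Kz Kz'] zmax] := @compact_EVT_max (rV * rV)%type R
    (fun p => wdot i M (p.2 - p.1) (p.2 - p.1)) (K `*` K) _ (compact_setX cptK cptK).
- by exists (k0, k0).
- by apply: continuous_subspaceT; exact: wdot_continuous.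
exists p.1, p.2; split=> // y y' Ky Ky'; apply: (zmax (y, y')); exact: mem_set.
Qed.

Definition dominant i (c : rV) : Prop := \sum_(j | j != i) `|c 0 j| < `|c 0 i|.

(** The second summand of [M] forces [|w_i| >= rho / 2], as the other coordinates contribute at most
    [(n+1) D^2] to the norm; the third makes [M rho / 2] exceed the sum of the other
    coefficients. *)
Lemma dominant_wdot i (D rho M : R) w : 0 < rho -> 0 < D ->
  M = 1 + 2 * n.+1%:R * D ^+ 2 / rho ^+ 2 + 2 * n.+1%:R * D / rho ->
  (forall j, `|w 0 j| <= D) -> M * rho ^+ 2 <= wdot i M w w ->
  dominant i (\row_j (wt i M j * w 0 j)).
Proof.
move=> rho0 D0 MD wD Mw; set m : R := n.+1%:R in MD.
have m1 : 1 <= m by rewrite /m ler1n.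
have M0 : 0 < M.
  by rewrite MD -addrA ltr_pwDl// addr_ge0// !mulr_ge0 ?invr_ge0 ?sqr_ge0// ?(ltW D0)// ?(ltW rho0)//; lra.
have cardD (F : 'I_n.+1 -> R) (B : R) : 0 <= B -> (forall j, F j <= B) ->
    \sum_(j | j != i) F j <= m * B.
  move=> B0 FB; apply: (@le_trans _ _ (\sum_(j < n.+1 | j != i) B)).
    by apply: ler_sum.
  apply: (@le_trans _ _ (\sum_(j < n.+1) B)).
    by rewrite [leRHS](bigID (fun j => j != i))/= lerDl sumr_ge0.
  by rewrite sumr_const card_ord /m mulr_natl.
have sq : wdot i M w w <= M * (w 0 i) ^+ 2 + m * D ^+ 2.
  rewrite /wdot (bigD1 i)//= {1}/wt eqxx -mulrA -expr2 lerD2l.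
  rewrite (eq_bigr (fun j => (w 0 j) ^+ 2)); last first.
    by move=> j /negbTE ji; rewrite /wt ji mul1r expr2.
  apply: cardD; first exact: sqr_ge0.
  by move=> j; rewrite -real_normK ?num_real// lerXn2r ?nnegrE ?(ltW D0).
have MD1 : 2 * (m * D ^+ 2) <= M * rho ^+ 2.
  rewrite MD -[leLHS](@divfK _ (rho ^+ 2)) ?expf_neq0 ?gt_eqF// ler_wpM2r ?sqr_ge0//.
  rewrite addrAC mulrA lerDr addr_ge0// !mulr_ge0 ?invr_ge0 ?(ltW D0) ?(ltW rho0)//; lra.
have MD2 : 2 * (m * D) < M * rho.
  rewrite MD -[ltLHS](@divfK _ rho) ?gt_eqF// ltr_pM2r// mulrA ltrDr.
  by rewrite ltr_pwDl// !mulr_ge0 ?invr_ge0 ?sqr_ge0//; lra.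
have wi : rho / 2 <= `|w 0 i|.
  rewrite -(@ler_pXn2r _ 2) ?nnegrE ?divr_ge0 ?(ltW rho0)// real_normK ?num_real//.
  rewrite -(ler_pM2l M0).
  have : 0 <= M * rho ^+ 2 by rewrite mulr_ge0 ?sqr_ge0 ?(ltW M0).
  move: (le_trans Mw sq) MD1; rewrite exprMn exprVn; lra.
rewrite /dominant (eq_bigr (fun j => `|w 0 j|)); last first.
  by move=> j /negbTE ji; rewrite mxE /wt ji mul1r.
rewrite mxE /wt eqxx normrM (gtr0_norm M0).
apply: (@le_lt_trans _ _ (m * D)); first exact: cardD (ltW D0) wD.
by move: wi; rewrite -(ler_pM2l M0); lra.
Qed.

(* [c] is the form [wdot i M w] scaled to height 4, where [w = z' - z] is the vector
   between two points of [K] at maximal distance for [wdot i M]. *)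
Lemma exists_direction i K c0 (rho : R) : bounded_set K -> closed K -> 0 < rho ->
  cube c0 rho `<=` K ->
  exists c z z' v (C : R), [/\ dominant i c, lin c v = 1, K z, K z' &
   [/\ forall y, K y -> lin c z <= lin c y, forall y, K y -> lin c y <= lin c z',
     lin c z' = lin c z + 4, 0 < C &
     (forall y, K y -> cube z (C * Num.sqrt (lin c y - lin c z)) y) /\
     (forall y, K y -> cube z' (C * Num.sqrt (lin c z' - lin c y)) y)]].
Proof.
move=> bK cK rho0 c0K; have [k k0 Kk] := bounded_cube bK.
pose D : R := k + k; have D0 : 0 < D by rewrite addr_gt0.
pose M : R := 1 + 2 * n.+1%:R * D ^+ 2 / rho ^+ 2 + 2 * n.+1%:R * D / rho.
have M1 : 1 <= M.
  by rewrite /M -addrA lerDl addr_ge0// !mulr_ge0 ?invr_ge0 ?sqr_ge0 ?(ltW D0) ?(ltW rho0).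
have Kc0 : K c0 by apply: c0K => j; rewrite subrr normr0 ltW.
have [|z [z' [Kz Kz' zmax]]] := @wdot_maximizer i M K bK cK; first by exists c0.
pose w := z' - z; pose Q := wdot i M w w.
(* The points [c0] and [c0 + rho e_i] of [K] already have squared distance [M rho^2]. *)
have MQ : M * rho ^+ 2 <= Q.
  have Kr : K (c0 + rho *: delta_mx 0 i).
    apply: c0K => j; rewrite !mxE addrAC subrr add0r eqxx/= normrM (gtr0_norm rho0).
    by rewrite -[leRHS]mulr1 ler_pM2l//; case: (j == i); rewrite ?normr1 ?normr0.
  have := zmax _ _ Kc0 Kr; rewrite [c0 + _ - c0]addrAC subrr add0r; apply: le_trans.
  by rewrite /wdot (bigD1 i)//= big1 => [|j /negbTE ji];
    rewrite !mxE ?eqxx ?ji ?andbF /wt ?eqxx/=; [rewrite addr0 !mulr1 -mulrA -expr2|rewrite !mulr0].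
have Q0 : 0 < Q by apply: lt_le_trans MQ; rewrite mulr_gt0 ?exprn_gt0//; lra.
pose c := (4 / Q) *: (\row_j (wt i M j * w 0 j)) : rV.
have linc y : lin c y = 4 / Q * wdot i M w y.
  rewrite /wdot /lin mulr_sumr; apply: eq_bigr => j _; rewrite /c !mxE; ring.
have lincB y y' : lin c y - lin c y' = 4 / Q * wdot i M w (y - y').
  by rewrite -linB linc.
(* In the norm of [wdot i M], maximality gives [|w - (y - z)|^2 <= |w|^2], hence
   [|y - z|^2 <= 2 <w, y - z>]: the distance to [z] is at most of the order of the square root of
   the height. *)
have low y : K y -> wdot i M (y - z) (y - z) <= Q / 2 * (lin c y - lin c z).
  move=> Ky; have := zmax _ _ Ky Kz'; rewrite -/w -/Q.
  rewrite (_ : z' - y = w - (y - z)); last by apply/rowP => j; rewrite !mxE; ring.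
  rewrite wdotBB -/Q lincB mulrA.
  by rewrite (_ : Q / 2 * (4 / Q) = 2); [lra|field; rewrite gt_eqF].
have high y : K y -> wdot i M (z' - y) (z' - y) <= Q / 2 * (lin c z' - lin c y).
  move=> Ky; have := zmax _ _ Kz Ky; rewrite -/w -/Q.
  rewrite (_ : y - z = w - (z' - y)); last by apply/rowP => j; rewrite !mxE; ring.
  rewrite wdotBB -/Q lincB mulrA.
  by rewrite (_ : Q / 2 * (4 / Q) = 2); [lra|field; rewrite gt_eqF].
have wdot_ge0 u : 0 <= wdot i M u u.
  by apply: le_trans (wdot_coord i u i M1); exact: sqr_ge0.
have Q20 : 0 < Q / 2 by rewrite divr_gt0.
exists c, z, z', (4^-1 *: w), (Num.sqrt (Q / 2)); split => //.
- have cE j : `|c 0 j| = 4 / Q * `|(\row_j (wt i M j * w 0 j)) 0 j|.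
    rewrite /c [X in `|X|]mxE normrM (@gtr0_norm _ (4 / Q))// divr_gt0//.
  rewrite /dominant cE (eq_bigr _ (fun j _ => cE j)) -mulr_sumr ltr_pM2l ?divr_gt0//.
  apply: (@dominant_wdot i D rho M w) => // j.
  rewrite /w mxE [(- z) 0 j]mxE; apply: le_trans (ler_normB _ _) _; rewrite lerD//.
    by have := Kk _ Kz' j; rewrite mxE subr0.
  by have := Kk _ Kz j; rewrite mxE subr0.
- by rewrite linZ linc -/Q; field; rewrite gt_eqF.
- split.
  + by move=> y Ky; rewrite -subr_ge0 -(pmulr_rge0 _ Q20) (le_trans _ (low _ Ky)).
  + by move=> y Ky; rewrite -subr_ge0 -(pmulr_rge0 _ Q20) (le_trans _ (high _ Ky)).
    by rewrite -(subrK (lin c z) (lin c z')) lincB -/w -/Q divfK ?gt_eqF// addrC.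
  + by rewrite sqrtr_gt0.
  + split=> y Ky j; rewrite -sqrtrM ?(ltW Q20)//.
      rewrite -sqrtr_sqr ler_wsqrtr//; apply: le_trans (low _ Ky).
      by have := wdot_coord i (y - z) j M1; rewrite !mxE.
    rewrite -normrN opprB -sqrtr_sqr ler_wsqrtr//; apply: le_trans (high _ Ky).
    by have := wdot_coord i (z' - y) j M1; rewrite !mxE.
Qed.

(** Diagonal dominance: at a coordinate [i] where [|x_i|] is largest, the [i]-th term of
    [lin (c i) x] outweighs all the others unless [x = 0]. *)
Lemma dominant_inj (c : 'I_n.+1 -> rV) x : (forall i, dominant i (c i)) ->
  (forall i, lin (c i) x = 0) -> x = 0.
Proof.
move=> dc cx.
pose i := [arg max_(i > ord0) `|x 0 i|]%O.
have imax j : `|x 0 j| <= `|x 0 i| by rewrite /i; case: arg_maxP => // k _; exact.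
have [x0|xi0] := eqVneq (x 0 i) 0.
  apply/rowP => j; rewrite mxE; apply/eqP; rewrite -normr_eq0 eq_le normr_ge0 andbT.
  by rewrite (le_trans (imax j))// x0 normr0.
have := cx i; rewrite /lin (bigD1 i)//= => /eqP; rewrite addr_eq0 => /eqP ci.
have : `|c i 0 i * x 0 i| < `|c i 0 i * x 0 i|.
  rewrite {1}ci normrN; apply: le_lt_trans (ler_norm_sum _ _ _) _.
  apply: (@le_lt_trans _ _ ((\sum_(j | j != i) `|c i 0 j|) * `|x 0 i|)).
    by rewrite mulr_suml; apply: ler_sum => j _; rewrite normrM ler_wpM2l.
  by rewrite normrM ltr_pM2r ?normr_gt0//; exact: dc.
by rewrite ltxx.
Qed.
End direction.

(** * Reconstruction *)

Section slab_test.
Context {R : realType} (n : nat).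
Notation rV := 'rV[R]_n.+1.
Implicit Types (A K : set rV) (c x y z : rV) (M : int -> nat) (m : int) (j : nat).

Definition slab_test M c : set rV :=
  [set y | exists m j, (j < M m)%N /\ slab_lo M m j <= lin c y < slab_hi M m j].

Lemma slab_test_measurable M c : lebesgue_measurable (slab_test M c).
Proof.
pose S (k : nat) : set rV := if @unpickle (int * nat)%type k is Some (m, j) then
  (if (j < M m)%N then [set y | lin c y < slab_hi M m j] `\` [set y | lin c y < slab_lo M m j]
   else set0) else set0.
have -> : slab_test M c = \bigcup_k S k.
  apply/seteqP; split => y /=.
    move=> [m [j [jM /andP[ylo yhi]]]]; exists (pickle (m, j)) => //.
    by rewrite /S pickleK jM; split => //=; apply/negP; rewrite -leNgt.
  move=> [k _]; rewrite /S; case: unpickle => // -[m j]; case: ifP => // jM [yhi /= /negP ylo].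
  by exists m, j; split=> //; rewrite -leNgt in ylo; rewrite ylo.
apply: caratheodory_measurable_bigcup => k; rewrite /S.
case: unpickle => [[m j]|]; last exact: caratheodory_measurable_set0.
case: ifP => _; last exact: caratheodory_measurable_set0.
by apply: caratheodory_measurable_setD; exact: halfspace_measurable.
Qed.

Lemma slab_lo_le_hi M m j : slab_lo M m j <= slab_hi M m j :> R.
Proof.
rewrite lerD2l ler_wpM2r ?invr_ge0// lerDl.
by have /andP[] := @dens01 R m.
Qed.

Lemma slab_hi_le_lo M m j : slab_hi M m j <= slab_lo M m j.+1 :> R.
Proof.
rewrite lerD2l ler_wpM2r ?invr_ge0// -natr1 lerD2l.
by have /andP[] := @dens01 R m.
Qed.

Lemma slab_lo0 M m : slab_lo M m 0 = m%:~R :> R.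
Proof. by rewrite /slab_lo mul0r addr0. Qed.

Lemma slab_lo_last M m : (0 < M m)%N -> slab_lo M m (M m) = (m + 1)%:~R :> R.
Proof. by move=> M0; rewrite /slab_lo divff ?intrD// pnatr_eq0 -lt0n. Qed.

Lemma slab_cell_uniq M m m' j j' (t : R) : (forall m, 0 < M m)%N ->
  (j < M m)%N -> (j' < M m')%N -> slab_lo M m j <= t < slab_lo M m j.+1 ->
  slab_lo M m' j' <= t < slab_lo M m' j'.+1 -> m = m' /\ j = j'.
Proof.
move=> M0; have cell m1 j1 : (j1 < M m1)%N -> slab_lo M m1 j1 <= t < slab_lo M m1 j1.+1 ->
    m1%:~R <= t < (m1 + 1)%:~R.
  move=> jM /andP[lo hi]; apply/andP; split.
    by apply: le_trans lo; rewrite lerDl divr_ge0.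
  apply: lt_le_trans hi _; rewrite -(slab_lo_last (M0 m1)) lerD2l ler_wpM2r ?invr_ge0//.
  by rewrite ler_nat.
move=> jM jM' tj tj'; have := cell _ _ jM tj; have := cell _ _ jM' tj'.
move=> /andP[a1 a2] /andP[b1 b2].
have m12 : m = m'.
  have := le_lt_trans a1 b2; have := le_lt_trans b1 a2; rewrite !ltr_int; clear; lia.
split => //; subst m'; have Mm : 0 < (M m)%:R :> R by rewrite ltr0n.
have lt_lo j1 j2 : slab_lo M m j1 <= t -> t < slab_lo M m j2.+1 -> (j1 <= j2)%N.
  move=> t1 t2; have := le_lt_trans t1 t2.
  by rewrite ltrD2l ltr_pM2r ?invr_gt0// ltr_nat.
move: tj tj' => /andP[t1 t2] /andP[t3 t4].
by apply/eqP; rewrite eqn_leq !lt_lo.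
Qed.

Section slices.
Variables (A : set rV) (M : int -> nat) (c : rV).
Hypotheses (bA : bounded_set A) (M0 : forall m, (0 < M m)%N).

Let G (t : R) := vol (A `&` below c t).
Let P (t : R) := vol ((A `&` slab_test M c) `&` below c t).

Lemma slab_test_cell m j : (j < M m)%N ->
  P (slab_lo M m j.+1) = P (slab_lo M m j) + (G (slab_hi M m j) - G (slab_lo M m j)).
Proof.
move=> jM; have lh := slab_lo_le_hi M m j; have hl := slab_hi_le_lo M m j.
have bT : bounded_set (A `&` slab_test M c) by apply: sub_bounded bA => y [].
rewrite {1}/P (vol_slab c bT (le_trans lh hl)) -/(P _); congr (_ + _).
rewrite {1}/G (vol_slab c bA lh) -/(G _) addrAC subrr add0r; congr vol.
apply/seteqP; split => y /=.
  move=> [[Ay [m' [j' [jM' lh']]]] yj]; split => //.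
  have [|mE jE] := slab_cell_uniq M0 jM jM' yj.
    by move: lh' => /andP[-> yhi] /=; apply: lt_le_trans yhi _; exact: slab_hi_le_lo.
  by subst m' j'.
move=> [Ay yj]; split; first by split => //; exists m, j.
by move: yj => /andP[-> yhi] /=; exact: lt_le_trans yhi hl.
Qed.

Lemma slab_test_block m : P (m + 1)%:~R = P m%:~R +
  \sum_(j < M m) (G (slab_hi M m j) - G (slab_lo M m j)).
Proof.
rewrite -(slab_lo_last (M0 m)) -(slab_lo0 M m).
suff S k : (k <= M m)%N -> P (slab_lo M m k) = P (slab_lo M m 0) +
    \sum_(j < k) (G (slab_hi M m j) - G (slab_lo M m j)) by exact: S.
elim: k => [|k IH] kM; first by rewrite big_ord0 addr0.
by rewrite big_ord_recr/= addrA -IH ?(ltnW kM)// slab_test_cell.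
Qed.

Lemma vol_slab_test N : (forall y, A y -> - N%:R <= lin c y < N%:R) ->
  vol (A `&` slab_test M c) = \sum_(i < N + N) \sum_(j < M (i%:Z - N%:Z))
    (G (slab_hi M (i%:Z - N%:Z) j) - G (slab_lo M (i%:Z - N%:Z) j)).
Proof.
move=> AN; have PN : P N%:R = vol (A `&` slab_test M c).
  congr vol; apply/seteqP; split => y /=; first by move=> [].
  by move=> [Ay Ty]; split => //; rewrite /below/=; have /andP[] := AN _ Ay.
have PN' : P (- N%:R) = 0.
  rewrite /P (_ : _ `&` _ = set0) ?/vol ?lebesgue_rV0//.
  rewrite -subset0 => y /= [[Ay _]]; rewrite /below/=.
  by have /andP[h _] := AN _ Ay; rewrite ltNge h.
have step k : P (k%:Z - N%:Z)%:~R = \sum_(i < k) \sum_(j < M (i%:Z - N%:Z))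
    (G (slab_hi M (i%:Z - N%:Z) j) - G (slab_lo M (i%:Z - N%:Z) j)).
  elim: k => [|k IH]; first by rewrite big_ord0 sub0r mulrNz PN'.
  rewrite big_ord_recr/= -IH -slab_test_block; congr (P _%:~R).
  by clear; lia.
by rewrite -step -PN PoszD addrK.
Qed.
End slices.

Section translates.
Variables (K : set rV) (c z : rV) (M : int -> nat).
Hypotheses (bK : bounded_set K) (M0 : forall m, (0 < M m)%N).
Hypothesis Klevel : forall y, K y -> 0 <= level c z y <= 4.

(** [lin c x + r * lin c z] is the height of [r *: z + x], the image of the reference point; this
    shift is the [x] of [slab_sum]. *)
Lemma vol_affine_below (r t : R) x : 0 < r ->
  vol (affine_image r x K `&` below c t) =
  r ^+ n.+1 * below_vol K c z ((t - (lin c x + r * lin c z)) / r).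
Proof.
move=> r0; rewrite /below_vol -(vol_affine x r0); last by apply: sub_bounded bK => y [].
have E y : (lin c (r *: y + x) < t) = (level c z y < (t - (lin c x + r * lin c z)) / r).
  by rewrite ltr_pdivlMr// linD linZ /level ltrBrDr; congr (_ < _); ring.
congr vol; apply/seteqP; split => y /=.
  by move=> [[k Kk <-]]; rewrite /below/= E => kt; exists k.
by move=> [k [Kk kt] <-]; split; [exists k|rewrite /below/= E].
Qed.

Lemma vol_affine_slab_test (r : R) x N : 0 < r ->
  `|lin c x + r * lin c z| + 4 * r < N%:R ->
  vol (affine_image r x K `&` slab_test M c) =
  - (r ^+ n.+1 * slab_sum M (below_vol K c z) r (lin c x + r * lin c z) N).
Proof.
move=> r0; set x' := lin c x + r * lin c z => xN.
rewrite (@vol_slab_test _ M c (bounded_affine r x bK) M0 N); last first.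
  move=> _ [k Kk <-]; have /andP[k0 k4] := Klevel Kk.
  have -> : lin c (r *: k + x) = x' + r * level c z k by rewrite linD linZ /level /x'; ring.
  have : 0 <= r * level c z k by rewrite mulr_ge0 ?(ltW r0).
  have : r * level c z k <= r * 4 by rewrite ler_pM2l.
  have := ler_norm x'; have := ler_norm (- x'); rewrite normrN.
  by move: xN; lra.
rewrite /slab_sum mulr_sumr -sumrN; apply: eq_bigr => i _.
rewrite mulr_sumr -sumrN; apply: eq_bigr => j _.
by rewrite !vol_affine_below// -/x'; ring.
Qed.
End translates.
End slab_test.

Section reconstruction.
Context {R : realType} (n : nat).
Notation rV := 'rV[R]_n.+1.

(** For every fixed [r >= 1] the volume is strictly increasing in [lin p.1 x]. The two copies
    compared share the same [r], which the whole space has to provide first. *)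
Lemma exists_slab_test (i : 'I_n.+1) (K : set rV) c0 (rho : R) : (0 < n)%N ->
  bounded_set K -> closed K -> line_convex K -> 0 < rho -> cube c0 rho `<=` K ->
  exists p : rV * set rV, [/\ dominant i p.1, lebesgue_measurable p.2 &
    forall r x1 x2, 1 <= r -> vol (affine_image r x1 K `&` p.2) =
      vol (affine_image r x2 K `&` p.2) -> lin p.1 x1 = lin p.1 x2].
Proof.
move=> n0 bK cK cvxK rho0 c0K.
have V0 : 0 < vol K.
  apply: vol_gt0 => //; exists c0; rewrite /interior/= -nbhs_ballE; exists rho => //= y; rewrite -ball_normE /= => cy.
  apply: c0K => j; rewrite -normrN opprB; apply: le_trans (ltW cy).
  by have := normr_coord (c0 - y) j; rewrite !mxE.
have [c [z [z' [v [C [dc cv Kz Kz' [Kge Kle height C0 [cap cap']]]]]]]] :=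
  exists_direction i bK cK rho0 c0K.
have [f [C1 [h0 [C10 h00 dH [f0 flo fhi fC fmid]]]]] :=
  convex_profile n0 cv bK Kz Kz' cvxK Kge Kle height V0 C0 cap cap'.
have [M [M0 Mpos]] := slab_positive C10 h00 f0 flo fhi fC fmid.
have Klevel y : K y -> 0 <= level c z y <= 4.
  move=> Ky; have := Kge _ Ky; have := Kle _ Ky; rewrite height /level => h1 h2.
  by apply/andP; split; lra.
have decr r x1 x2 : 1 <= r -> lin c x1 < lin c x2 ->
    vol (affine_image r x1 K `&` slab_test M c) < vol (affine_image r x2 K `&` slab_test M c).
  move=> r1 x12; have r0 : 0 < r by lra.
  pose t1 := lin c x1 + r * lin c z; pose t2 := lin c x2 + r * lin c z.
  have t12 : t1 < t2 by rewrite ltrD2r.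
  have [N NE] : exists N : nat, `|t1| + `|t2| + 4 * r < N%:R.
    exists (Num.truncn (`|t1| + `|t2| + 4 * r)).+1; exact: truncnS_gt.
  have n1 := normr_ge0 t1; have n2 := normr_ge0 t2.
  rewrite !(@vol_affine_slab_test _ _ _ _ _ _ bK M0 Klevel r _ N r0); [|lra..].
  rewrite ltrN2 ltr_pM2l ?exprn_gt0//; apply: slab_sum_decr dH _ _ _ _ _ r0 t12 _.
  move=> x x1x xx2; apply: Mpos => //; apply: le_trans (ltW NE); rewrite lerD2r.
  rewrite ler_norml; apply/andP; split; have := ler_norm t2; have := ler_norm (- t1);
    rewrite normrN; lra.
exists (c, slab_test M c); split => //=; first exact: slab_test_measurable.
move=> r x1 x2 r1 E.
have [lt|lt|//] := ltgtP (lin c x1) (lin c x2).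
  by have := decr _ _ _ r1 lt; rewrite E ltxx.
by have := decr _ _ _ r1 lt; rewrite E ltxx.
Qed.

Lemma line_convex_affine r x (E : set rV) : line_convex E -> line_convex (affine_image r x E).
Proof.
move=> cE _ _ t [y Ey <-] [y' Ey' <-] t01; exists (y + t *: (y' - y)); first exact: cE.
by apply/rowP => i; rewrite !mxE; ring.
Qed.

Lemma cube_affine r x c0 (rho : R) (E : set rV) : 0 < r -> cube c0 rho `<=` E ->
  cube (r *: c0 + x) (r * rho) `<=` affine_image r x E.
Proof.
move=> r0 cE y yc; apply/affine_imageE; first by rewrite gt_eqF.
apply: cE => i; rewrite -(ler_pM2l r0) -{1}(gtr0_norm r0) -normrM.
have := yc i; rewrite !mxE; congr (`|_| <= _).
by field; rewrite gt_eqF.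
Qed.

End reconstruction.

Theorem corollary6p11 (R : realType) (d : nat) (hd : (2 <= d)%N)
    (E : set 'rV[R]_d) (bndE : bounded_set E)
    (cvxE : @convex_set R _ E)
    (intE : interior E !=set0) :
  reconstructible (magnified_copies E) d.+1.
Proof.
case: d hd E bndE cvxE intE => [//|n] n0 E bE /convex_set_line cE intE.
have [c0 [rho [rho0 c0E]]] := interior_cube intE.
have c0K : cube c0 rho `<=` closure E by move=> y /c0E; exact: subset_closure.
have bA r x : bounded_set (affine_image r x E) by exact: bounded_affine.
split.
  move=> _ [r [x [r1 ->]]]; rewrite -/(affine_image r x E).
  have r0 : 0 < r by lra.
  split; last by rewrite lebesgue_rV_vol ?ltry.
  apply: (@convex_measurable _ _ _ (r *: c0 + x) (r * rho)) => //.
  - exact: line_convex_affine.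
  - by rewrite mulr_gt0.
  - exact: cube_affine.
have [p pP] := choice (fun i => @exists_slab_test R n i _ _ _ n0 (bounded_closure bE)
  (@closed_closure _ E) (line_convex_closure cE) rho0 c0K).
(* Index 0 is the whole space, and each of the [d] coordinates has its own slab test: [d + 1]
   sets. *)
exists (fun i => if unlift ord0 i is Some j then (p j).2 else setT); split.
  by move=> i; case: unliftP => [j _|_]; [have [] := pP j|rewrite -setC0; apply: caratheodory_measurable_setC; exact: caratheodory_measurable_set0].
move=> _ _ [r [x [r1 ->]]] [s [y [s1 ->]]] AB.
rewrite -/(affine_image r x E) -/(affine_image s y E) in AB *.
have r0 : 0 < r by lra. have s0 : 0 < s by lra.
have rs : r = s.
  have := AB ord0; rewrite unlift_none !setIT => /(congr1 fine).
  rewrite -!/(vol _) !vol_affine//.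
  move=> /(mulIf (lt0r_neq0 (vol_gt0 intE bE)))/eqP.
  by rewrite eqrXn2 ?(ltW r0) ?(ltW s0)// => /eqP.
subst s; congr (affine_image r _ E).
apply/eqP; rewrite -subr_eq0; apply/eqP.
apply: (@dominant_inj _ _ (fun i => (p i).1)) => i; have [di _ pi] := pP i => //.
rewrite linB (pi r x y r1) ?subrr//.
rewrite -!(vol_affine_closure cE bE rho0 c0E)//.
by have := AB (lift ord0 i); rewrite liftK => /(congr1 fine).
Qed.
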